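(* Let $\alpha>3$ be a real number. If $\mathcal{S}(\alpha,2)$ admits a minimizer that is $0$-th nonsingular at $r=0$, then the best constant $\mathcal{S}^{-\frac12}(\alpha,2)$ is given by $$\mathcal{S}^{-\frac12}(\alpha,2)=\mathcal{P}^{-\frac12}\left[\frac{2\,\Gamma(\alpha+1)}{\Gamma(\frac{\alpha+1}{2})\,\Gamma(\frac{\alpha+1}{2})}\right]^{\frac{2}{\alpha+1}},\qquad \mathcal{P}=\prod_{h=-2}^{1}(\alpha+1+2h),$$ where $\Gamma$ is Euler's gamma function.
   Context: For $q\ge1$ and $\theta>-1$, $L^q_\theta$ is the space of measurable $u:(0,\infty)\to\mathbb{R}$ with $\|u\|_{L^q_\theta}=(\int_0^\infty|u|^q r^\theta dr)^{1/q}<\infty$. $AC^{1}_{loc}(0,\infty)$ is the set of differentiable functions $u$ on $(0,\infty)$ with $u'$ locally absolutely continuous. $\mathcal{D}^{2,2}_\infty(\alpha)$ is the completion of $\{u\in AC^{1}_{loc}(0,\infty): \lim_{r\to\infty}u(r)=\lim_{r\to\infty}u'(r)=0,\ u''\in L^2_\alpha\}$ under the norm $\|u''\|_{L^2_\alpha}$; since $\alpha-3>0$, its elements are identified with functions in $AC^{1}_{loc}(0,\infty)$ with $u^{(j)}\in L^2_{\alpha-2(2-j)}$ for $j=0,1,2$. $\Delta_\alpha u=r^{-\alpha}(r^\alpha u')'=u''+\frac{\alpha}{r}u'$ and $2^*=2^*(\alpha,2)=\frac{2(\alpha+1)}{\alpha-3}$. Set $$\mathcal{S}(\alpha,2)=\inf\left\{\frac{\|\Delta_\alpha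 u\|^2_{L^2_\alpha}}{\|u\|^2_{L^{2^*}_\alpha}}: u\in\mathcal{D}^{2,2}_\infty(\alpha)\setminus\{0\}\right\};$$ a minimizer is a nonzero $u\in\mathcal{D}^{2,2}_\infty(\alpha)$ attaining the infimum, and $\mathcal{S}^{-1/2}(\alpha,2)$ is the best constant of the embedding $\mathcal{D}^{2,2}_\infty(\alpha)\hookrightarrow L^{2^*}_\alpha$. Every minimizer is of class $C^4(0,\infty)$. A function $u$ is $0$-th nonsingular at $r=0$ if the (finite) limit $\lim_{r\to0^+}u(r)$ exists. *)

(* Defs.v *)
From mathcomp Require Import all_boot all_order all_algebra.
From mathcomp Require Import all_classical all_reals all_analysis.

Set Implicit Arguments.
Unset Strict Implicit.
Unset Printing Implicit Defensive.

Import Order.TTheory GRing.Theory Num.Theory.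
Import numFieldNormedType.Exports.

Local Open Scope ring_scope.
Local Open Scope classical_set_scope.

(* A function on (0, +oo) is represented by a function on R whose values
   outside (0, +oo) are irrelevant: everything below depends only on its
   restriction to (0, +oo). *)

Definition wLnorm (R : realType) (q theta : R) (u : R -> R) : \bar R :=
  ((\int[@lebesgue_measure R]_(r in `]0%R, +oo[)
      (`|u r| `^ q * r `^ theta)%:E) `^ q^-1)%E.

Definition wLspace (R : realType) (q theta : R) : set (R -> R) :=
  [set u : R -> R | measurable_fun (`]0, +oo[ : set R) u
         /\ (wLnorm q theta u < +oo)%E].

Definition abs_continuous (R : realType) (a b : R) (f : R -> R) : Prop :=
  forall e : R, 0 < e -> exists2 d : R, 0 < d &
    forall (n : nat) (x y : nat -> R),
      (forall i, (i < n)%N -> [/\ a <= x i, x i <= y i & y i <= b]) ->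
      trivIset `I_n (fun i => `]x i, y i[) ->
      \sum_(0 <= i < n) (y i - x i) < d ->
      \sum_(0 <= i < n) `|f (y i) - f (x i)| < e.

Definition AC1loc (R : realType) : set (R -> R) :=
  [set u : R -> R | (forall r : R, 0 < r -> derivable u r 1)
         /\ (forall a b : R, 0 < a -> a < b -> abs_continuous a b (derive1 u))].

(* For u in AC1loc, derive1n 2 u is the classical second derivative at almost
   every point of (0, +oo); elsewhere it is an irrelevant default value. *)

Definition D22_pre (R : realType) (alpha : R) : set (R -> R) :=
  [set u : R -> R | [/\ AC1loc u,
               u r @[r --> +oo%R] --> (0 : R),
               derive1 u r @[r --> +oo%R] --> (0 : R) &
               wLspace 2 alpha (derive1n 2 u)]].

Definition X22 (R : realType) (alpha : R) : set (R -> R) :=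
  [set u : R -> R | AC1loc u /\
     forall j : nat, (j <= 2)%N ->
       wLspace 2 (alpha - 2 * (2 - j%:R)) (derive1n j u)].

(* The completion of D22_pre under ||u''||_{L^2_alpha}, realized as its closure
   in X22.  For alpha > 3, Hardy's inequalities put D22_pre inside X22, on which
   ||u''|| is a norm equivalent to the complete norm
   sum_j ||u^(j)||_{L^2_(alpha - 2(2-j))}. *)
Definition D22 (R : realType) (alpha : R) : set (R -> R) :=
  [set u : R -> R | X22 alpha u /\
     exists v : nat -> R -> R, (forall n, D22_pre alpha (v n)) /\
       wLnorm 2 alpha (fun r => derive1n 2 (v n) r - derive1n 2 u r) @[n --> \oo]
         --> (0%E : \bar R)].

Definition Delta (R : realType) (alpha : R) (u : R -> R) : R -> R :=
  fun r => derive1n 2 u r + alpha / r * derive1 u r.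

Definition crit_exp (R : realType) (alpha : R) : R :=
  2 * (alpha + 1) / (alpha - 3).

Definition admissible (R : realType) (alpha : R) : set (R -> R) :=
  [set u : R -> R | D22 alpha u /\ exists2 r : R, 0 < r & u r != 0].

(* For alpha > 3, both norms are finite on D22 and the denominator is nonzero on admissible
   functions, so the extended-real conventions for 0^-1 and +oo^-1 play no
   role. *)
Definition quotient (R : realType) (alpha : R) (u : R -> R) : \bar R :=
  (wLnorm 2 alpha (Delta alpha u) ^+ 2
     / wLnorm (crit_exp alpha) alpha u ^+ 2)%E.

Definition S2 (R : realType) (alpha : R) : \bar R :=
  ereal_inf [set quotient alpha u | u in admissible alpha].

Definition minimizer (R : realType) (alpha : R) (u : R -> R) : Prop :=
  admissible alpha u /\ quotient alpha u = S2 alpha.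

Definition nonsingular0 (R : realType) (u : R -> R) : Prop :=
  exists l : R, u r @[r --> 0^'+] --> l.

Definition Gamma (R : realType) (s : R) : R :=
  \int[@lebesgue_measure R]_(t in `]0, +oo[) (t `^ (s - 1) * expR (- t)).

(* prod_{h=-2}^{1} (alpha + 1 + 2h), indexed by k = h + 2. *)
Definition P2 (R : realType) (alpha : R) : R :=
  \prod_(0 <= k < 4) (alpha + 1 + 2 * (k%:R - 2)).

(* Main.v *)
From HB Require Import structures.
Require Import Defs.
From mathcomp Require Import all_boot all_order all_algebra.
From mathcomp Require Import all_classical all_reals all_analysis.
From mathcomp Require Import measurable_realfun.
From mathcomp Require Import ring lra.
Import Order.TTheory GRing.Theory Num.Theory.
Import numFieldNormedType.Exports.
Set Implicit Arguments.
Unset Strict Implicit.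
Unset Printing Implicit Defensive.
Local Open Scope ring_scope.
Local Open Scope classical_set_scope.


(** Write [gam := (alpha - 3) / 2], [a := (alpha + 1) / 2] and let [p] be the
    critical exponent.  A minimizer [u] solves [Delta^2 u = lam |u|^(p-2) u], where
    [Delta] is the radial Laplacian [Delta alpha].  The theorem holds because the
    bubbles [l (1 + k r^2)^(- gam)] solve the same equation and leave no room for
    another bounded solution: a minimizer with a limit [l] at [0] is a bubble,
    and the constant is read off from the mass of a bubble, a Beta integral.

    The weak equation ([euler_lagrange]) comes from convexity: [|.|^p] lies above
    its tangents, so the mass of [u + e phi] is at least an affine function of
    [e], and the Sobolev inequality says that an explicit function of the single
    real variable [e] is minimal at [0].

    Regularity ([minimizer_radial_solution]) is obtained by testing with the
    potential of a ball, whose Laplacian is the indicator of [(0, y)].  The weak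
    equation then gives the flux [r^alpha u'] explicitly in terms of primitives of
    [r^s |u|^(p-2) u], up to a constant that vanishes because [u] is bounded.
    Differentiating this formula turns the equation into a first-order system
    whose four components have limits at the origin.  Here [u'] is only absolutely
    continuous, so the fundamental theorem of calculus is needed for such
    functions ([abs_continuous_FTC]); it follows from the Radon-Nikodym theorem
    applied to Stieltjes measures, and from Lebesgue differentiation.

    Uniqueness ([radial_solution_unique]): take two bounded solutions with the same
    value at [0].  If their Laplacians differ at [0], the monotonicity of the
    nonlinearity preserves the sign of the difference along the system, and the
    solutions drift apart quadratically, which boundedness forbids.  If the
    Laplacians agree, the system is a contraction in an exponentially weighted
    norm.  Thus [u] is the bubble with value [l] at [0] whose parameter satisfies
    [k^2 P2 = lam |l|^(p-2)] ([minimizer_is_bubble]).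

    Finally [k > 0], as otherwise [u] would be constant, against its decay at
    infinity.  With [T] the mass of [u] and [S] the infimum,
    [lam = S T^(2/p - 1)] and [T = |l|^p k^(-a) Gamma(a)^2 / (2 Gamma(2 a))]
    ([beta_rational_integral]); in [k^2 P2 = lam |l|^(p-2)] both [k] and [l] cancel,
    which determines [S] ([best_constantE]). *)


(** * Absolutely continuous functions *)

Section AC.
Context (R : realType).
Implicit Types (a b : R) (f : R -> R) (s : seq (R * R)).

(** Common endpoints are allowed, so that consecutive intervals of a partition
    qualify. *)
Definition nonoverlap (p q : R * R) : bool := (p.2 <= q.1) || (q.2 <= p.1).

Lemma nonoverlapC p q : nonoverlap p q = nonoverlap q p.
Proof. by rewrite /nonoverlap orbC. Qed.

Definition inside a b (p : R * R) : bool := [&& a <= p.1, p.1 <= p.2 & p.2 <= b].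

Definition total_length s := \sum_(p <- s) (p.2 - p.1).

Lemma inside_nonoverlap (p q c : R * R) :
  inside c.1 c.2 p -> nonoverlap c q -> nonoverlap p q.
Proof.
move=> /and3P[h1 h2 h3] /orP[h|h]; apply/orP; [left|right]; lra.
Qed.

(** Lists of intervals, unlike indexed families, can be concatenated and refined
    by induction. *)
Lemma abs_continuous_seq a b f : a <= b -> abs_continuous a b f ->
  forall e : R, 0 < e -> exists2 d : R, 0 < d & forall s,
    all (inside a b) s -> pairwise nonoverlap s -> total_length s < d ->
    \sum_(p <- s) `|f p.2 - f p.1| < e.
Proof.
move=> ab acf e e0; have [d d0 H] := acf e e0; exists d => // s sab seps sd.
have := H (size s) (fun i => (nth (a, a) s i).1) (fun i => (nth (a, a) s i).2).
rewrite -!(big_nth (a, a) predT (fun p : R * R => p.2 - p.1)).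
rewrite -!(big_nth (a, a) predT (fun p : R * R => `|f p.2 - f p.1|)).
apply => //.
  by move=> i iS; have /and3P[] := all_nthP (a, a) sab i iS.
apply/trivIsetP => i j /= iS jS ij.
wlog lij : i j iS jS ij / (i < j)%N.
  move=> W; case: (ltngtP i j) ij => // h _; last rewrite setIC; apply: W => //.
    by rewrite ltn_eqF.
  by rewrite ltn_eqF.
have sepij : nonoverlap (nth (a, a) s i) (nth (a, a) s j).
  by move/pairwiseP : seps => /(_ (a, a) i j iS jS lij).
apply/seteqP; split => // x /= []; rewrite !in_itv/= => /andP[h1 h2] /andP[h3 h4].
by case/orP: sepij => h; lra.
Qed.

Lemma variation_pairs a b f (l : seq R) : itv_partition a b l ->
  variation a b f l = \sum_(p <- zip (a :: l) l) `|f p.2 - f p.1|.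
Proof.
move=> abl; rewrite variation_zip //.
elim: l a {abl} => [a|z l IH a]; first by rewrite /= !big_nil.
by rewrite /= !big_cons /= IH.
Qed.

Lemma partition_pairs a b (l : seq R) : itv_partition a b l ->
  [/\ all (inside a b) (zip (a :: l) l), pairwise nonoverlap (zip (a :: l) l) &
      total_length (zip (a :: l) l) = b - a].
Proof.
elim: l a => [a /itv_partition_nil ->|z l IH a abl].
  by split=> //; rewrite /total_length /= big_nil subrr.
have [h1 h2 h3] := IH z (itv_partition_cons abl).
have az : a < z by case: abl => /= /andP[].
have zb : z <= b by exact: (itv_partition_le (itv_partition_cons abl)).
split => /=.
- rewrite /inside/= lexx (ltW az) zb /=.
  apply: sub_all h1 => p /and3P[? ? ?]; apply/and3P; split => //.
  by apply: le_trans (ltW az) _.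
- rewrite h2 andbT; apply: sub_all h1 => p /and3P[? ? ?].
  by apply/orP; left.
- rewrite /total_length big_cons /= -/(total_length _) /= h3; lra.
Qed.

Local Open Scope ereal_scope.

Lemma sum_TV_ge0 a b f s : all (inside a b) s ->
  0 <= \sum_(p <- s) total_variation p.1 p.2 f.
Proof.
move=> /allP h; rewrite big_seq; apply: sume_ge0 => p /h /and3P[_ ? _].
exact: total_variation_ge0.
Qed.

(** A total variation is a supremum over partitions, and cutting the intervals of
    a list along partitions keeps the total length: the same [d] works. *)
Lemma abs_continuous_TV a b f : (a <= b)%R -> abs_continuous a b f ->
  forall e : R, (0 < e)%R -> exists2 d : R, (0 < d)%R & forall s,
    all (inside a b) s -> pairwise nonoverlap s -> (total_length s < d)%R ->
    \sum_(p <- s) total_variation p.1 p.2 f <= e%:E.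
Proof.
move=> ab acf e e0; have [d d0 H] := abs_continuous_seq ab acf e0.
exists d => // cs csab sepcs csd.
(* Strengthened for induction: the intervals of [s] have already been cut, those of
   [cs] still count with their total variation. *)
suff : forall s, all (inside a b) (cs ++ s) -> pairwise nonoverlap (cs ++ s) ->
    (total_length (cs ++ s) < d)%R ->
    \sum_(p <- cs) total_variation p.1 p.2 f +
      (\sum_(p <- s) `|f p.2 - f p.1|)%R%:E <= e%:E.
  move=> /(_ [::]); rewrite cats0 big_nil adde0; exact.
elim: cs {csab sepcs csd} => [s h1 h2 h3|c cs IH s].
  by rewrite big_nil add0e lee_fin ltW// H.
rewrite cat_cons /= => /andP[cab csab] /andP[sepc seps] ld.
have ld' : (total_length (cs ++ s) < d)%R.
  apply: le_lt_trans ld; rewrite /total_length big_cons lerDr subr_ge0.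
  by case/and3P: cab.
have IHs := IH s csab seps ld'.
rewrite big_cons.
have c12 : (c.1 <= c.2)%R by case/and3P: cab.
have cs0 : 0 <= \sum_(p <- cs) total_variation p.1 p.2 f.
  by apply: sum_TV_ge0; move: csab; rewrite all_cat => /andP[h _]; exact: h.
set X := \sum_(p <- cs) _ in IHs cs0 *; set Y := (\sum_(p <- s) _)%R in IHs *.
have Xfin : X \is a fin_num.
  rewrite ge0_fin_numE//; apply: (@le_lt_trans _ _ e%:E); last exact: ltry.
  apply: le_trans IHs; rewrite leeDl// lee_fin; exact: sumr_ge0.
rewrite -addeA -leeBrDr; last by rewrite fin_numD Xfin.
apply: ge_ereal_sup => _ [v [l pl <-] <-].
have [l1 l2 l3] := partition_pairs pl.
rewrite leeBrDr; last by rewrite fin_numD Xfin.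
rewrite addeCA -EFinD variation_pairs// -big_cat /=.
apply: IH.
- move: csab; rewrite !all_cat => /andP[-> ->]; rewrite andbT /=.
  apply: sub_all l1 => p /and3P[? ? ?]; case/and3P: cab => ? ? ?.
  by apply/and3P; split => //; lra.
- move: seps sepc; rewrite !pairwise_cat all_cat => /and3P[h1 h2 h3] /andP[h4 h5].
  rewrite h2 l2 h3 /= !andbT allrel_catr h1 andbT.
  apply/andP; split; apply/allrelP => p q.
    move=> pcs ql; rewrite nonoverlapC; apply: (inside_nonoverlap (c := c)).
      by move/allP: l1; apply.
    by move/allP: h4; apply.
  move=> ql ps; apply: (inside_nonoverlap (c := c)).
    by move/allP: l1; apply.
  by move/allP: h5; apply.
- apply: le_lt_trans ld; rewrite /total_length !big_cat big_cons big_cat /=.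
  by rewrite -[X in (_ + (X + _) <= _)%R]/(total_length _) l3; lra.
Qed.

End AC.


(** * Densities of absolutely continuous functions *)

Section StieltjesAC.
Context (R : realType).
Implicit Types (a b : R) (s : seq (R * R)).

(** Replaces a component [I] of an open set by an interval inside [[a, b]] that
    carries the same part of a measure supported by [`]a, b]]; the last clause
    fixes a degenerate choice when [I] misses [`]a, b]]. *)
Lemma open_interval_trace a b (I : set R) : a <= b -> open I -> is_interval I ->
  exists p : R * R, [/\ inside a b p, I `&` `]a, b] `<=` `]p.1, p.2],
    `]p.1, p.2[ `<=` I & (I `&` `]a, b] = set0 -> p = (a, a))].
Proof.
move=> ab oI iI; have [->|/set0P [c [Ic Jc]]] := eqVneq (I `&` `]a, b]) set0.
  exists (a, a); split => //; rewrite /inside /= ?lexx ?ab //.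
  by move=> x /=; rewrite in_itv/= => /andP[h1 h2]; lra.
set K := I `&` `]a, b].
have Kc : K c by [].
have lbK : lbound K a by move=> z [_] /=; rewrite in_itv/= => /andP[/ltW].
have ubK : ubound K b by move=> z [_] /=; rewrite in_itv/= => /andP[].
have infc : inf K <= c by apply: ge_inf => //; exists a.
have supc : c <= sup K by apply: ub_le_sup => //; exists b.
have K0 : K !=set0 by exists c.
exists (inf K, sup K); split => /=.
- rewrite /inside /= (le_trans infc supc) andTb.
  by apply/andP; split; [exact: lb_le_inf|exact: ge_sup].
- move=> z Kz /=; rewrite in_itv /=; apply/andP; split; last first.
    by apply: ub_le_sup => //; exists b.
  have infz : inf K <= z by apply: ge_inf => //; exists a.
  rewrite lt_neqAle infz andbT; apply/eqP => E.
  have [Iz] := Kz; rewrite /= in_itv/= => /andP[az zb].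
  have [e /= e0 He] := oI z Iz.
  pose t := Num.max ((a + z) / 2) (z - e / 2).
  have tz : t < z by rewrite /t gt_max; apply/andP; split; lra.
  have ta : a < t by rewrite /t lt_max; apply/orP; left; lra.
  have te : z - e / 2 <= t by rewrite /t le_max lexx orbT.
  have Kt : K t.
    split; last by rewrite /= in_itv/= ta /=; lra.
    by apply: He; rewrite /= ger0_norm; lra.
  have : inf K <= t by apply: ge_inf => //; exists a.
  by lra.
- move=> z /=; rewrite in_itv/= => /andP[iz zs].
  have [x [Ix _] xz] := inf_lt K0 iz.
  have [y [Iy _] zy] := sup_gt K0 zs.
  by apply: (iI x y Ix Iy); rewrite (ltW xz) (ltW zy).
- by move=> E; rewrite E in Kc.
Qed.

Definition mk_cumulative (F : R -> R) (nd : nondecreasing F)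
    (rc : right_continuous F) : cumulative R R :=
  HB.pack F (isCumulative.Build R _ R F nd rc).

Lemma stieltjes_itvoc (F : cumulative R R) (x y : R) : x <= y ->
  lebesgue_stieltjes_measure F `]x, y]%classic = (F y - F x)%:E.
Proof.
move=> xy.
rewrite /lebesgue_stieltjes_measure/= /measure_extension/=.
rewrite measurable_mu_extE; last exact: is_ocitv.
exact: wlength_itv_bnd.
Qed.

Local Notation mu := (@lebesgue_measure R).

(** A null set lies in an open set of small length, over whose components [F]
    increases by a small total amount.  So the Stieltjes measure of [F] is
    dominated by the Lebesgue measure, and [rho] is its Radon-Nikodym density. *)
Lemma monotone_density a b (F : R -> R) : a <= b ->
  nondecreasing F -> right_continuous F ->
  (forall e : R, 0 < e -> exists2 d : R, 0 < d & forall s,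
    all (inside a b) s -> pairwise (@nonoverlap R) s -> total_length s < d ->
    \sum_(p <- s) (F p.2 - F p.1) <= e) ->
  exists rho : R -> R, mu.-integrable `]a, b] (EFin \o rho) /\
    forall x, a <= x <= b -> F x - F a = \int[mu]_(t in `]a, x]) rho t.
Proof.
move=> ab ndF rcF acF.
pose G := mk_cumulative ndF rcF.
pose nu0 : {measure set (g_sigma_algebraType R.-ocitv.-measurable) -> \bar R} :=
  lebesgue_stieltjes_measure G.
have mab : measurable (`]a, b]%classic : set (g_sigma_algebraType R.-ocitv.-measurable)) by exact: measurable_itv.
have nu0ab : (nu0 `]a, b]%classic < +oo)%E.
  by rewrite [X in (X < _)%E](@stieltjes_itvoc G) ?ltry.
pose nu : {finite_measure set (g_sigma_algebraType R.-ocitv.-measurable) -> \bar R} :=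
  mfrestr mab nu0ab.
have nuE A : nu A = nu0 (A `&` `]a, b]) by [].
have ac : nu `<< mu.
  apply/null_content_dominatesP => A mA A0.
  apply/eqP; rewrite eq_le measure_ge0 andbT.
  apply/lee_addgt0Pr => e e0; rewrite add0e.
  have [d d0 Hd] := acF e e0.
  have := @lebesgue_regularity_outer R A d mA.
  rewrite A0 ltry => /(_ isT d0)[U [oU AU muU]].
  have mU : measurable U by exact: open_measurable.
  have {}muU : (mu U < d%:E)%E.
    have -> : U = A `|` (U `\` A) by rewrite setDUK.
    by rewrite setUC measureU0 //; exact: measurableD.
  (* The components of [U], traced on [`]a, b]]. *)
  pose I := open_disjoint_itv oU.
  have oI k : open (I k) := @open_disjoint_itv_open _ _ oU k.
  have iI k := @open_disjoint_itv_is_interval _ _ oU k.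
  have tI := @open_disjoint_itv_trivIset _ _ oU.
  have UI := @open_disjoint_itv_bigcup _ _ oU.
  have mI k : measurable (I k) by exact: open_measurable.
  have /choice [P HP] := fun k => open_interval_trace ab (oI k) (iI k).
  apply: (@le_trans _ _ (nu (\bigcup_k (I k)))).
    by apply: le_measure; rewrite ?inE // -UI.
  rewrite measure_bigcup//=; last by move=> i _; exact: mI.
  apply: lime_le; first exact: is_cvg_nneseries.
  apply: nearW => n; rewrite big_mkcond /=.
  apply: (@le_trans _ _ (\sum_(0 <= k < n) (F (P k).2 - F (P k).1)%:E)%E).
    apply: lee_sum => k _; rewrite mem_setT /=.
    have [/and3P[h1 h2 h3] h4 h5 h6] := HP k.
    rewrite -(@stieltjes_itvoc G)//.
    apply: le_measure => //; rewrite inE; last exact: measurable_itv.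
    exact: (measurableI _ _ (mI k) mab).
  rewrite sumEFin lee_fin.
  have -> : \sum_(0 <= k < n) (F (P k).2 - F (P k).1) =
      \sum_(p <- map P (iota 0 n)) (F p.2 - F p.1).
    by rewrite big_map /index_iota subn0.
  apply: Hd.
  - by apply/allP => p /mapP[k _ ->]; have [] := HP k.
  - apply/(pairwiseP (a, a)) => i j.
    rewrite !inE !size_map !size_iota => iN jN ij.
    rewrite !(nth_map 0%N) ?size_iota // !nth_iota // !add0n.
    have [/and3P[i1 i2 i3] i4 i5 i6] := HP i.
    have [/and3P[j1 j2 j3] j4 j5 j6] := HP j.
    have [K0|Ki] := eqVneq (I i `&` `]a, b]) set0.
      by rewrite /nonoverlap (i6 K0) /= j1.
    have [K0|Kj] := eqVneq (I j `&` `]a, b]) set0.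
      by rewrite /nonoverlap (j6 K0) /= i1 orbT.
    rewrite /nonoverlap leNgt; apply/orP.
    case: (boolP ((P j).1 < (P i).2)) => h /=; [right|by left].
    rewrite leNgt; apply/negP => h'.
    have /set0P[z /i4] := Ki; rewrite /= in_itv/= => /andP[z1 z2].
    have /set0P[w /j4] := Kj; rewrite /= in_itv/= => /andP[w1 w2].
    pose lo := Num.max (P i).1 (P j).1; pose hi := Num.min (P i).2 (P j).2.
    have lohi : lo < hi by rewrite /lo /hi gt_max !lt_min; lra.
    have [lo1 lo2] : (P i).1 <= lo /\ (P j).1 <= lo by rewrite /lo !le_max !lexx orbT.
    have [hi1 hi2] : hi <= (P i).2 /\ hi <= (P j).2 by rewrite /hi !ge_min !lexx orbT.
    have Ii : I i ((lo + hi) / 2) by apply: i5; rewrite /= in_itv/=; lra.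
    have Ij : I j ((lo + hi) / 2) by apply: j5; rewrite /= in_itv/=; lra.
    have : i <> j by move=> E; rewrite E ltnn in ij.
    by apply; apply: (tI i j) => //; exists ((lo + hi) / 2).
  - rewrite -lte_fin; apply: le_lt_trans muU.
    rewrite UI measure_bigcup//=; last by move=> i _; exact: mI.
    apply: (@le_trans _ _ (\sum_(0 <= k < n) mu (I k))%E); last first.
      rewrite (@eq_eseriesl _ _ xpredT); last by move=> i; rewrite mem_setT.
      exact: nneseries_lim_ge.
    rewrite /total_length big_map /index_iota subn0 -sumEFin.
    apply: lee_sum => k _.
    have [/and3P[h1 h2 h3] h4 h5 h6] := HP k.
    apply: (@le_trans _ _ (mu `](P k).1, (P k).2[%classic)).
      rewrite lebesgue_measure_itv /= lte_fin.
      by case: ltP => [_|]; rewrite ?EFinB// lee_fin; lra.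
    apply: le_measure => //; rewrite inE; [exact: measurable_itv|exact: mI].
have [f [f0 ffin fint fE]] := radon_nikodym_sigma_finite ac.
have fK : EFin \o (fine \o f) = f by apply/funext => x /=; rewrite fineK.
exists (fine \o f); split.
  by rewrite fK; exact: integrableS fint.
move=> x /andP[ax xb].
have := fE `]a, x]%classic (measurable_itv _).
rewrite nuE setIidl; last first.
  by move=> z /=; rewrite !in_itv/= => /andP[-> h]; lra.
rewrite [nu0 _](@stieltjes_itvoc G)// => h.
apply: EFin_inj; rewrite h /Rintegral.
under [in RHS]eq_integral do rewrite fineK//.
rewrite fineK//; apply: integrable_fin_num; first exact: measurable_itv.
exact: integrableS fint.
Qed.

End StieltjesAC.


Lemma ae_eq_integrable d (T : measurableType d) (R : realType)
    (mu : {measure set T -> \bar R}) (D : set T) (f g : T -> \bar R) : measurable D ->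
  mu.-integrable D f -> measurable_fun D g -> ae_eq mu D f g ->
  mu.-integrable D g.
Proof.
move=> mD /integrableP[mf foo] mg fg; apply/integrableP; split => //.
rewrite (_ : (\int[mu]_(x in D) `|g x|)%E = (\int[mu]_(x in D) `|f x|)%E)//.
apply: ae_eq_integral => //; [exact: measurableT_comp..|].
case: fg => N [mN N0 sub]; exists N; split => // x /= nx; apply: sub => /= h.
by apply: nx => Dx; rewrite h.
Qed.

Section ACdensity.
Context (R : realType).
Implicit Types (a b : R) (s : seq (R * R)).

Local Notation mu := (@lebesgue_measure R).

(** Composing with [clamp a b] extends a function on [[a, b]] by constants, as
    Stieltjes measures require functions on the whole line. *)
Definition clamp a b (x : R) : R := Num.max a (Num.min x b).

Lemma clamp_itv a b x : a <= b -> a <= clamp a b x <= b.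
Proof.
by move=> ab; rewrite /clamp le_max lexx /= ge_max ab /= ge_min lexx orbT.
Qed.

Lemma clamp_id a b x : a <= x <= b -> clamp a b x = x.
Proof. by move=> /andP[ax xb]; rewrite /clamp (min_idPl xb) (max_idPr ax). Qed.

Lemma clamp_le a b x y : a <= b -> x <= y -> clamp a b x <= clamp a b y.
Proof.
move=> ab xy; rewrite /clamp.
by case: (leP y b) => ?; case: (leP x b) => ?; case: (leP a x) => ?;
  case: (leP a y) => ?; case: (leP a b) => ?; lra.
Qed.

Lemma clamp_lip a b x y : a <= b -> x <= y ->
  clamp a b y - clamp a b x <= y - x.
Proof.
move=> ab xy; rewrite /clamp.
by case: (leP y b) => ?; case: (leP x b) => ?; case: (leP a x) => ?;
  case: (leP a y) => ?; case: (leP a b) => ?; lra.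
Qed.

Lemma monotone_density_itv a b (H : R -> R) : a <= b ->
  (forall x y, a <= x -> x <= y -> y <= b -> H x <= H y) ->
  (forall e : R, 0 < e -> exists2 d : R, 0 < d & forall s,
    all (inside a b) s -> pairwise (@nonoverlap R) s -> total_length s < d ->
    \sum_(p <- s) (H p.2 - H p.1) <= e) ->
  exists rho : R -> R, mu.-integrable `]a, b] (EFin \o rho) /\
    forall x, a <= x <= b -> H x - H a = \int[mu]_(t in `]a, x]) rho t.
Proof.
move=> ab ndH acH; pose F := H \o clamp a b.
have FE x : a <= x <= b -> F x = H x by move=> h; rewrite /F /= clamp_id.
have ndF : nondecreasing F.
  move=> x y xy; apply: ndH; last 1 first.
  - by have /andP[] := clamp_itv y ab.
  - by have /andP[] := clamp_itv x ab.
  - exact: clamp_le.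
have rcF : right_continuous F.
  move=> x; apply/cvgrPdist_le => e e0.
  have [d d0 Hd] := acH e e0.
  near=> y.
  have xy : x <= y by near: y; exact: nbhs_right_ge.
  have yd : y - x < d.
    have : y < x + d by near: y; apply: nbhs_right_lt; rewrite ltrDl.
    lra.
  rewrite distrC ger0_norm; last by rewrite subr_ge0; exact: ndF.
  have := Hd [:: (clamp a b x, clamp a b y)].
  rewrite /= /total_length !big_cons !big_nil /= !addr0; apply => //.
    have /andP[h1 _] := clamp_itv x ab; have /andP[_ h2] := clamp_itv y ab.
    by rewrite /inside /= h1 h2 clamp_le.
  by apply: le_lt_trans yd; exact: clamp_lip.
have acF e : 0 < e -> exists2 d : R, 0 < d & forall s,
    all (inside a b) s -> pairwise (@nonoverlap R) s -> total_length s < d ->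
    \sum_(p <- s) (F p.2 - F p.1) <= e.
  move=> e0; have [d d0 Hd] := acH e e0; exists d => // s h1 h2 h3.
  have <- : \sum_(p <- s) (H p.2 - H p.1) = \sum_(p <- s) (F p.2 - F p.1).
    rewrite !big_seq; apply: eq_bigr => p ps.
    have /and3P[p1 p2 p3] := allP h1 p ps.
    by rewrite !FE// ?p1 ?p3 /=; lra.
  exact: Hd.
have [rho [rint rE]] := monotone_density ab ndF rcF acF.
exists rho; split => // x xab.
by rewrite -rE// !FE// lexx ab.
Unshelve. all: by end_near. Qed.

(** Move from [a] by steps shorter than the [d] attached to [1]: each of them adds
    at most [1] to the variation. *)
Lemma abs_continuous_TV_fin a b (f : R -> R) : a <= b -> abs_continuous a b f ->
  forall x, a <= x <= b -> total_variation a x f \is a fin_num.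
Proof.
move=> ab acf; have [d d0 Hd] := abs_continuous_TV ab acf ltr01.
suff H : forall n x, a <= x <= b -> x <= a + n%:R * (d / 2) ->
    total_variation a x f \is a fin_num.
  move=> x xab; apply: (H (Num.Def.archi_bound ((x - a) / (d / 2)))) => //.
  rewrite -lerBlDl -ler_pdivrMr; last lra.
  rewrite ltW// archi_boundP// divr_ge0 ?subr_ge0//; last lra.
  by case/andP: xab.
elim=> [|n IH] x /andP[ax xb] h.
  have -> : x = a by lra.
  by rewrite total_variationxx.
pose z := Num.max a (x - d / 2).
have az : a <= z by rewrite /z le_max lexx.
have zx : z <= x by rewrite /z ge_max ax /=; lra.
have xz : x - z < d.
  have : x - d / 2 <= z by rewrite /z le_max lexx orbT.
  lra.
rewrite (total_variationD f az zx) fin_numD; apply/andP; split.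
  apply: IH; first by rewrite az /=; lra.
  rewrite /z ge_max; apply/andP; split.
    by rewrite lerDl mulr_ge0//; lra.
  by move: h; rewrite -natr1; lra.
rewrite ge0_fin_numE; last exact: total_variation_ge0.
have := Hd [:: (z, x)]; rewrite /= big_cons big_nil adde0 /= => h1.
apply: (@le_lt_trans _ _ 1%:E); last exact: ltry.
apply: h1 => //; first by rewrite /inside /= az zx xb.
by rewrite /total_length big_cons big_nil addr0.
Qed.

(** Jordan decomposition: with [V] the variation of [f] from [a], both [V] and
    [V - f] are nondecreasing and absolutely continuous. *)
Lemma abs_continuous_density a b (f : R -> R) : a <= b -> abs_continuous a b f ->
  exists rho : R -> R, mu.-integrable `]a, b] (EFin \o rho) /\
    forall x, a <= x <= b -> f x - f a = \int[mu]_(t in `]a, x]) rho t.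
Proof.
move=> ab acf; pose V x := fine (total_variation a x f).
have Vfin := abs_continuous_TV_fin ab acf.
have VB x y : a <= x -> x <= y -> y <= b ->
    (V y - V x)%:E = total_variation x y f.
  move=> ax xy yb.
  have h1 : total_variation a x f \is a fin_num by apply: Vfin; rewrite ax /=; lra.
  have h2 : total_variation a y f \is a fin_num by apply: Vfin; rewrite yb andbT; lra.
  have := total_variationD f ax xy => E.
  have h3 : total_variation x y f \is a fin_num.
    by move: h2; rewrite E fin_numD => /andP[].
  by rewrite /V E fineD// addrAC subrr add0r fineK.
have fV x y : a <= x -> x <= y -> y <= b -> `|f y - f x| <= V y - V x.
  move=> ax xy yb; rewrite -lee_fin VB//; exact: total_variation_ge.
have acV e : 0 < e -> exists2 d : R, 0 < d & forall s,
    all (inside a b) s -> pairwise (@nonoverlap R) s -> total_length s < d ->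
    \sum_(p <- s) (V p.2 - V p.1) <= e.
  move=> e0; have [d d0 Hd] := abs_continuous_TV ab acf e0.
  exists d => // s h1 h2 h3; rewrite -lee_fin -sumEFin.
  apply: le_trans (Hd s h1 h2 h3).
  rewrite !big_seq; apply: lee_sum => p ps.
  by have /and3P[p1 p2 p3] := allP h1 p ps; rewrite VB.
have [r1 [i1 E1]] : exists rho : R -> R, mu.-integrable `]a, b] (EFin \o rho) /\
    forall x, a <= x <= b -> V x - V a = \int[mu]_(t in `]a, x]) rho t.
  apply: monotone_density_itv => // x y ax xy yb.
  by rewrite -subr_ge0; apply: le_trans (fV x y ax xy yb).
have [r2 [i2 E2]] : exists rho : R -> R, mu.-integrable `]a, b] (EFin \o rho) /\
    forall x, a <= x <= b ->
    (V x - f x) - (V a - f a) = \int[mu]_(t in `]a, x]) rho t.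
  apply: (@monotone_density_itv a b (fun x => V x - f x)) => //.
    move=> x y ax xy yb; have := fV x y ax xy yb.
    by have := ler_norm (f y - f x); lra.
  move=> e e0; have e20 : 0 < e / 2 by lra.
  have [d d0 Hd] := acV _ e20.
  exists d => // s h1 h2 h3; have := Hd s h1 h2 h3.
  suff : \sum_(p <- s) (V p.2 - f p.2 - (V p.1 - f p.1)) <=
      2 * \sum_(p <- s) (V p.2 - V p.1) by lra.
  rewrite mulr_sumr !big_seq; apply: ler_sum => p ps.
  have /and3P[p1 p2 p3] := allP h1 p ps.
  have := fV _ _ p1 p2 p3; have := ler_norm (- (f p.2 - f p.1)).
  by rewrite normrN; lra.
exists (fun x => r1 x - r2 x); split.
  have -> : EFin \o (fun x => r1 x - r2 x) = ((EFin \o r1) \- (EFin \o r2))%E.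
    by apply/funext => x /=; rewrite EFinB.
  exact: integrableB.
move=> x /andP[ax xb].
have sub : (`]a, x] : set R) `<=` `]a, b].
  by move=> z /=; rewrite !in_itv/= => /andP[-> h]; lra.
rewrite RintegralB//; last 2 first.
- exact: integrableS i1.
- exact: integrableS i2.
rewrite -E1 -?E2 ?ax ?xb//; lra.
Qed.

(** Lebesgue differentiation applied to the density of [f]. *)
Theorem abs_continuous_ae_derivable a b (f : R -> R) :
  a <= b -> abs_continuous a b f ->
  exists rho : R -> R, [/\ mu.-integrable `]a, b] (EFin \o rho),
    f b - f a = \int[mu]_(t in `]a, b]) rho t &
    {ae mu, forall x, a < x < b -> derivable f x 1 /\ derive1 f x = rho x}].
Proof.
move=> ab acf; have [rho [rint rE]] := abs_continuous_density ab acf.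
exists rho; split => //; first by rewrite rE// lexx ab.
pose g := rho \_ `]a, b].
have gint : mu.-integrable setT (EFin \o g).
  rewrite /g -restrict_EFin.
  by have [h _] := integrable_mkcond (mu := mu) (EFin \o rho) (measurable_itv `]a, b]%R); exact: h.
have /(_ (BRight a)) := @FTC1 R g.
have giS (A : set R) : measurable A -> mu.-integrable A (EFin \o g).
  by move=> mA; exact: integrableS gint.
move=> /(_ (fun y => giS _ (measurable_itv _))).
have gloc : locally_integrable setT g.
  exact: (open_integrable_locally openT gint).
move=> /(_ gloc); apply: filterS; first exact: (ae_filter_ringOfSetsType mu).
move=> x + /andP[ax xb].
set G := fun y => _.
have ax' : (BRight a < BRight x)%O by rewrite bnd_simp.
move=> /(_ ax')[dG eG].
have fG : {near x, (fun y => f a + G y) =1 f}.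
  near=> y.
  have ay : a < y by near: y; apply: lt_nbhsr.
  have yb : y < b by near: y; apply: lt_nbhsl.
  have := rE y; rewrite (ltW ay) (ltW yb) => /(_ isT) E.
  rewrite [f y](_ : _ = f a + \int[mu]_(t in `]a, y]) rho t); last by rewrite -E; ring.
  congr (_ + _); apply: eq_Rintegral => z; rewrite inE /= in_itv/= => /andP[z1 z2].
  by rewrite /g patchE mem_set//= in_itv/= z1 /=; lra.
have dG' : derivable (fun y => f a + G y) x 1 by apply: derivableD.
split; first exact: near_eq_derivable fG dG'.
rewrite derive1E -(near_eq_derive _ fG)// deriveD//.
rewrite derive_cst add0r -derive1E eG /g patchE mem_set//=.
by rewrite in_itv/= ax ltW.
Unshelve. all: by end_near. Qed.

(** [f] is differentiable almost everywhere, so [g] has to agree with its derivative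
    only at the points where that exists. *)
Corollary abs_continuous_FTC a b (f g : R -> R) :
  a <= b -> abs_continuous a b f -> measurable_fun `]a, b] g ->
  (forall x, a < x < b -> derivable f x 1 -> derive1 f x = g x) ->
  mu.-integrable `]a, b] (EFin \o g) /\ f b - f a = \int[mu]_(t in `]a, b]) g t.
Proof.
move=> ab acf mg fg.
have [rho [rint rE rae]] := abs_continuous_ae_derivable ab acf.
have ae1 : ae_eq mu `]a, b]%classic (EFin \o rho) (EFin \o g).
  have aeb : {ae mu, forall x : R, x != b}.
    exists [set b]; split; [exact: measurable_set1|exact: lebesgue_measure_set1|].
    by move=> x /= /negP; rewrite negbK => /eqP.
  apply: filterS2 rae aeb; first exact: (ae_filter_ringOfSetsType mu).
  move=> x h xb /=; rewrite in_itv/= => /andP[ax xb'].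
  have xab : a < x < b by rewrite ax lt_neqAle xb xb'.
  by have [dx <-] := h xab; rewrite fg.
have mab : measurable (`]a, b]%classic : set R) by exact: measurable_itv.
have mrho : measurable_fun `]a, b]%classic (EFin \o rho) by case/integrableP: rint.
have mg' : measurable_fun `]a, b]%classic (EFin \o g) by exact/measurable_EFinP.
split; first by apply: ae_eq_integrable ae1; [exact: mab|exact: rint|exact: mg'].
rewrite rE /Rintegral; congr fine.
by apply: ae_eq_integral ae1; [exact: mab|exact: mrho|exact: mg'].
Qed.

End ACdensity.


(** * Measurability of the derivative *)

Section MeasurableDerivative.
Context (R : realType).
Implicit Types (f : R -> R).

Definition slope f (r h : R) : R := h^-1 * (f (h + r) - f r).

(** The Cauchy criterion for difference quotients at [r], at one scale; for
    continuous [f] it defines a closed set, so that the set of points of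
    differentiability is Borel. *)
Definition slopes_close f (n m : nat) : set R :=
  [set r | forall h k : R, 0 < `|h| < m.+1%:R^-1 -> 0 < `|k| < m.+1%:R^-1 ->
    `|slope f r h - slope f r k| <= n.+1%:R^-1].

Lemma derivableE_slopes f r :
  derivable f r 1 <-> (\bigcap_n \bigcup_m slopes_close f n m) r.
Proof.
have E : (fun h => h^-1 *: (f (h *: 1 + r) - f r)) = slope f r.
  by apply/funext => h; rewrite /slope -[h *: 1]/(h * 1) mulr1.
rewrite /derivable E; split.
- move=> /cvg_ex[l /cvgrPdist_lt sl] n _.
  have e0 : 0 < (n.+1%:R^-1 / 2 : R) by rewrite divr_gt0// invr_gt0 ltr0n.
  have [d /= d0 Hd] := sl _ e0.
  have [m md] : exists m : nat, m.+1%:R^-1 < d.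
    exists (Num.Def.archi_bound d^-1).
    rewrite invf_plt ?posrE ?ltr0n//.
    apply: lt_le_trans (archi_boundP _) _; first by rewrite invr_ge0 ltW.
    by rewrite ler_nat.
  exists m => // h k /andP[h0 hm] /andP[k0 km].
  have Hh : `|l - slope f r h| < n.+1%:R^-1 / 2.
    apply: Hd; first by rewrite /= sub0r normrN (lt_trans hm).
    by rewrite -normr_gt0.
  have Hk : `|l - slope f r k| < n.+1%:R^-1 / 2.
    apply: Hd; first by rewrite /= sub0r normrN (lt_trans km).
    by rewrite -normr_gt0.
  rewrite (_ : _ - _ = (l - slope f r k) - (l - slope f r h)); last by ring.
  apply: le_trans (ler_normB _ _) _.
  by move: Hh Hk; set e := n.+1%:R^-1; lra.
- move=> H; apply/cauchy_cvgP/cauchy_exP => e e0.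
  pose n := Num.Def.archi_bound e^-1.
  have ne : n.+1%:R^-1 < e.
    rewrite invf_plt ?posrE ?ltr0n//.
    apply: lt_le_trans (archi_boundP _) _; first by rewrite invr_ge0 ltW.
    by rewrite ler_nat.
  have [m _ Hm] := H n I.
  have m0 : 0 < (m.+1%:R^-1 : R) by rewrite invr_gt0 ltr0n.
  exists (slope f r (m.+1%:R^-1 / 2)).
  exists m.+1%:R^-1 => //= h /=; rewrite sub0r normrN => hm h0.
  apply: le_lt_trans ne; apply: Hm.
    by move: m0; set e' := m.+1%:R^-1 => m0; rewrite ger0_norm; lra.
  by rewrite normr_gt0 h0.
Qed.

Lemma derive1_slope f r : derivable f r 1 ->
  slope f r n.+1%:R^-1 @[n --> \oo] --> derive1 f r.
Proof.
move=> df; have E : (fun h => h^-1 *: (f (h *: 1 + r) - f r)) = slope f r.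
  by apply/funext => h; rewrite /slope -[h *: 1]/(h * 1) mulr1.
have : slope f r h @[h --> 0^'] --> derive1 f r by rewrite derive1E -E; exact: df.
move=> /cvgrPdist_lt sl; apply/cvgrPdist_lt => e e0.
have [d /= d0 Hd] := sl _ e0; near=> n.
have nd : `|n.+1%:R^-1 : R| < d.
  rewrite ger0_norm ?invr_ge0//; near: n; exact: near_infty_natSinv_lt (PosNum d0).
by apply: Hd; rewrite /= ?sub0r ?normrN// invr_eq0.
Unshelve. all: by end_near. Qed.

Lemma measurable_derive1 f : continuous f -> measurable_fun setT (derive1 f).
Proof.
move=> cf.
pose E := \bigcap_n \bigcup_m slopes_close f n m.
have cs h : continuous (slope f ^~ h).
  move=> r; rewrite /slope; apply: cvgM; first exact: cvg_cst.
  apply: cvgB; last exact: cf.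
  apply: (@continuous_comp _ _ _ (fun r => h + r) f); last exact: cf.
  by apply: cvgD; [exact: cvg_cst|exact: cvg_id].
have mE : measurable E.
  apply: bigcap_measurable => [|n _]; first by exists 0%N.
  apply: bigcup_measurable => m _; apply: closed_measurable.
  have -> : slopes_close f n m =
      \bigcap_(p in [set p : R * R | (0 < `|p.1| < m.+1%:R^-1) /\
                                     (0 < `|p.2| < m.+1%:R^-1)])
        [set r | `|slope f r p.1 - slope f r p.2| <= n.+1%:R^-1].
    apply/seteqP; split => [r H [h k] /= [hh hk]|r H h k hh hk].
      exact: H.
    exact: (H (h, k)).
  apply: closed_bigI => p _.
  rewrite (_ : [set r | _] = (fun r => `|slope f r p.1 - slope f r p.2|) @^-1`
    [set x | x <= n.+1%:R^-1])//.
  apply: preimage_closed => [r _|]; last exact: closed_le.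
  by apply: cvg_norm; apply: cvgB; exact: cs.
rewrite -(setUv E); apply/measurable_funU => //; first exact: measurableC.
split.
- apply: (@measurable_fun_cvg _ _ _ _ (fun n r => slope f r n.+1%:R^-1)).
    move=> n; apply: measurable_funTS; exact: continuous_measurable_fun.
  by move=> r Er; apply: derive1_slope; apply/derivableE_slopes.
(* Where [f] is not differentiable, [derive1 f] is the default value [point]. *)
- apply: (eq_measurable_fun (cst point)) => [r|]; last exact: measurable_cst.
  rewrite inE => nE /=; rewrite derive1E /derive dvgP// => df.
  by apply: nE; apply/derivableE_slopes.
Qed.

(** On [`]e, +oo[] the function agrees with its composition with [Num.max e], which
    is continuous on the whole line. *)
Lemma measurable_derive1_pos f :
  (forall r, 0 < r -> {for r, continuous f}) ->
  measurable_fun (`]0, +oo[ : set R) (derive1 f).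
Proof.
move=> cf.
have -> : (`]0, +oo[ : set R) = \bigcup_n `]n.+1%:R^-1, +oo[.
  apply/seteqP; split => [r /=|r [n _] /=]; rewrite !in_itv/= !andbT; last first.
    by apply: lt_trans; rewrite invr_gt0 ltr0n.
  move=> r0; exists (Num.Def.archi_bound r^-1) => //=; rewrite in_itv/= andbT.
  rewrite invf_plt ?posrE ?ltr0n//.
  apply: lt_le_trans (archi_boundP _) _; first by rewrite invr_ge0 ltW.
  by rewrite ler_nat.
apply/measurable_fun_bigcup => [n|n]; first exact: measurable_itv.
pose eta : R := n.+1%:R^-1.
have eta0 : 0 < eta by rewrite invr_gt0 ltr0n.
pose g := f \o Num.max eta.
have cg : continuous g.
  move=> r; apply: continuous_comp; last first.
    by apply: cf; rewrite lt_max eta0.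
  by apply: continuous_max => z; [exact: cvg_cst|exact: cvg_id].
apply: (eq_measurable_fun (derive1 g)); last first.
  by apply: measurable_funTS; exact: measurable_derive1.
move=> r; rewrite inE /= in_itv/= andbT => er.
rewrite !derive1E; apply: near_eq_derive => //.
near=> z; rewrite /g /= (max_idPr _)// ltW//.
by near: z; exact: lt_nbhsr.
Unshelve. all: by end_near. Qed.

End MeasurableDerivative.

(** * Calculus on the half-line *)

Section HalfLine.
Context (R : realType).
Implicit Types (f g F u : R -> R) (r x y : R).

Local Notation mu := (@lebesgue_measure R).
Local Notation pos := (`]0, +oo[ : set R).

Lemma powRDp x (s t : R) : 0 < x -> x `^ (s + t) = x `^ s * x `^ t.
Proof. by move=> x0; rewrite powRD// lt0r_neq0// implybT. Qed.

Lemma powRBp x (s t : R) : 0 < x -> x `^ (s - t) = x `^ s / x `^ t.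
Proof. by move=> x0; rewrite powRDp// powRN. Qed.

Lemma derivable_continuous_at f x : derivable f x 1 -> {for x, continuous f}.
Proof. by move=> /derivable1_diffP/differentiable_continuous. Qed.

Lemma is_derive_continuous_at f x (l : R) :
  is_derive x 1 f l -> {for x, continuous f}.
Proof. by move=> [df _]; exact: derivable_continuous_at. Qed.

Lemma pos_within_continuous f x y : 0 < x ->
  (forall r, 0 < r -> {for r, continuous f}) -> {within `[x, y], continuous f}.
Proof.
move=> x0 cf; apply: continuous_in_subspaceT => r; rewrite inE /= in_itv/=.
by move=> /andP[xr _]; apply: cf; exact: lt_le_trans xr.
Qed.

Lemma pos_continuous_measurable f :
  (forall r, 0 < r -> {for r, continuous f}) -> measurable_fun pos f.
Proof.
move=> cf; apply: open_continuous_measurable_fun; first exact: interval_open.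
by move=> r; rewrite inE /= in_itv/= andbT => r0; exact: cf.
Qed.

Lemma pos_continuous_integrable f x y : 0 < x ->
  (forall r, 0 < r -> {for r, continuous f}) ->
  mu.-integrable `[x, y] (EFin \o f).
Proof.
move=> x0 cf; apply: continuous_compact_integrable; first exact: segment_compact.
exact: pos_within_continuous.
Qed.

Lemma pos_FTC2 f F x y : 0 < x -> x <= y ->
  (forall r, 0 < r -> is_derive r 1 F (f r)) ->
  (forall r, 0 < r -> {for r, continuous f}) ->
  F y - F x = \int[mu]_(t in `[x, y]) f t.
Proof.
move=> x0; rewrite le_eqVlt => /orP[/eqP <-|xy] dF cf.
  by rewrite set_itv1 Rintegral_set1 subrr.
have cF r : 0 < r -> {for r, continuous F}.
  by move=> /dF; exact: is_derive_continuous_at.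
have := @continuous_FTC2 R f F x y xy (pos_within_continuous x0 cf).
rewrite /Rintegral => ->; first by rewrite -EFinB.
- split.
  + move=> r; rewrite in_itv/= => /andP[xr _]; have [] := dF r _ => //.
    exact: lt_trans xr.
  + by apply: cvg_at_right_filter; exact: cF.
  + by apply: cvg_at_left_filter; apply: cF; exact: lt_trans xy.
- move=> r; rewrite in_itv/= => /andP[xr _]; rewrite derive1E.
  by have [_ ->] := dF r (lt_trans x0 xr).
Qed.

Lemma pos_monotone F f x y : 0 < x -> x <= y ->
  (forall r, 0 < r -> is_derive r 1 F (f r)) ->
  (forall r, x < r < y -> 0 <= f r) -> F x <= F y.
Proof.
move=> x0 xy dF f0; apply: (@ger0_derive1_ndecr R F x y) => //.
- move=> r; rewrite in_itv/= => /andP[xr _].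
  by have [] := dF r (lt_trans x0 xr).
- move=> r; rewrite in_itv/= => /andP[xr ry]; rewrite derive1E.
  by have [_ ->] := dF r (lt_trans x0 xr); rewrite f0// xr.
- apply: pos_within_continuous => // r /dF; exact: is_derive_continuous_at.
Qed.

Lemma is_derive_powR (c : R) x : 0 < x ->
  is_derive x 1 (@powR R ^~ c) (c * x `^ (c - 1)).
Proof. by move=> x0; apply: is_derive1_powR. Qed.

Lemma powR_continuous (c : R) x : 0 < x -> {for x, continuous (@powR R ^~ c)}.
Proof. by move=> x0; exact: (is_derive_continuous_at (is_derive_powR c x0)). Qed.

(** In these variants of the differentiation rules the value of the derivative is
    free up to an equation, which [ring] or [field] can then prove. *)
Lemma is_deriveM_eq f g x (a b c : R) :
  is_derive x 1 f a -> is_derive x 1 g b -> c = f x * b + g x * a ->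
  is_derive x 1 (fun r => f r * g r) c.
Proof.
move=> fa gb ->.
have := @is_deriveM R R f g x 1 a b fa gb; apply.
Qed.

Lemma is_deriveD_eq f g x (a b c : R) :
  is_derive x 1 f a -> is_derive x 1 g b -> c = a + b ->
  is_derive x 1 (fun r => f r + g r) c.
Proof.
move=> fa gb ->.
by have := @is_deriveD R R R f g x 1 a b fa gb; exact.
Qed.

Lemma is_deriveB_eq f g x (a b c : R) :
  is_derive x 1 f a -> is_derive x 1 g b -> c = a - b ->
  is_derive x 1 (fun r => f r - g r) c.
Proof.
move=> fa gb ->.
by have := @is_deriveB R R R f g x 1 a b fa gb; exact.
Qed.

Lemma is_deriveZ_eq f x (k a c : R) :
  is_derive x 1 f a -> c = k * a -> is_derive x 1 (fun r => k * f r) c.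
Proof.
move=> fa ->.
by have := @is_deriveZ R R R f k x 1 a fa; exact.
Qed.

Lemma AC1loc_is_derive u r : AC1loc u -> 0 < r -> is_derive r 1 u (derive1 u r).
Proof. by move=> [du _] r0; split; [exact: du|rewrite derive1E]. Qed.

Lemma AC1loc_continuous u r : AC1loc u -> 0 < r -> {for r, continuous u}.
Proof.
by move=> uac r0; exact: (is_derive_continuous_at (AC1loc_is_derive uac r0)).
Qed.

Lemma abs_continuous_continuous_at a b f x : a < x < b -> abs_continuous a b f ->
  {for x, continuous f}.
Proof.
move=> /andP[ax xb] acf; apply/cvgrPdist_lt => e e0.
have ab : a <= b by lra.
have [d d0 Hd] := abs_continuous_seq ab acf e0.
near=> y.
have ay : a < y by near: y; exact: lt_nbhsr.
have yb : y < b by near: y; exact: lt_nbhsl.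
have xyd : `|x - y| < d by near: y; exact: cvgr_dist_lt.
have [xy|yx] := leP x y.
  have := Hd [:: (x, y)]; rewrite /= /total_length !big_cons !big_nil /= !addr0.
  rewrite distrC; apply => //; first by rewrite /inside /= xy (ltW ax) ltW.
  by rewrite distrC ger0_norm in xyd; lra.
have := Hd [:: (y, x)]; rewrite /= /total_length !big_cons !big_nil /= !addr0.
apply => //; first by rewrite /inside /= (ltW yx) (ltW ay) ltW.
by rewrite ger0_norm in xyd; lra.
Unshelve. all: by end_near. Qed.

Lemma AC1loc_derive1_continuous u r : AC1loc u -> 0 < r ->
  {for r, continuous (derive1 u)}.
Proof.
move=> [_ acu] r0; apply: (@abs_continuous_continuous_at (r / 2) (r * 2)).
  by lra.
by apply: acu; lra.
Qed.

Lemma AC1loc_measurable u : AC1loc u -> forall j, (j <= 2)%N ->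
  measurable_fun pos (derive1n j u).
Proof.
move=> uac [|[|[|//]]] _.
- by apply: pos_continuous_measurable => r; exact: AC1loc_continuous.
- by apply: pos_continuous_measurable => r; exact: AC1loc_derive1_continuous.
- by apply: measurable_derive1_pos => r; exact: AC1loc_derive1_continuous.
Qed.

Lemma powR_measurable (c : R) : measurable_fun pos (@powR R ^~ c).
Proof. by apply: measurable_funTS; exact: measurable_powR. Qed.

End HalfLine.

(** * Radial decay and finiteness of the norms *)

Section Radial.
Context (R : realType).
Implicit Types (f g F u v : R -> R) (r x y : R).

Local Notation mu := (@lebesgue_measure R).
Local Notation pos := (`]0, +oo[ : set R).

Lemma in_posE r : pos r = (0 < r) :> Prop.
Proof. by rewrite /= in_itv/= andbT. Qed.

Lemma measurable_pos : measurable pos.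
Proof. exact: measurable_itv. Qed.

Lemma integrable_sub (D E : set R) f : measurable D -> measurable E ->
  D `<=` E -> mu.-integrable E (EFin \o f) -> mu.-integrable D (EFin \o f).
Proof. by move=> mD mE DE; apply: integrableS. Qed.

Lemma le_Rint_set (D : set R) f g : measurable D ->
  mu.-integrable D (EFin \o f) -> mu.-integrable D (EFin \o g) ->
  (forall r, D r -> f r <= g r) ->
  \int[mu]_(r in D) f r <= \int[mu]_(r in D) g r.
Proof. by move=> mD fi gi fg; apply: le_Rintegral. Qed.

Lemma le_Rint_sub (D E : set R) f : measurable D -> measurable E ->
  D `<=` E -> mu.-integrable E (EFin \o f) -> (forall r, E r -> 0 <= f r) ->
  \int[mu]_(r in D) f r <= \int[mu]_(r in E) f r.
Proof.
move=> mD mE DE fi f0; rewrite /Rintegral fine_le//.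
- by apply: integrable_fin_num => //; exact: (integrable_sub mD mE).
- exact: integrable_fin_num.
- apply: ge0_subset_integral => //; first by case/integrableP : fi.
Qed.

Lemma norm_Rint_le (D : set R) f g : measurable D ->
  mu.-integrable D (EFin \o f) -> mu.-integrable D (EFin \o g) ->
  (forall r, D r -> `|f r| <= g r) ->
  `|\int[mu]_(r in D) f r| <= \int[mu]_(r in D) g r.
Proof.
move=> mD fi gi fg.
have h : `|\int[mu]_(r in D) f r| <= \int[mu]_(r in D) `|f r|.
  by apply: le_normr_Rintegral.
apply: (le_trans h); apply: le_Rint_set => //.
have -> : EFin \o (fun r => `|f r|) = (abse \o (EFin \o f)) by [].
by apply: integrable_abse.
Qed.

Lemma integrable_dominated f g : measurable_fun pos f ->
  (forall r, 0 < r -> `|f r| <= g r) -> mu.-integrable pos (EFin \o g) ->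
  mu.-integrable pos (EFin \o f).
Proof.
move=> mf fg ig; apply: le_integrable ig; first exact: measurable_pos.
  exact/measurable_EFinP.
move=> r; rewrite in_posE => r0 /=; rewrite lee_fin.
by apply: le_trans (fg r r0) (ler_norm _).
Qed.

Lemma Rint_pos_gt0 f r0 : mu.-integrable pos (EFin \o f) -> 0 < r0 ->
  (forall r, 0 < r -> 0 <= f r) -> 0 < f r0 -> {for r0, continuous f} ->
  0 < \int[mu]_(r in pos) f r.
Proof.
move=> fi r00 fge0 f0 cf.
have f20 : 0 < f r0 / 2 by rewrite divr_gt0.
move/cvgrPdist_lt : cf => /(_ _ f20)[d /= d0 Hd].
pose J : set R := `[r0, r0 + d / 2].
have mJ : measurable J by exact: measurable_itv.
have JP : J `<=` pos.
  by move=> z; rewrite /J /= !in_itv/= andbT => /andP[h _]; exact: lt_le_trans h.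
have fJ z : J z -> f r0 / 2 <= f z.
  rewrite /J /= in_itv/= => /andP[h1 h2].
  have : `|f r0 - f z| < f r0 / 2.
    by apply: Hd; rewrite /ball /= distrC ger0_norm; lra.
  by rewrite ltr_norml => /andP[_]; lra.
apply: (@lt_le_trans _ _ (\int[mu]_(r in J) (f r0 / 2))).
  rewrite Rintegral_cst//; apply: mulr_gt0 => //.
  rewrite /J [X in fine X]lebesgue_measure_itv /= lte_fin ltrDl divr_gt0//=.
  by lra.
apply: (@le_trans _ _ (\int[mu]_(r in J) f r)).
  have icst : mu.-integrable J (EFin \o (fun=> f r0 / 2)).
    by apply: pos_continuous_integrable => // r _; exact: cvg_cst.
  have ifJ : mu.-integrable J (EFin \o f).
    exact: (integrable_sub mJ measurable_pos JP fi).
  exact: (le_Rint_set mJ icst ifJ fJ).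
have f_ge0 r : pos r -> 0 <= f r by rewrite in_posE; exact: fge0.
exact: (le_Rint_sub mJ measurable_pos JP fi f_ge0).
Qed.

Lemma sqr_powR_norm (x : R) : `|x| `^ 2 = x ^+ 2.
Proof. by rewrite powR_mulrn// -normrX ger0_norm// sqr_ge0. Qed.

Lemma wLnorm_lty (q t : R) u : 0 < q ->
  (wLnorm q t u < +oo)%E <->
  (\int[mu]_(r in pos) (`|u r| `^ q * r `^ t)%:E < +oo)%E.
Proof.
move=> q0; rewrite /wLnorm; split => h; last exact: poweR_lty.
by apply: lty_poweRy h; rewrite invr_eq0 gt_eqF.
Qed.

Lemma wLnorm_fin (q t : R) u :
  mu.-integrable pos (EFin \o (fun r => `|u r| `^ q * r `^ t)) ->
  wLnorm q t u = ((\int[mu]_(r in pos) (`|u r| `^ q * r `^ t)) `^ q^-1)%:E.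
Proof.
move=> iu; rewrite /wLnorm /Rintegral -poweR_EFin fineK//.
apply: integrable_fin_num => //; exact: measurable_pos.
Qed.

Lemma measurable_weight (q t : R) u : measurable_fun pos u ->
  measurable_fun pos (fun r => `|u r| `^ q * r `^ t).
Proof.
move=> mf; apply: measurable_funM; last exact: powR_measurable.
apply: (measurableT_comp (measurable_powR q)).
exact: measurableT_comp.
Qed.

Lemma wLspaceP (q t : R) u : 0 < q -> wLspace q t u <-> measurable_fun pos u /\
  mu.-integrable pos (EFin \o (fun r => `|u r| `^ q * r `^ t)).
Proof.
move=> q0; rewrite /wLspace /= wLnorm_lty//.
have E : (\int[mu]_(r in pos) `|(`|u r| `^ q * r `^ t)%:E| =
    \int[mu]_(r in pos) (`|u r| `^ q * r `^ t)%:E)%E.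
  by apply: eq_integral => r _; rewrite /= ger0_norm// mulr_ge0 ?powR_ge0.
split=> -[mf h]; split => //.
  apply/integrableP; split.
    by apply/measurable_EFinP; exact: measurable_weight.
  by rewrite [X in (X < _)%E]E.
by move: h => /integrableP[_]; rewrite [X in (X < _)%E]E.
Qed.

Lemma wLspace2P (t : R) u : wLspace 2 t u <-> measurable_fun pos u /\
  mu.-integrable pos (EFin \o (fun r => u r ^+ 2 * r `^ t)).
Proof.
rewrite wLspaceP//.
by under [X in _ /\ mu.-integrable _ (EFin \o X)]eq_fun do rewrite sqr_powR_norm.
Qed.

Lemma integrable_linear f g (a b : R) :
  mu.-integrable pos (EFin \o f) -> mu.-integrable pos (EFin \o g) ->
  mu.-integrable pos (EFin \o (fun r => a * f r + b * g r)).
Proof.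
move=> fi gi.
have -> : EFin \o (fun r => a * f r + b * g r) =
    (fun r => a%:E * (EFin \o f) r + b%:E * (EFin \o g) r)%E.
  by apply/funext => r /=; rewrite EFinD !EFinM.
by apply: integrableD; [exact: measurable_pos|apply: integrableZl..];
  rewrite //; exact: measurable_pos.
Qed.

Lemma X22_integrable (al : R) u j : X22 al u -> (j <= 2)%N ->
  mu.-integrable pos (EFin \o (fun r => derive1n j u r ^+ 2 * r `^ (al - 2 * (2 - j%:R)))).
Proof. by move=> [_ H] /H /wLspace2P[]. Qed.

(** The derivative of [u^2 r^(al - 3)] is dominated by
    [(al - 2) u^2 r^(al - 4) + u'^2 r^(al - 2)], which is integrable. *)
Lemma radial_bound (al : R) u : 3 < al -> X22 al u ->
  exists C, forall r, 0 < r -> u r ^+ 2 <= C * r `^ (3 - al).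
Proof.
move=> al3 Xu; have [uac _] := Xu.
have i0 := X22_integrable Xu (leq0n 2).
have i1 := X22_integrable Xu (leqnSn 1).
rewrite /= in i0 i1.
have e0 : al - 2 * (2 - 0) = al - 4 by ring.
have e1 : al - 2 * (2 - 1) = al - 2 by ring.
rewrite ?mulr0n ?mulr1n e0 in i0; rewrite ?mulr1n e1 in i1.
pose g r := (al - 2) * (u r ^+ 2 * r `^ (al - 4)) + 1 * (derive1 u r ^+ 2 * r `^ (al - 2)).
have ig : mu.-integrable pos (EFin \o g) by exact: integrable_linear.
have g0 r : 0 <= g r.
  have al2 : 0 <= al - 2 by lra.
  rewrite /g mul1r; apply: addr_ge0; first apply: mulr_ge0 => //.
    by rewrite mulr_ge0 ?sqr_ge0 ?powR_ge0.
  by rewrite mulr_ge0 ?sqr_ge0 ?powR_ge0.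
pose F r := u r ^+ 2 * r `^ (al - 3).
pose f r := u r ^+ 2 * ((al - 3) * r `^ (al - 4)) + r `^ (al - 3) * (u r * derive1 u r + u r * derive1 u r).
have dF r : 0 < r -> is_derive r 1 F (f r).
  move=> r0; apply: (@is_deriveM_eq _ (fun r => u r ^+ 2) (@powR R ^~ (al - 3)) r
    (u r * derive1 u r + u r * derive1 u r) ((al - 3) * r `^ (al - 4))) => //.
  - have du := AC1loc_is_derive uac r0.
    under eq_fun do rewrite expr2.
    exact: (is_deriveM_eq du du erefl).
  - rewrite (_ : al - 4 = al - 3 - 1); last by ring.
    exact: is_derive_powR.
have cf r : 0 < r -> {for r, continuous f}.
  move=> r0; have cu := AC1loc_continuous uac r0.
  have cu' := AC1loc_derive1_continuous uac r0.
  have cp (c : R) : {for r, continuous (@powR R ^~ c)} by exact: powR_continuous.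
  rewrite /f; apply: cvgD; apply: cvgM.
  - by under eq_fun do rewrite expr2; apply: cvgM.
  - by apply: cvgM; [exact: cvg_cst|exact: cp].
  - exact: cp.
  - by apply: cvgD; apply: cvgM.
have fg r : 0 < r -> `|f r| <= g r.
  move=> r0.
  have E3 : r `^ (al - 3) = r * r `^ (al - 4).
    by rewrite -{2}[r]powRr1 ?ltW// -powRDp//; congr (_ `^ _); ring.
  have E2 : r `^ (al - 2) = r * (r * r `^ (al - 4)).
    by rewrite -E3 -{2}[r]powRr1 ?ltW// -powRDp//; congr (_ `^ _); ring.
  rewrite /f /g E2 E3; have := powR_gt0 (al - 4) r0.
  move: (r `^ _) (u r) (derive1 u r) => w a b w0.
  have h : `|2 * (a * (r * b))| <= a ^+ 2 + (r * b) ^+ 2.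
    move: (r * b) => z; have h1 := sqr_ge0 (a - z); have h2 := sqr_ge0 (a + z).
    by rewrite ler_norml; apply/andP; split; nra.
  rewrite (_ : _ + _ = w * ((al - 3) * a ^+ 2 + 2 * (a * (r * b)))); last by ring.
  rewrite normrM gtr0_norm// [X in _ <= X](_ : _ = w * ((al - 3) * a ^+ 2 + (a ^+ 2 + (r * b) ^+ 2))); last by ring.
  rewrite ler_pM2l//; apply: le_trans (ler_normD _ _) _.
  rewrite ger0_norm; last by rewrite mulr_ge0 ?sqr_ge0//; lra.
  by rewrite lerD2l.
pose K := \int[mu]_(r in pos) g r.
have FK x y : 0 < x -> x <= y -> `|F y - F x| <= K.
  move=> x0 xy; rewrite (pos_FTC2 x0 xy dF cf).
  have sub : `[x, y] `<=` pos.
    by move=> z /=; rewrite !in_itv/= andbT => /andP[xz _]; exact: lt_le_trans xz.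
  have iF : mu.-integrable `[x, y] (EFin \o f) by exact: pos_continuous_integrable.
  have mxy : measurable (`[x, y] : set R) by exact: measurable_itv.
  have igxy : mu.-integrable `[x, y] (EFin \o g).
    exact: (integrable_sub mxy measurable_pos sub ig).
  apply: (le_trans (norm_Rint_le mxy iF igxy _)).
    by move=> z /sub; rewrite in_posE => /fg.
  by apply: le_Rint_sub => //; exact: measurable_pos.
exists (F 1 + K) => r r0.
have Fr : F r <= F 1 + K.
  have [r1|r1] := leP 1 r.
    by have := FK 1 r ltr01 r1; rewrite ler_norml => /andP[_]; lra.
  have := FK r 1 r0 (ltW r1); rewrite ler_norml => /andP[h _].
  by have : 0 <= K by [apply: Rintegral_ge0 => z _; exact: g0]; lra.
rewrite (_ : 3 - al = - (al - 3)); last by ring.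
by rewrite powRN ler_pdivlMr ?powR_gt0.
Qed.

Lemma crit_expE (al : R) : 3 < al ->
  crit_exp al = 2 + 8 / (al - 3).
Proof. by move=> al3; rewrite /crit_exp; field; lra. Qed.

(** As [crit_exp al - 2 = 8 / (al - 3)], the radial bound gives
    [|u|^(p - 2) <= C r^(- 4)], whence [|u|^p r^al <= C u^2 r^(al - 4)]. *)
Lemma X22_crit_integrable (al : R) u : 3 < al -> X22 al u ->
  mu.-integrable pos (EFin \o (fun r => `|u r| `^ crit_exp al * r `^ al)).
Proof.
move=> al3 Xu; have [C HC] := radial_bound al3 Xu.
have [uac _] := Xu.
have i0 := X22_integrable Xu (leq0n 2).
have e0 : al - 2 * (2 - 0%:R) = al - 4 by ring.
rewrite e0 /= in i0.
pose s := 4 / (al - 3).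
have s0 : 0 <= s by apply: divr_ge0; lra.
have C0 : 0 <= C.
  by have := HC 1 ltr01; rewrite powR1 mulr1; apply: le_trans; exact: sqr_ge0.
apply: (@integrable_dominated _ (fun r => C `^ s * (u r ^+ 2 * r `^ (al - 4)) + 0 * 0)).
- apply: measurable_weight; exact: (AC1loc_measurable uac (leq0n 2)).
- move=> r r0; rewrite mulr0 addr0 ger0_norm; last by rewrite mulr_ge0// powR_ge0.
  have p2 : 0 < crit_exp al by rewrite crit_expE// addr_gt0// divr_gt0//; lra.
  have -> : `|u r| `^ crit_exp al = u r ^+ 2 * (u r ^+ 2) `^ s.
    have [->|u0] := eqVneq (u r) 0.
      by rewrite normr0 powR0 ?gt_eqF// expr0n /= mul0r.
    rewrite -!sqr_powR_norm -powRrM -powRDp ?normr_gt0//; congr (_ `^ _).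
    by rewrite crit_expE// /s; field; lra.
  have -> : r `^ al = r `^ (al - 4) * r `^ 4 by rewrite -powRDp//; congr (_ `^ _); ring.
  rewrite [X in _ <= X](_ : _ = u r ^+ 2 * C `^ s * r `^ (al - 4)); last by ring.
  rewrite [X in X <= _](_ : _ = u r ^+ 2 * ((u r ^+ 2) `^ s * r `^ 4) * r `^ (al - 4)); last by ring.
  rewrite ler_pM2r ?powR_gt0//; apply: ler_wpM2l; first exact: sqr_ge0.
  apply: (@le_trans _ _ ((C * r `^ (3 - al)) `^ s * r `^ 4)).
    apply: ler_wpM2r; first exact: powR_ge0.
    apply: ge0_ler_powR => //; rewrite ?nnegrE ?sqr_ge0 //.
    - by apply: mulr_ge0 => //; exact: powR_ge0.
    - exact: HC.
  rewrite powRM ?powR_ge0// -powRrM -mulrA -powRDp//.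
  rewrite (_ : (3 - al) * s + 4 = 0); last by rewrite /s; field; lra.
  by rewrite powRr0 mulr1.
- by have := integrable_linear (C `^ s) 0 i0 (integrable0 mu _); apply; exact: measurable_pos.
Qed.

End Radial.

(** * Linear structure of the function spaces *)

Section Linear.
Context (R : realType).
Implicit Types (f g h u v phi : R -> R) (r x y e : R).

Local Notation mu := (@lebesgue_measure R).
Local Notation pos := (`]0, +oo[ : set R).

Lemma ae_imp (P Q : R -> Prop) : (forall r, P r -> Q r) ->
  {ae mu, forall r, P r} -> {ae mu, forall r, Q r}.
Proof.
by move=> PQ; apply: filterS; first exact: (ae_filter_ringOfSetsType mu).
Qed.

Lemma ae_imp2 (P Q S : R -> Prop) : (forall r, P r -> Q r -> S r) ->
  {ae mu, forall r, P r} -> {ae mu, forall r, Q r} -> {ae mu, forall r, S r}.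
Proof.
by move=> PQS; apply: filterS2; first exact: (ae_filter_ringOfSetsType mu).
Qed.

Lemma ae_all_nat (P : nat -> R -> Prop) :
  (forall n, {ae mu, forall r, P n r}) -> {ae mu, forall r, forall n, P n r}.
Proof. exact: ae_foralln. Qed.

Lemma abs_continuous_eq a b f g : (forall x, a <= x <= b -> f x = g x) ->
  abs_continuous a b f -> abs_continuous a b g.
Proof.
move=> fg acf e e0; have [d d0 Hd] := acf e e0; exists d => // n x y h1 h2 h3.
rewrite (_ : \sum_(0 <= i < n) _ = \sum_(0 <= i < n) `|f (y i) - f (x i)|).
  exact: Hd.
apply: eq_big_nat => i /andP[_ iN]; have [ax xy yb] := h1 i iN.
by rewrite !fg//; apply/andP; split; lra.
Qed.

Lemma abs_continuousD a b f g : abs_continuous a b f -> abs_continuous a b g ->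
  abs_continuous a b (fun x => f x + g x).
Proof.
move=> acf acg e e0; have e2 : 0 < e / 2 by lra.
have [d d0 Hd] := acf _ e2; have [d' d'0 Hd'] := acg _ e2.
exists (Num.min d d'); first by rewrite lt_min d0.
move=> n x y h1 h2; rewrite lt_min => /andP[h3 h4].
have := Hd n x y h1 h2 h3; have := Hd' n x y h1 h2 h4.
suff : \sum_(0 <= i < n) `|f (y i) + g (y i) - (f (x i) + g (x i))| <=
  \sum_(0 <= i < n) `|f (y i) - f (x i)| + \sum_(0 <= i < n) `|g (y i) - g (x i)|.
  by lra.
rewrite -big_split /=; apply: ler_sum => i _.
rewrite (_ : _ - _ = (f (y i) - f (x i)) + (g (y i) - g (x i))); last by ring.
exact: ler_normD.
Qed.

Lemma abs_continuousM_bounded a b f g K : 0 < K ->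
  (forall x, a <= x <= b -> `|f x| <= K) -> (forall x, a <= x <= b -> `|g x| <= K) ->
  abs_continuous a b f -> abs_continuous a b g ->
  abs_continuous a b (fun x => f x * g x).
Proof.
move=> K0 fK gK acf acg e e0; have e2 : 0 < e / 2 / K by rewrite !divr_gt0.
have [d d0 Hd] := acf _ e2; have [d' d'0 Hd'] := acg _ e2.
exists (Num.min d d'); first by rewrite lt_min d0.
move=> n x y h1 h2; rewrite lt_min => /andP[h3 h4].
have := Hd n x y h1 h2 h3; have := Hd' n x y h1 h2 h4.
rewrite !ltr_pdivlMr//.
suff : \sum_(0 <= i < n) `|f (y i) * g (y i) - f (x i) * g (x i)| <=
  (\sum_(0 <= i < n) `|f (y i) - f (x i)|) * K +
  (\sum_(0 <= i < n) `|g (y i) - g (x i)|) * K.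
  by lra.
rewrite !mulr_suml -big_split /= !big_mkord; apply: ler_sum => i _.
have [ax xy yb] := h1 i (ltn_ord i).
rewrite (_ : _ - _ = (f (y i) - f (x i)) * g (y i) + f (x i) * (g (y i) - g (x i))); last by ring.
apply: le_trans (ler_normD _ _) _; rewrite !normrM; apply: lerD.
  by apply: ler_wpM2l => //; apply: gK; rewrite yb andbT; lra.
by rewrite mulrC; apply: ler_wpM2l => //; apply: fK; rewrite ax /=; lra.
Qed.

Lemma lipschitz_abs_continuous a b f L :
  (forall x y, a <= x -> x <= y -> y <= b -> `|f y - f x| <= L * (y - x)) ->
  abs_continuous a b f.
Proof.
move=> fL e e0; have K0 : 0 < `|L| + 1 by have := normr_ge0 L; lra.
exists (e / (`|L| + 1)); first by rewrite divr_gt0.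
move=> n x y h1 _; rewrite ltr_pdivlMr// => h2; apply: le_lt_trans h2.
rewrite mulr_suml !big_mkord; apply: ler_sum => i _.
have [ax xy yb] := h1 i (ltn_ord i).
apply: le_trans (fL _ _ ax xy yb) _; rewrite mulrC; apply: ler_wpM2l.
  by rewrite subr_ge0.
by have := ler_norm L; lra.
Qed.

Lemma derive1_near f g r : 0 < r -> (forall z, 0 < z -> f z = g z) ->
  derive1 f r = derive1 g r.
Proof.
move=> r0 fg; rewrite !derive1E; apply: near_eq_derive => //.
near=> z; apply: fg.
by near: z; exact: lt_nbhsr.
Unshelve. all: by end_near. Qed.

Lemma derivable_near f g r : 0 < r -> (forall z, 0 < z -> f z = g z) ->
  derivable f r 1 -> derivable g r 1.
Proof.
move=> r0 fg; apply: near_eq_derivable => //.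
near=> z; apply: fg.
by near: z; exact: lt_nbhsr.
Unshelve. all: by end_near. Qed.

Lemma derivable_is_derive f r : derivable f r 1 -> is_derive r 1 f (derive1 f r).
Proof. by move=> df; apply: DeriveDef => //; rewrite derive1E. Qed.

Lemma derive1_addZ f g e r : derivable f r 1 -> derivable g r 1 ->
  derive1 (fun z => f z + e * g z) r = derive1 f r + e * derive1 g r.
Proof.
move=> df dg; have dF := derivable_is_derive df.
have dG := derivable_is_derive dg.
have [_ E] := is_deriveD_eq dF (is_deriveZ_eq (k := e) dG erefl) erefl.
by rewrite [LHS]derive1E; exact: E.
Qed.

Lemma derivable_addZ f g e r : derivable f r 1 -> derivable g r 1 ->
  derivable (fun z => f z + e * g z) r 1.
Proof.
move=> df dg; have dF := derivable_is_derive df.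
have dG := derivable_is_derive dg.
by have [] := is_deriveD_eq dF (is_deriveZ_eq (k := e) dG erefl) erefl.
Qed.

Lemma AC1loc_addZ u v e : AC1loc u -> AC1loc v -> AC1loc (fun r => u r + e * v r).
Proof.
move=> [du acu] [dv acv]; split.
  by move=> r r0; apply: derivable_addZ; [exact: du|exact: dv].
move=> a b a0 ab; apply: (@abs_continuous_eq _ _ (fun r => derive1 u r + e * derive1 v r)).
  move=> x /andP[ax _]; rewrite derive1_addZ//; [apply: du|apply: dv]; lra.
apply: abs_continuousD; first exact: acu.
have := acv a b a0 ab => h d d0.
have K0 : 0 < `|e| + 1 by have := normr_ge0 e; lra.
have [c c0 Hc] := h (d / (`|e| + 1)) (divr_gt0 d0 K0).
exists c => // n x y h1 h2 h3; have := Hc n x y h1 h2 h3.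
rewrite ltr_pdivlMr//; apply: le_lt_trans.
rewrite mulr_suml; apply: ler_sum => i _.
rewrite -mulrBr normrM mulrC; apply: ler_wpM2l => //; lra.
Qed.

(** Countably many compact intervals cover the half-line. *)
Lemma AC1loc_ae_derivable u : AC1loc u ->
  {ae mu, forall r, 0 < r -> derivable (derive1 u) r 1}.
Proof.
move=> [_ acu].
have H n : {ae mu, forall r, n.+1%:R^-1 < r < n.+2%:R -> derivable (derive1 u) r 1}.
  have n0 : 0 < (n.+1%:R^-1 : R) by rewrite invr_gt0 ltr0n.
  have n1 : n.+1%:R^-1 < (n.+2%:R : R).
    by apply: (@le_lt_trans _ _ 1); rewrite ?invf_le1 ?ltr0n// ?ler1n// ltr1n.
  have [rho [_ _]] := abs_continuous_ae_derivable (ltW n1) (acu _ _ n0 n1).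
  by apply: ae_imp => r h /h[].
move: (ae_all_nat H); apply: ae_imp => r h r0; pose m := maxn (Num.Def.archi_bound r^-1) (Num.Def.archi_bound r).
apply: (h m); apply/andP; split.
  rewrite invf_plt ?posrE ?ltr0n//.
  apply: lt_le_trans (archi_boundP _) _; first by rewrite invr_ge0 ltW.
  by rewrite ler_nat (leq_trans (leq_maxl _ _) (leqnSn _)).
apply: lt_le_trans (archi_boundP _) _; first exact: ltW.
by rewrite ler_nat /m (leq_trans (leq_maxr (Num.Def.archi_bound r^-1) _))// -addn2 leq_addr.
Qed.

(** At points where one of the second derivatives does not exist, [derive1n 2]
    takes default values and is not additive. *)
Lemma derive1n2_addZ_ae u v e : AC1loc u -> AC1loc v ->
  {ae mu, forall r, 0 < r ->
    derive1n 2 (fun r => u r + e * v r) r = derive1n 2 u r + e * derive1n 2 v r}.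
Proof.
move=> uac vac.
have [du _] := uac; have [dv _] := vac.
move: (AC1loc_ae_derivable uac) (AC1loc_ae_derivable vac).
apply: ae_imp2 => r h1 h2 r0; rewrite /=.
rewrite (@derive1_near _ (fun z => derive1 u z + e * derive1 v z))//.
  by rewrite derive1_addZ; [|exact: h1|exact: h2].
by move=> z z0; rewrite derive1_addZ; [|exact: du|exact: dv].
Qed.

Lemma Rint_ae f g : measurable_fun pos f -> measurable_fun pos g ->
  {ae mu, forall r, 0 < r -> f r = g r} ->
  \int[mu]_(r in pos) f r = \int[mu]_(r in pos) g r.
Proof.
move=> mf mg fg; rewrite /Rintegral; congr fine.
apply: ae_eq_integral; [exact: measurable_pos|exact/measurable_EFinP..|].
by move: fg; apply: ae_imp => r h; rewrite in_posE => /h ->.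
Qed.

Lemma integrable_ae f g : mu.-integrable pos (EFin \o f) -> measurable_fun pos g ->
  {ae mu, forall r, 0 < r -> f r = g r} -> mu.-integrable pos (EFin \o g).
Proof.
move=> fi mg fg; apply: (ae_eq_integrable _ fi); first exact: measurable_pos.
  exact/measurable_EFinP.
by move: fg; apply: ae_imp => r h; rewrite in_posE => /h /= ->.
Qed.

Lemma wLnorm_ae q t f g : measurable_fun pos f -> measurable_fun pos g ->
  {ae mu, forall r, 0 < r -> f r = g r} -> wLnorm q t f = wLnorm q t g.
Proof.
move=> mf mg fg.
suff E : (\int[mu]_(r in pos) (`|f r| `^ q * r `^ t)%:E =
          \int[mu]_(r in pos) (`|g r| `^ q * r `^ t)%:E)%E by rewrite /wLnorm E.
apply: ae_eq_integral; first exact: measurable_pos.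
- by apply/measurable_EFinP; exact: measurable_weight.
- by apply/measurable_EFinP; exact: measurable_weight.
by move: fg; apply: ae_imp => r h; rewrite in_posE => /h ->.
Qed.

Lemma wLspace2_addZ_ae t f g h e : wLspace 2 t f -> wLspace 2 t g ->
  measurable_fun pos h -> {ae mu, forall r, 0 < r -> h r = f r + e * g r} ->
  wLspace 2 t h.
Proof.
move=> /wLspace2P[mf fi] /wLspace2P[mg gi] mh hE; apply/wLspace2P; split => //.
have mw (k : R -> R) : measurable_fun pos k -> measurable_fun pos (fun r => k r ^+ 2 * r `^ t).
  move=> mk; apply: measurable_funM; last exact: powR_measurable.
  exact: measurable_funX.
apply: (@integrable_ae (fun r => (f r + e * g r) ^+ 2 * r `^ t)); last first.
- by move: hE; apply: ae_imp => r H /H ->.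
- exact: mw.
apply: integrable_dominated (integrable_linear 2 (2 * e ^+ 2) fi gi).
  apply: mw; apply: measurable_funD => //; apply: measurable_funM => //.
move=> r r0; rewrite ger0_norm; last by rewrite mulr_ge0 ?sqr_ge0 ?powR_ge0.
rewrite [X in _ <= X](_ : _ = (2 * f r ^+ 2 + 2 * (e * g r) ^+ 2) * r `^ t); last by ring.
apply: ler_wpM2r; first exact: powR_ge0.
by have := sqr_ge0 (f r - e * g r); nra.
Qed.

Lemma derive1n_addZ_ae u v e j : AC1loc u -> AC1loc v -> (j <= 2)%N ->
  {ae mu, forall r, 0 < r ->
    derive1n j (fun r => u r + e * v r) r = derive1n j u r + e * derive1n j v r}.
Proof.
move=> uac vac; case: j => [|[|[|//]]] _.
- by apply: aeW => r.
- have [du _] := uac; have [dv _] := vac.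
  by apply: aeW => r r0 /=; rewrite derive1_addZ; [|exact: du|exact: dv].
- exact: derive1n2_addZ_ae.
Qed.

Lemma X22_addZ al u v e : X22 al u -> X22 al v -> X22 al (fun r => u r + e * v r).
Proof.
move=> [uac hu] [vac hv]; have uv := AC1loc_addZ e uac vac.
split; first exact: uv.
move=> j j2; apply: (@wLspace2_addZ_ae _ (derive1n j u) (derive1n j v) _ e (hu j j2) (hv j j2)).
  exact: AC1loc_measurable.
exact: derive1n_addZ_ae.
Qed.

Lemma D22_pre_addZ al u v e : D22_pre al u -> D22_pre al v ->
  D22_pre al (fun r => u r + e * v r).
Proof.
move=> [uac u0 u1 u2] [vac v0 v1 v2]; have uv := AC1loc_addZ e uac vac.
have lim0 f g : f r @[r --> +oo%R] --> (0 : R) -> g r @[r --> +oo%R] --> (0 : R) ->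
    (f r + e * g r) @[r --> +oo%R] --> (0 : R).
  move=> f0 g0; rewrite -[X in _ --> X](_ : 0 + e * 0 = 0); last by rewrite mulr0 addr0.
  by apply: cvgD => //; apply: cvgMr.
split; [exact: uv|exact: lim0| |].
- have [du _] := uac; have [dv _] := vac.
  have := lim0 _ _ u1 v1; apply: cvg_trans; apply: near_eq_cvg.
  near=> r; have r0 : 0 < r by near: r; exact: nbhs_pinfty_gt.
  by rewrite derive1_addZ; [|exact: du|exact: dv].
- apply: (wLspace2_addZ_ae (e := e) u2 v2).
    exact: (AC1loc_measurable uv (leqnn 2)).
  exact: derive1n2_addZ_ae.
Unshelve. all: by end_near. Qed.

(** If [v n] approximates [u], then [v n + e phi] approximates [u + e phi] with
    the same error. *)
Lemma D22_addZ al u phi e : D22 al u -> D22_pre al phi -> X22 al phi ->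
  D22 al (fun r => u r + e * phi r).
Proof.
move=> [Xu [v [vpre vlim]]] ppre Xp; split; first exact: X22_addZ.
exists (fun n r => v n r + e * phi r); split.
  by move=> n; exact: (D22_pre_addZ e (vpre n) ppre).
move: vlim; apply: cvg_trans; apply: near_eq_cvg; apply: nearW => n.
have [vac _ _ _] := vpre n; have [pac _ _ _] := ppre; have [uac _] := Xu.
have vp := AC1loc_addZ e vac pac; have up := AC1loc_addZ e uac pac.
have m2 (w : R -> R) : AC1loc w -> measurable_fun pos (derive1n 2 w).
  by move=> wac; exact: (AC1loc_measurable wac (leqnn 2)).
apply: wLnorm_ae; [by apply: measurable_funB; exact: m2..|].
have A := derive1n2_addZ_ae e vac pac; have B := derive1n2_addZ_ae e uac pac.
apply: (ae_imp2 _ A B) => r h1 h2 r0.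
rewrite (h1 r0) (h2 r0).
by move: (derive1n 2 (v n) r) (derive1n 2 u r) (derive1n 2 phi r) => a b c; ring.
Qed.

End Linear.

(** * Integrability of powers *)

Lemma integrable_disjointU d (T : measurableType d) (R : realType)
    (mu : {measure set T -> \bar R}) (A B : set T) (f : T -> \bar R) :
  measurable A -> measurable B -> [disjoint A & B] ->
  mu.-integrable A f -> mu.-integrable B f -> mu.-integrable (A `|` B) f.
Proof.
move=> mA mB AB /integrableP[mfA fA] /integrableP[mfB fB].
have mf : measurable_fun (A `|` B) f by apply/measurable_funU.
apply/integrableP; split => //.
rewrite ge0_integral_setU//; first exact: lte_add_pinfty.
exact: measurableT_comp.
Qed.

Section Powers.
Context (R : realType).
Implicit Types (f g F : R -> R) (r x y s t c : R).

Local Notation mu := (@lebesgue_measure R).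
Local Notation pos := (`]0, +oo[ : set R).

Section Exhaustion.
Context (f F : R -> R) (a b : nat -> R).
Context (f0 : forall r, 0 < r -> 0 <= f r)
  (cf : forall r, 0 < r -> {for r, continuous f})
  (dF : forall r, 0 < r -> is_derive r 1 F (f r))
  (ab : forall n, 0 < a n /\ a n <= b n)
  (mono : forall n m, (n <= m)%N -> a m <= a n /\ b n <= b m).

Let sub n : `[a n, b n] `<=` pos.
Proof.
move=> z /=; rewrite !in_itv/= andbT => /andP[az _].
by have [a0 _] := ab n; exact: lt_le_trans az.
Qed.

Let mf n : measurable_fun `[a n, b n] (EFin \o f).
Proof.
apply/measurable_EFinP; apply: (measurable_funS (@measurable_pos R) (@sub n)).
exact: pos_continuous_measurable.
Qed.

(** Monotone convergence; on each segment the integral of [f] is the increment of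
    its primitive. *)
Lemma exhaustion_cvg : (F (b n) - F (a n))%:E @[n --> \oo] -->
  (\int[mu]_(x in \bigcup_n `[a n, b n]) (f x)%:E)%E.
Proof.
have mI n : measurable (`[a n, b n]%classic : set R) by exact: measurable_itv.
have -> : (fun n => (F (b n) - F (a n))%:E) =
    (fun n => \int[mu]_(x in `[a n, b n]) (EFin \o f) x)%E.
  apply/funext => n; have [a0 anb] := ab n.
  have ifn : mu.-integrable `[a n, b n] (EFin \o f) by exact: pos_continuous_integrable.
  rewrite (pos_FTC2 a0 anb dF cf) /Rintegral fineK//.
  by apply: integrable_fin_num => //; exact: mI.
apply: ge0_nondecreasing_set_cvg_integral => //.
  move=> n m /mono[h1 h2]; apply/subsetPset => z /=; rewrite !in_itv/=.
  by move=> /andP[h3 h4]; apply/andP; split; lra.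
by move=> n z /sub; rewrite in_posE lee_fin => /f0.
Qed.

Lemma exhaustion_integrable (A : set R) K : A = \bigcup_n `[a n, b n] ->
  (forall n, F (b n) - F (a n) <= K) -> mu.-integrable A (EFin \o f).
Proof.
move=> -> FK.
have mI n : measurable (`[a n, b n]%classic : set R) by exact: measurable_itv.
apply/integrableP; split; first by apply/measurable_fun_bigcup.
have E : (\int[mu]_(x in \bigcup_n `[a n, b n]) `|(EFin \o f) x| =
    \int[mu]_(x in \bigcup_n `[a n, b n]) (f x)%:E)%E.
  apply: eq_integral => z; rewrite inE => -[n _ /sub]; rewrite in_posE => z0 /=.
  by rewrite ger0_norm// f0.
rewrite [X in (X < _)%E]E; apply: (@le_lt_trans _ _ K%:E); last exact: ltry.
rewrite -(cvg_lim _ exhaustion_cvg)//; apply: lime_le.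
  by apply/cvg_ex; eexists; exact: exhaustion_cvg.
by apply: nearW => n; rewrite lee_fin.
Qed.

End Exhaustion.

Lemma is_derive_powR_primitive s r : s + 1 != 0 -> 0 < r ->
  is_derive r 1 (fun z => (s + 1)^-1 * z `^ (s + 1)) (r `^ s).
Proof.
move=> s1 r0; apply: (is_deriveZ_eq (is_derive_powR (s + 1) r0)).
by rewrite mulrA mulVf// mul1r addrK.
Qed.

Lemma integrable_powR0 s y : -1 < s -> 0 < y ->
  mu.-integrable `]0, y] (EFin \o (@powR R ^~ s)).
Proof.
move=> s1 y0; have s10 : 0 < s + 1 by lra.
apply: (@exhaustion_integrable _ (fun z => (s + 1)^-1 * z `^ (s + 1))
  (fun n => y / n.+1%:R) (fun=> y) _ _ _ _ _ _ ((s + 1)^-1 * y `^ (s + 1))).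
- by move=> r _; exact: powR_ge0.
- by move=> r r0; exact: powR_continuous.
- by move=> r r0; apply: is_derive_powR_primitive => //; rewrite gt_eqF.
- move=> n; split; first by rewrite divr_gt0.
  by rewrite ler_pdivrMr// ler_peMr// ?ler1n// ltW.
- move=> n m nm; split => //; rewrite ler_pM2l// lef_pV2 ?posrE ?ltr0n//.
  by rewrite ler_nat ltnS.
- apply/seteqP; split => [z /=|z [n _] /=]; rewrite !in_itv/=; last first.
    by move=> /andP[h ->]; rewrite andbT; apply: lt_le_trans h; rewrite divr_gt0.
  move=> /andP[z0 zy]; exists (Num.Def.archi_bound (y / z)) => //=.
  rewrite in_itv/= zy andbT ler_pdivrMr// mulrC -ler_pdivrMr//.
  apply: le_trans (ltW (archi_boundP _)) _; first by rewrite divr_ge0 ?ltW.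
  by rewrite ler_nat.
- by move=> n; rewrite gerBl mulr_ge0 ?powR_ge0// invr_ge0 ltW.
Qed.

Lemma integrable_powRy t y : t < -1 -> 0 < y ->
  mu.-integrable `[y, +oo[ (EFin \o (@powR R ^~ t)).
Proof.
move=> t1 y0; have t10 : t + 1 < 0 by lra.
apply: (@exhaustion_integrable _ (fun z => (t + 1)^-1 * z `^ (t + 1))
  (fun=> y) (fun n => y + n%:R) _ _ _ _ _ _ (- ((t + 1)^-1 * y `^ (t + 1)))).
- by move=> r _; exact: powR_ge0.
- by move=> r r0; exact: powR_continuous.
- by move=> r r0; apply: is_derive_powR_primitive => //; rewrite lt_eqF.
- by move=> n; split => //; rewrite lerDl.
- by move=> n m nm; split => //; rewrite lerD2l ler_nat.
- apply/seteqP; split => [z /=|z [n _] /=]; rewrite !in_itv/= ?andbT; last first.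
    by move=> /andP[].
  move=> yz; exists (Num.Def.archi_bound (z - y)) => //=.
  rewrite in_itv/= yz /= -lerBlDl ltW// archi_boundP// subr_ge0//.
- move=> n; rewrite lerBlDr addNr; apply: mulr_le0_ge0; last exact: powR_ge0.
  by rewrite invr_le0 ltW.
Qed.

Lemma integrable_two_powers f s t y c : -1 < s -> t < -1 -> 0 < y ->
  measurable_fun pos f ->
  (forall r, 0 < r -> r < y -> `|f r| <= c * r `^ s) ->
  (forall r, y < r -> `|f r| <= c * r `^ t) ->
  mu.-integrable pos (EFin \o f).
Proof.
move=> s1 t1 y0 mf h1 h2.
have E : pos = `]0, y[ `|` `[y, +oo[.
  apply/seteqP; split => [z /=|z [] /=]; rewrite !in_itv/= ?andbT.
  - by move=> z0; rewrite z0 /=; case: (ltP z y); [left|right].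
  - by move=> /andP[].
  - exact: lt_le_trans.
have m1 : measurable (`]0, y[ : set R) by exact: measurable_itv.
have m2 : measurable (`[y, +oo[ : set R) by exact: measurable_itv.
have i1 : mu.-integrable `]0, y[ (EFin \o (fun r => c * r `^ s)).
  have -> : EFin \o (fun r => c * r `^ s) = (fun r => c%:E * (EFin \o (@powR R ^~ s)) r)%E.
    by apply/funext => r /=; rewrite EFinM.
  apply: integrableZl => //; apply: integrable_sub (integrable_powR0 s1 y0) => //.
    by move=> z /=; rewrite !in_itv/= => /andP[-> /ltW].
pose c' := Num.max c (`|f y| / y `^ t).
have i2 : mu.-integrable `[y, +oo[ (EFin \o (fun r => c' * r `^ t)).
  have -> : EFin \o (fun r => c' * r `^ t) = (fun r => c'%:E * (EFin \o (@powR R ^~ t)) r)%E.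
    by apply/funext => r /=; rewrite EFinM.
  by apply: integrableZl => //; exact: integrable_powRy.
have disj : [disjoint `]0, y[%classic & `[y, +oo[%classic]%classic.
  apply/disj_setPS => z [] /=; rewrite !in_itv/= andbT => /andP[_ h1'] h2'.
  by have := lt_le_trans h1' h2'; rewrite ltxx.
rewrite E; apply: integrable_disjointU => //.
- apply: le_integrable i1 => //.
    apply/measurable_EFinP; apply: measurable_funS mf; first exact: measurable_pos.
    by rewrite E; left.
  move=> r /=; rewrite in_itv/= => /andP[r0 ry]; rewrite lee_fin.
  exact: le_trans (h1 r r0 ry) (ler_norm _).
- apply: le_integrable i2 => //.
    apply/measurable_EFinP; apply: measurable_funS mf; first exact: measurable_pos.
    by rewrite E; right.
  move=> r /=; rewrite in_itv/= andbT => yr; rewrite lee_fin.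
  apply: le_trans (ler_norm _).
  move: yr; rewrite le_eqVlt => /orP[/eqP <-|yr].
    by rewrite -ler_pdivrMr ?powR_gt0// /c' le_max lexx orbT.
  apply: le_trans (h2 r yr) _; apply: ler_wpM2r; first exact: powR_ge0.
  by rewrite /c' le_max lexx.
Qed.

End Powers.

(** * The potential of a ball as a test function *)

Section BallPotential.
Context (R : realType) (al : R) (al3 : 3 < al).
Implicit Types (f g h : R -> R) (r x y : R).

Local Notation mu := (@lebesgue_measure R).
Local Notation pos := (`]0, +oo[ : set R).

Local Ltac side_lra := repeat (apply/andP; split); move: al3; lra.

(** The potential below is defined by two formulas; this gives its derivative where
    they meet. *)
Lemma is_derive_glue f g h x l :
  (forall z, z <= x -> f z = g z) -> (forall z, x <= z -> f z = h z) ->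
  is_derive x 1 g l -> is_derive x 1 h l -> is_derive x 1 f l.
Proof.
move=> fg fh dg dh.
have E k : (fun t => t^-1 *: (k (t *: 1 + x) - k x)) = slope k x.
  by apply/funext => t; rewrite /slope -[t *: 1]/(t * 1) mulr1.
have cg : slope g x t @[t --> 0^'] --> l by rewrite -E; case: dg => dg <-; exact: dg.
have ch : slope h x t @[t --> 0^'] --> l by rewrite -E; case: dh => dh <-; exact: dh.
have cf : slope f x t @[t --> 0^'] --> l.
  apply/cvgrPdist_lt => e e0; near=> t.
  have Hg : `|l - slope g x t| < e by near: t; exact: cvgr_dist_lt.
  have Hh : `|l - slope h x t| < e by near: t; exact: cvgr_dist_lt.
  have [t0|t0] := leP t 0.
    have -> : slope f x t = slope g x t by rewrite /slope !fg// gerDr.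
    exact: Hg.
  have -> : slope f x t = slope h x t by rewrite /slope !fh// lerDr ltW.
  exact: Hh.
split; first by apply/cvg_ex; exists l; rewrite E.
by rewrite /derive E; apply/cvg_lim.
Unshelve. all: by end_near. Qed.

Definition inner_potential y r : R :=
  (2 * (al + 1))^-1 * r ^+ 2 - (2 * (al - 1))^-1 * y ^+ 2.

Definition outer_potential y r : R :=
  - (y `^ (al + 1) / ((al + 1) * (al - 1))) * r `^ (1 - al).

(** The decaying solution of [Delta phi = 1] on [(0, y)], [Delta phi = 0] on
    [(y, +oo)]. *)
Definition ball_potential y r : R :=
  if r <= y then inner_potential y r else outer_potential y r.

(** The derivative of [ball_potential]: writing its two branches as a minimum shows
    that it is locally Lipschitz. *)
Definition ball_field y r : R :=
  (al + 1)^-1 * Num.min r (y `^ (al + 1) * r `^ (- al)).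

Lemma outer_field_le y r : 0 < y -> 0 < r -> (r <= y) = (r <= y `^ (al + 1) * r `^ (- al)).
Proof.
move=> y0 r0; have ral : 0 < r `^ al by exact: powR_gt0.
have E : (r <= y `^ (al + 1) * r `^ (- al)) = (r `^ (al + 1) <= y `^ (al + 1)).
  have -> : r `^ (al + 1) = r * r `^ al.
    by rewrite powRDp// powRr1 1?mulrC// ltW.
  by rewrite powRN ler_pdivlMr.
have al1 : 0 < al + 1 by (move: al3; lra).
rewrite E; apply/idP/idP => h.
  by apply: ge0_ler_powR; rewrite ?nnegrE // ltW.
rewrite leNgt; apply/negP => yr; have : y `^ (al + 1) < r `^ (al + 1).
  by apply: gt0_ltr_powR; rewrite ?nnegrE // ltW.
by rewrite ltNge h.
Qed.

Lemma ball_field_in y r : 0 < y -> 0 < r -> r <= y ->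
  ball_field y r = (al + 1)^-1 * r.
Proof.
by move=> y0 r0 ry; rewrite /ball_field (min_idPl _)// -outer_field_le.
Qed.

Lemma ball_field_out y r : 0 < y -> y <= r ->
  ball_field y r = (al + 1)^-1 * (y `^ (al + 1) * r `^ (- al)).
Proof.
move=> y0; rewrite le_eqVlt => /orP[/eqP <-|yr].
  rewrite ball_field_in// -powRDp// addrAC subrr add0r powRr1// ltW//.
have r0 : 0 < r by exact: lt_trans yr.
rewrite /ball_field (min_idPr _)//; apply: ltW.
by rewrite ltNge -outer_field_le// -ltNge.
Qed.

Lemma is_derive_sqr r : is_derive r 1 (fun z : R => z ^+ 2) (2 * r).
Proof.
under eq_fun do rewrite expr2.
by apply: (is_deriveM_eq (is_derive_id r 1) (is_derive_id r 1)); ring.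
Qed.

Lemma inner_potential_derive y r :
  is_derive r 1 (inner_potential y) ((al + 1)^-1 * r).
Proof.
apply: (is_deriveB_eq (is_deriveZ_eq (is_derive_sqr r) erefl) (is_derive_cst _ _ _)).
by field; side_lra.
Qed.

Lemma outer_potential_derive y r : 0 < r ->
  is_derive r 1 (outer_potential y) ((al + 1)^-1 * (y `^ (al + 1) * r `^ (- al))).
Proof.
move=> r0; apply: (is_deriveZ_eq (is_derive_powR (1 - al) r0)).
rewrite (_ : 1 - al - 1 = - al); last by ring.
by field; side_lra.
Qed.

Lemma potentials_agree y : 0 < y -> inner_potential y y = outer_potential y y.
Proof.
move=> y0; rewrite /inner_potential /outer_potential.
have -> : y `^ (al + 1) / ((al + 1) * (al - 1)) =
    y `^ (al - 1) * y ^+ 2 / ((al + 1) * (al - 1)).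
  rewrite -powR_mulrn ?ltW// -powRDp//; congr (_ `^ _ / _); ring.
rewrite (_ : 1 - al = - (al - 1)); last by ring.
rewrite powRN; have := powR_gt0 (al - 1) y0; move: (y `^ _) => w w0.
by field; side_lra.
Qed.

Lemma ball_potential_derive y r : 0 < y -> 0 < r ->
  is_derive r 1 (ball_potential y) (ball_field y r).
Proof.
move=> y0 r0; have [ry|yr|ry] := ltgtP r y.
- rewrite (ball_field_in y0 r0 (ltW ry)).
  apply: near_eq_is_derive (inner_potential_derive y r).
  by near=> z; rewrite /ball_potential ifT// ltW//; near: z; exact: lt_nbhsl.
- rewrite (ball_field_out y0 (ltW yr)).
  apply: near_eq_is_derive (outer_potential_derive y r0).
  by near=> z; rewrite /ball_potential ifF//; apply/negbTE; rewrite -ltNge;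
    near: z; exact: lt_nbhsr.
- rewrite ry; apply: (@is_derive_glue _ (inner_potential y) (outer_potential y)).
  + by move=> z zy; rewrite /ball_potential zy.
  + move=> z; rewrite le_eqVlt => /orP[/eqP <-|yz]; rewrite /ball_potential.
      by rewrite lexx potentials_agree.
    by rewrite leNgt yz.
  + by rewrite ball_field_in//; exact: inner_potential_derive.
  + by rewrite ball_field_out//; exact: outer_potential_derive.
Unshelve. all: by end_near. Qed.

Lemma ball_potential_derive1 y r : 0 < y -> 0 < r ->
  derive1 (ball_potential y) r = ball_field y r.
Proof. by move=> y0 r0; have [_] := ball_potential_derive y0 r0; rewrite derive1E. Qed.

Lemma ball_potential_derive1n2_in y r : 0 < y -> 0 < r -> r < y ->
  derive1n 2 (ball_potential y) r = (al + 1)^-1.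
Proof.
move=> y0 r0 ry /=.
have d : is_derive r 1 (derive1 (ball_potential y)) (al + 1)^-1.
  apply: (near_eq_is_derive (f := fun z => (al + 1)^-1 * z)); last first.
    by apply: (is_deriveZ_eq (is_derive_id r 1)); rewrite mulr1.
  near=> z; have z0 : 0 < z by near: z; exact: lt_nbhsr.
  have zy : z < y by near: z; exact: lt_nbhsl.
  by rewrite ball_potential_derive1// ball_field_in// ltW.
by have [_] := d; rewrite derive1E.
Unshelve. all: by end_near. Qed.

Lemma ball_potential_derive1n2_out y r : 0 < y -> y < r ->
  derive1n 2 (ball_potential y) r =
  - al / (al + 1) * (y `^ (al + 1) * r `^ (- al - 1)).
Proof.
move=> y0 yr /=; have r0 : 0 < r by exact: lt_trans yr.
have d : is_derive r 1 (derive1 (ball_potential y))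
    (- al / (al + 1) * (y `^ (al + 1) * r `^ (- al - 1))).
  apply: (near_eq_is_derive
    (f := fun z => (al + 1)^-1 * (y `^ (al + 1) * z `^ (- al)))); last first.
    apply: (is_deriveZ_eq (is_deriveZ_eq (is_derive_powR (- al) r0) erefl)).
    by ring.
  near=> z; have z0 : 0 < z by near: z; exact: lt_nbhsr.
  have yz : y < z by near: z; exact: lt_nbhsr.
  by rewrite ball_potential_derive1// ball_field_out// ltW.
by have [_] := d; rewrite derive1E.
Unshelve. all: by end_near. Qed.

Lemma Delta_ball_potential_in y r : 0 < y -> 0 < r -> r < y ->
  Delta al (ball_potential y) r = 1.
Proof.
move=> y0 r0 ry; rewrite /Delta ball_potential_derive1n2_in//.
rewrite ball_potential_derive1// ball_field_in ?(ltW ry)//.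
by field; side_lra.
Qed.

Lemma Delta_ball_potential_out y r : 0 < y -> y < r ->
  Delta al (ball_potential y) r = 0.
Proof.
move=> y0 yr; have r0 : 0 < r by exact: lt_trans yr.
rewrite /Delta ball_potential_derive1n2_out//.
rewrite ball_potential_derive1// ball_field_out ?(ltW yr)//.
have -> : r `^ (- al - 1) = r `^ (- al) * r^-1 by rewrite powRDp// powR_inv1// ltW.
move: (r `^ _) (y `^ _) => a b.
by field; side_lra.
Qed.

Lemma ball_field_lipschitz y a x z : 0 < y -> 0 < a -> a <= x -> x <= z ->
  `|ball_field y z - ball_field y x| <=
  (1 + al * y `^ (al + 1) * a `^ (- al - 1)) * (z - x).
Proof.
move=> y0 a0 ax xz; pose L := al * y `^ (al + 1) * a `^ (- al - 1).
have x0 : 0 < x by exact: lt_le_trans ax.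
have z0 : 0 < z by exact: lt_le_trans xz.
have L0 : 0 <= L by rewrite /L !mulr_ge0 ?powR_ge0//; (move: al3; lra).
pose q r := y `^ (al + 1) * r `^ (- al).
have dq r : 0 < r -> is_derive r 1 q (y `^ (al + 1) * (- al * r `^ (- al - 1))).
  by move=> r0; apply: (is_deriveZ_eq (is_derive_powR (- al) r0)).
have q1 : q z <= q x.
  suff : - q x <= - q z by (move: al3; lra).
  apply: (@pos_monotone _ (fun r => - q r) (fun r => - (y `^ (al + 1) * (- al * r `^ (- al - 1))))) => //.
    move=> r r0; rewrite -[X in is_derive _ _ _ X]mulN1r.
    have -> : (fun r => - q r) = (fun r => -1 * q r).
      by apply/funext => t; rewrite mulN1r.
    exact: (is_deriveZ_eq (dq r r0) erefl).
  move=> r /andP[xr _]; rewrite mulNr mulrN opprK.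
  by rewrite !mulr_ge0 ?powR_ge0//; (move: al3; lra).
have q2 : q x - q z <= L * (z - x).
  suff : L * x + q x <= L * z + q z by (move: al3; lra).
  apply: (@pos_monotone _ (fun r => L * r + q r)
    (fun r => L * 1 + y `^ (al + 1) * (- al * r `^ (- al - 1)))) => //.
    move=> r r0.
    exact: (is_deriveD_eq (is_deriveZ_eq (is_derive_id r 1) erefl) (dq r r0) erefl).
  move=> r /andP[xr _].
  have r0 : 0 < r by exact: lt_trans xr.
  rewrite mulr1 /L; have : r `^ (- al - 1) <= a `^ (- al - 1).
    rewrite (_ : - al - 1 = - (al + 1)); last by ring.
    rewrite !powRN lef_pV2 ?posrE ?powR_gt0//.
    apply: ge0_ler_powR; rewrite ?nnegrE ?ltW//; (move: al3; lra).
  have := powR_ge0 y (al + 1); move: (y `^ _) (r `^ _) (a `^ _) => A B C A0 BC.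
  rewrite (_ : _ + _ = al * A * (C - B)); last by ring.
  by rewrite !mulr_ge0//; (move: al3; lra).
have al1 : 0 < (al + 1)^-1 <= 1.
  by rewrite invr_gt0 invf_le1; (move: al3; lra).
have m : `|Num.min z (q z) - Num.min x (q x)| <= (1 + L) * (z - x).
  have K0 : 0 <= L * (z - x) by rewrite mulr_ge0// subr_ge0.
  rewrite mulrDl mul1r ler_norml; move: K0 q1 q2.
  move: (L * (z - x)) (q x) (q z) => K A B K0 q1 q2.
  by case: (leP z B) => ?; case: (leP x A) => ?; apply/andP; split; lra.
rewrite /ball_field -mulrBr normrM gtr0_norm; last by case/andP: al1.
apply: le_trans m; rewrite -/(q z) -/(q x).
by rewrite ler_piMl//; case/andP: al1.
Qed.

Lemma ball_potential_AC1loc y : 0 < y -> AC1loc (ball_potential y).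
Proof.
move=> y0; split.
  by move=> r r0; have [] := ball_potential_derive y0 r0.
move=> a b a0 ab; apply: (@abs_continuous_eq _ _ _ (ball_field y)).
  move=> x /andP[ax _]; rewrite ball_potential_derive1//; (move: al3; lra).
apply: (@lipschitz_abs_continuous _ _ _ _
  (1 + al * y `^ (al + 1) * a `^ (- al - 1))) => x z ax xz zb.
exact: (ball_field_lipschitz y0 a0 ax xz).
Qed.

Lemma ball_potential_measurable y : 0 < y -> forall j, (j <= 2)%N ->
  measurable_fun pos (derive1n j (ball_potential y)).
Proof. by move=> y0 j j2; exact: (AC1loc_measurable (ball_potential_AC1loc y0)). Qed.

Lemma wLspace2_two_powers (t s s' y c : R) f : measurable_fun pos f -> 0 < y ->
  -1 < s * 2 + t -> s' * 2 + t < -1 ->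
  (forall r, 0 < r -> r < y -> `|f r| <= c * r `^ s) ->
  (forall r, y < r -> `|f r| <= c * r `^ s') ->
  wLspace 2 t f.
Proof.
move=> mf y0 h1 h2 f1 f2; apply/wLspace2P; split => //.
have key r k : 0 < r -> `|f r| <= c * r `^ k ->
    `|f r ^+ 2 * r `^ t| <= c ^+ 2 * r `^ (k * 2 + t).
  move=> r0 H; rewrite powRDp// powRrM powR_mulrn ?powR_ge0// mulrA -exprMn.
  rewrite normrM (ger0_norm (powR_ge0 _ _)); apply: ler_wpM2r; first exact: powR_ge0.
  by rewrite normrX; apply: lerXn2r => //; rewrite nnegrE; exact: le_trans H.
apply: (integrable_two_powers (c := c ^+ 2) h1 h2 y0).
- apply: measurable_funM; last exact: powR_measurable.
  exact: measurable_funX.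
- by move=> r r0 ry; apply: key => //; exact: f1.
- by move=> r yr; apply: key; [exact: lt_trans yr|exact: f2].
Qed.

Lemma ball_potential_wLspace y : 0 < y -> forall j : nat, (j <= 2)%N ->
  wLspace 2 (al - 2 * (2 - j%:R)) (derive1n j (ball_potential y)).
Proof.
move=> y0 j j2; have mj := ball_potential_measurable y0 j2.
have al1 : 0 < al + 1 by (move: al3; lra). have al1' : 0 < al - 1 by (move: al3; lra).
case: j j2 mj => [|[|[|//]]] _ mj.
- pose c1 := (2 * (al + 1))^-1 * y ^+ 2 + (2 * (al - 1))^-1 * y ^+ 2.
  pose c2 := y `^ (al + 1) / ((al + 1) * (al - 1)).
  have c20 : 0 <= c2 by rewrite /c2 divr_ge0 ?powR_ge0// mulr_ge0// ltW.
  have c10 : 0 <= c1 by rewrite /c1 addr_ge0// mulr_ge0 ?sqr_ge0// invr_ge0; (move: al3; lra).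
  apply: (@wLspace2_two_powers _ 0 (1 - al) y (c1 + c2)) => //=; try (move: al3; lra).
  + move=> r r0 ry; rewrite powRr0 mulr1 /ball_potential (ltW ry) /inner_potential.
    apply: le_trans (ler_normB _ _) _.
    rewrite !ger0_norm; last 2 first.
      by rewrite mulr_ge0 ?sqr_ge0// invr_ge0; (move: al3; lra).
      by rewrite mulr_ge0 ?sqr_ge0// invr_ge0; (move: al3; lra).
    suff : (2 * (al + 1))^-1 * r ^+ 2 <= (2 * (al + 1))^-1 * y ^+ 2 by rewrite /c1; (move: al3; lra).
    apply: ler_wpM2l; first by rewrite invr_ge0; (move: al3; lra).
    by apply: lerXn2r; rewrite ?nnegrE ltW.
  + move=> r yr; rewrite /ball_potential [r <= y]leNgt yr /= /outer_potential.
    rewrite normrM normrN (ger0_norm (powR_ge0 _ _)) -/c2 (ger0_norm c20).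
    by apply: ler_wpM2r; [exact: powR_ge0|(move: al3; lra)].
- pose c := (al + 1)^-1 * Num.max 1 (y `^ (al + 1)).
  apply: (@wLspace2_two_powers _ 1 (- al) y c) => //=; try (move: al3; lra).
  + move=> r r0 ry; rewrite ball_potential_derive1// ball_field_in ?(ltW ry)//.
    rewrite powRr1 ?(ltW r0)// ger0_norm; last first.
      by rewrite mulr_ge0 ?(ltW r0)// invr_ge0 ltW.
    apply: ler_wpM2r; first exact: ltW.
    by rewrite /c ler_peMr ?invr_ge0 ?(ltW al1)// le_max lexx.
  + move=> r yr; have r0 : 0 < r by exact: lt_trans yr.
    rewrite ball_potential_derive1// ball_field_out ?(ltW yr)//.
    rewrite ger0_norm; last by rewrite !mulr_ge0 ?powR_ge0// invr_ge0 ltW.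
    rewrite /c -mulrA; apply: ler_wpM2l; first by rewrite invr_ge0 ltW.
    by apply: ler_wpM2r; [exact: powR_ge0|rewrite le_max lexx orbT].
- pose c := (al + 1)^-1 + al / (al + 1) * y `^ (al + 1).
  have c0 : 0 <= al / (al + 1) * y `^ (al + 1).
    by rewrite mulr_ge0 ?powR_ge0// divr_ge0; (move: al3; lra).
  have c0' : 0 <= (al + 1)^-1 by rewrite invr_ge0 ltW.
  apply: (@wLspace2_two_powers _ 0 (- al - 1) y c) => //; try (move: al3; lra).
  + move=> r r0 ry; rewrite ball_potential_derive1n2_in// powRr0 mulr1 ger0_norm//.
    by rewrite /c; (move: al3; lra).
  + move=> r yr; rewrite ball_potential_derive1n2_out//.
    rewrite mulrA normrM (ger0_norm (powR_ge0 _ _)); apply: ler_wpM2r; first exact: powR_ge0.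
    by rewrite !mulNr normrN ger0_norm// /c; (move: al3; lra).
Qed.

Lemma ball_potential_X22 y : 0 < y -> X22 al (ball_potential y).
Proof.
move=> y0; split; first exact: ball_potential_AC1loc.
exact: ball_potential_wLspace.
Qed.

Lemma powR_cvg_pinfty0 (c : R) : c < 0 -> r `^ c @[r --> +oo%R] --> (0 : R).
Proof.
move=> c0; apply/cvgrPdist_lt => e e0.
near=> r; have r0 : 0 < r by near: r; exact: nbhs_pinfty_gt.
rewrite sub0r normrN ger0_norm ?powR_ge0//.
have rK : e `^ (c^-1) < r by near: r; apply: nbhs_pinfty_gt; rewrite num_real.
have : (e `^ c^-1) `^ (- c) < r `^ (- c).
  by apply: gt0_ltr_powR => //; rewrite ?oppr_gt0 ?nnegrE ?powR_ge0 ?ltW.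
rewrite -powRrM mulrN mulVf ?lt_eqF// !powRN powRr1 ?ltW//.
by rewrite ltf_pV2 ?posrE// powR_gt0.
Unshelve. all: by end_near. Qed.

Lemma ball_potential_D22_pre y : 0 < y -> D22_pre al (ball_potential y).
Proof.
move=> y0; have al1 : 1 - al < 0 by (move: al3; lra). have al0 : - al < 0 by (move: al3; lra).
split.
- exact: ball_potential_AC1loc.
- pose c := - (y `^ (al + 1) / ((al + 1) * (al - 1))).
  have : c * r `^ (1 - al) @[r --> +oo%R] --> c * 0.
    by apply: cvgMr; exact: powR_cvg_pinfty0.
  rewrite mulr0; apply: cvg_trans; apply: near_eq_cvg.
  near=> r; have yr : y < r by near: r; apply: nbhs_pinfty_gt; rewrite num_real.
  by rewrite /ball_potential [r <= y]leNgt yr.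
- pose c := (al + 1)^-1 * y `^ (al + 1).
  have : c * r `^ (- al) @[r --> +oo%R] --> c * 0.
    by apply: cvgMr; exact: powR_cvg_pinfty0.
  rewrite mulr0; apply: cvg_trans; apply: near_eq_cvg.
  near=> r; have yr : y < r by near: r; apply: nbhs_pinfty_gt; rewrite num_real.
  have r0 : 0 < r by exact: lt_trans yr.
  by rewrite ball_potential_derive1// ball_field_out ?(ltW yr)// -mulrA.
- have := ball_potential_wLspace y0 (leqnn 2).
  by rewrite (_ : al - 2 * (2 - 2%:R) = al) //; ring.
Unshelve. all: by end_near. Qed.

End BallPotential.

(** * The Euler-Lagrange equation *)

Section PowerNonlinearity.
Context (R : realType).
Implicit Types (p q x y t a b : R).

(** Write [t `^ q = t * t `^ (q - 1)] and use [expR x >= 1 + x] together with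
    [ln t >= 1 - t^-1]. *)
Lemma bernoulli_powR q t : 1 <= q -> 0 <= t -> 1 + q * (t - 1) <= t `^ q.
Proof.
move=> q1; rewrite le_eqVlt => /orP[/eqP <-|t0].
  by rewrite powR0 ?gt_eqF//; lra.
have -> : t `^ q = t * t `^ (q - 1).
  by rewrite -{2}[t]powRr1 ?(ltW t0)// -powRDp//; congr (_ `^ _); ring.
have h1 : 1 + (q - 1) * ln t <= t `^ (q - 1).
  by rewrite /powR gt_eqF//; exact: expR_ge1Dx.
have h2 : 1 - t^-1 <= ln t.
  have h : -1 < t^-1 - 1 by have := invr_gt0 t; rewrite t0 => ?; lra.
  have := le_ln1Dx h; rewrite addrC subrK lnV ?posrE//; lra.
apply: (@le_trans _ _ (t * (1 + (q - 1) * ln t))); last by rewrite ler_pM2l.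
have h3 : (q - 1) * (1 - t^-1) <= (q - 1) * ln t by apply: ler_wpM2l => //; lra.
apply: (@le_trans _ _ (t * (1 + (q - 1) * (1 - t^-1)))).
  rewrite le_eqVlt; apply/orP; left; apply/eqP; field; lra.
by rewrite ler_pM2l// lerD2l.
Qed.

(** [|x|^(p - 2) x], the derivative of [|x|^p / p]. *)
Definition signed_power p x : R := x * `|x| `^ (p - 2).

Lemma signed_power0 p : signed_power p 0 = 0.
Proof. by rewrite /signed_power mul0r. Qed.

(** The graph of [|.|^p] lies above its tangent at [a]: this is Bernoulli's
    inequality at [|1 + b / a|], rescaled. *)
Lemma convex_power p a b : 1 <= p ->
  `|a| `^ p + p * (signed_power p a * b) <= `|a + b| `^ p.
Proof.
move=> p1; have [->|a0] := eqVneq a 0.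
  rewrite signed_power0 mul0r mulr0 addr0 normr0 powR0 ?powR_ge0// gt_eqF//; lra.
have na : 0 < `|a| by rewrite normr_gt0.
have E : `|a + b| = `|a| * `|1 + b / a|.
  by rewrite -normrM; congr `|_|; field.
rewrite E powRM//.
have -> : signed_power p a * b = `|a| `^ p * (b / a).
  have -> : `|a| `^ p = `|a| `^ (p - 2) * `|a| ^+ 2.
    by rewrite -powR_mulrn// -powRDp//; congr (_ `^ _); ring.
  rewrite /signed_power; have -> : `|a| ^+ 2 = a ^+ 2.
    by rewrite -normrX ger0_norm ?sqr_ge0.
  by move: (_ `^ _) => w; field.
rewrite [leLHS](_ : _ = `|a| `^ p * (1 + p * (1 + b / a - 1))); last by ring.
apply: ler_wpM2l; first exact: powR_ge0.
apply: (le_trans _ (bernoulli_powR p1 (normr_ge0 _))).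
rewrite lerD2l; apply: ler_wpM2l; first by lra.
by rewrite lerD2r ler_norm.
Qed.

Lemma signed_power_young p x y : 2 < p ->
  `|signed_power p x * y| <= `|x| `^ p + `|y| `^ p.
Proof.
move=> p2; rewrite /signed_power normrM normrM (ger0_norm (powR_ge0 _ _)).
have key a : 0 <= a -> a * a `^ (p - 2) * a = a `^ p.
  rewrite le_eqVlt => /orP[/eqP <-|a0]; first by rewrite !mul0r powR0// gt_eqF//; lra.
  have -> : a `^ p = a `^ (p - 2) * a ^+ 2.
    by rewrite -powR_mulrn ?(ltW a0)// -powRDp//; congr (_ `^ _); ring.
  by ring.
have [xy|yx] := leP `|x| `|y|.
  apply: (@le_trans _ _ (`|y| * `|y| `^ (p - 2) * `|y|)).
    apply: ler_wpM2r => //; apply: ler_pM; rewrite ?powR_ge0//.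
    by apply: ge0_ler_powR; rewrite ?nnegrE//; lra.
  by rewrite key// lerDr powR_ge0.
apply: (@le_trans _ _ (`|x| * `|x| `^ (p - 2) * `|x|)).
  by apply: ler_wpM2l; rewrite ?mulr_ge0 ?powR_ge0// ltW.
by rewrite key// lerDl powR_ge0.
Qed.

Lemma signed_power_le p x y : 2 < p -> x <= y ->
  signed_power p x <= signed_power p y.
Proof.
move=> p2 xy; rewrite /signed_power.
have pos a b : 0 <= a -> a <= b -> a * `|a| `^ (p - 2) <= b * `|b| `^ (p - 2).
  move=> a0 ab; have b0 := le_trans a0 ab; rewrite !ger0_norm//.
  apply: ler_pM; rewrite ?powR_ge0//.
  by apply: ge0_ler_powR; rewrite ?nnegrE//; lra.
have [x0|x0] := leP 0 x; first exact: pos.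
have [y0|y0] := leP y 0.
  by have := pos (- y) (- x) ltac:(lra) ltac:(lra); rewrite !normrN !mulNr lerN2.
apply: (@le_trans _ _ 0); first by rewrite mulr_le0_ge0 ?powR_ge0// ltW.
by rewrite mulr_ge0 ?powR_ge0// ltW.
Qed.

(** On each half-line this is Bernoulli's inequality with exponent [p - 1]; across
    the origin the two increments add up. *)
Lemma signed_power_lipschitz p K x y : 2 < p -> `|x| <= K -> `|y| <= K ->
  `|signed_power p x - signed_power p y| <= (p - 1) * K `^ (p - 2) * `|x - y|.
Proof.
move=> p2; set L := (p - 1) * K `^ (p - 2).
have L0 : 0 <= L by rewrite /L mulr_ge0 ?powR_ge0//; lra.
have pos a b : 0 <= b -> b <= a -> a <= K ->
    `|signed_power p a - signed_power p b| <= L * `|a - b|.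
  move=> b0; rewrite le_eqVlt => /orP[/eqP ->|ba] aK.
    by rewrite !subrr normr0 mulr0.
  have a0 : 0 < a by exact: le_lt_trans ba.
  rewrite !ger0_norm; last 2 first.
  - by rewrite subr_ge0 ltW.
  - by rewrite subr_ge0; apply: signed_power_le => //; exact: ltW.
  rewrite /signed_power !ger0_norm ?(ltW a0)//.
  have h := @bernoulli_powR (p - 1) (b / a) ltac:(lra) (divr_ge0 b0 (ltW a0)).
  have E c : 0 <= c -> c * c `^ (p - 2) = c `^ (p - 1).
    rewrite le_eqVlt => /orP[/eqP <-|c0]; first by rewrite mul0r powR0// gt_eqF//; lra.
    by rewrite -{1}[c]powRr1 ?(ltW c0)// -powRDp//; congr (_ `^ _); ring.
  rewrite !E ?(ltW a0)//.
  have -> : b `^ (p - 1) = a `^ (p - 1) * (b / a) `^ (p - 1).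
    by rewrite -powRM ?divr_ge0 ?(ltW a0)//; congr (_ `^ _); field; lra.
  have aK2 : a `^ (p - 2) <= K `^ (p - 2).
    by apply: ge0_ler_powR; rewrite ?nnegrE ?(ltW a0)//; lra.
  apply: (@le_trans _ _ ((p - 1) * a `^ (p - 2) * (a - b))).
    rewrite -E ?(ltW a0)//.
    have h' : a * a `^ (p - 2) * (1 + (p - 1) * (b / a - 1)) <=
        a * a `^ (p - 2) * (b / a) `^ (p - 1).
      by apply: ler_wpM2l => //; rewrite mulr_ge0 ?powR_ge0 ?(ltW a0).
    move: h'; rewrite (_ : a * a `^ (p - 2) * (1 + (p - 1) * (b / a - 1)) =
      a * a `^ (p - 2) - (p - 1) * a `^ (p - 2) * (a - b)); last first.
      by move: (a `^ _) => w; field; lra.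
    by move: (a `^ (p - 2)) ((b / a) `^ (p - 1)) => w z; lra.
  rewrite /L; apply: ler_wpM2r; first by rewrite subr_ge0 ltW.
  by apply: ler_wpM2l => //; lra.
have N a : signed_power p (- a) = - signed_power p a.
  by rewrite /signed_power normrN mulNr.
wlog xy : x y / y <= x.
  move=> W hx hy; case: (leP y x) => h; first exact: W.
  by rewrite distrC (distrC x); apply: W => //; exact: ltW.
move=> hx hy.
have /andP[x1 x2] : - K <= x <= K by rewrite -ler_norml.
have /andP[y1 y2] : - K <= y <= K by rewrite -ler_norml.
have [y0|y0] := leP 0 y; first exact: pos.
have [x0|x0] := leP x 0.
  have := pos (- y) (- x) ltac:(lra) ltac:(lra) ltac:(lra); rewrite !N.
  by rewrite !opprK ![- _ + _]addrC.
have h1 := pos x 0 (lexx _) (ltW x0) x2.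
have h2 := pos (- y) 0 (lexx _) ltac:(lra) ltac:(lra).
rewrite signed_power0 !subr0 in h1; rewrite signed_power0 !subr0 N !normrN in h2.
apply: le_trans (ler_normB _ _) _; apply: (le_trans (lerD h1 h2)).
rewrite -mulrDr; apply: ler_wpM2l => //.
by rewrite (gtr0_norm x0) (ltr0_norm y0) ger0_norm; lra.
Qed.

Lemma signed_power_continuous p : 2 < p -> continuous (signed_power p).
Proof.
move=> p2 x; apply/cvgrPdist_lt => e e0.
pose L := (p - 1) * (`|x| + 1) `^ (p - 2) + 1.
have L0 : 0 < L.
  by rewrite /L ltr_wpDl// mulr_ge0 ?powR_ge0//; lra.
near=> y.
have xy1 : `|x - y| < 1 by near: y; exact: cvgr_dist_lt.
have xye : `|x - y| < e / L.
  by near: y; apply: cvgr_dist_lt => //; rewrite divr_gt0.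
have yK : `|y| <= `|x| + 1.
  have -> : y = x - (x - y) by ring.
  by apply: le_trans (ler_normB _ _) _; lra.
apply: le_lt_trans (signed_power_lipschitz p2 _ yK) _; first by lra.
apply: (@le_lt_trans _ _ (L * `|x - y|)).
  by apply: ler_wpM2r => //; rewrite /L lerDl.
by rewrite mulrC -ltr_pdivlMr.
Unshelve. all: by end_near. Qed.

End PowerNonlinearity.

Lemma is_derive_comp_eq (R : realType) (f g : R -> R) (x a b c : R) :
  is_derive (g x) 1 f a -> is_derive x 1 g b -> c = a * b ->
  is_derive x 1 (fun r => f (g r)) c.
Proof.
move=> fa gb ->.
by have := @is_derive1_comp R f g x a b fa gb.
Qed.

Section EulerLagrange.
Context (R : realType) (al : R) (al3 : 3 < al).
Implicit Types (f g u w phi : R -> R) (r x y e : R).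

Local Notation mu := (@lebesgue_measure R).
Local Notation pos := (`]0, +oo[ : set R).
Local Notation p := (crit_exp al).

Lemma crit_exp_gt2 : 2 < p.
Proof. by rewrite crit_expE// ltrDl divr_gt0//; move: al3; lra. Qed.

Definition mass u : R := \int[mu]_(r in pos) (`|u r| `^ p * r `^ al).

Definition energy f g : R :=
  \int[mu]_(r in pos) (Delta al f r * Delta al g r * r `^ al).

Lemma measurable_Delta u : AC1loc u -> measurable_fun pos (Delta al u).
Proof.
move=> uac; apply: measurable_funD; first exact: (AC1loc_measurable uac (leqnn 2)).
apply: measurable_funM; last exact: (AC1loc_measurable uac (leqnSn 1)).
apply: pos_continuous_measurable => r r0.
apply: cvgM; first exact: cvg_cst.
by apply: cvgV; [rewrite gt_eqF|exact: cvg_id].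
Qed.

Lemma Delta_sqr_integrable u : X22 al u ->
  mu.-integrable pos (EFin \o (fun r => Delta al u r ^+ 2 * r `^ al)).
Proof.
move=> Xu; have [uac _] := Xu.
have i1 := X22_integrable Xu (leqnSn 1).
have i2 := X22_integrable Xu (leqnn 2).
rewrite (_ : al - 2 * (2 - 2%:R) = al) in i2; last by ring.
rewrite (_ : al - 2 * (2 - 1%:R) = al - 2) in i1; last by ring.
have := integrable_linear 2 (2 * al ^+ 2) i2 i1.
apply: integrable_dominated.
  apply: measurable_funM; last exact: powR_measurable.
  by apply: measurable_funX; exact: measurable_Delta.
move=> r r0; rewrite ger0_norm; last by rewrite mulr_ge0 ?sqr_ge0 ?powR_ge0.
have -> : r `^ (al - 2) = r `^ al / r ^+ 2.
  by rewrite powRBp// -powR_mulrn// ltW.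
rewrite /Delta -[derive1n 1 u]/(derive1 u).
move: (derive1n 2 u r) (derive1 u r) (powR_gt0 al r0) => a b.
move: (r `^ al) => W W0.
rewrite [leRHS](_ : _ = (2 * a ^+ 2 + 2 * (al / r * b) ^+ 2) * W); last first.
  by field; rewrite gt_eqF.
apply: ler_wpM2r; first exact: ltW.
by move: (al / r * b) => z; have := sqr_ge0 (a - z); nra.
Qed.

Lemma Delta_mul_integrable u w : X22 al u -> X22 al w ->
  mu.-integrable pos (EFin \o (fun r => Delta al u r * Delta al w r * r `^ al)).
Proof.
move=> Xu Xw; have [uac _] := Xu; have [wac _] := Xw.
have := integrable_linear 1 1 (Delta_sqr_integrable Xu) (Delta_sqr_integrable Xw).
apply: integrable_dominated.
  apply: measurable_funM; last exact: powR_measurable.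
  by apply: measurable_funM; exact: measurable_Delta.
move=> r r0; rewrite normrM (ger0_norm (powR_ge0 _ _)) !mul1r -mulrDl.
apply: ler_wpM2r; first exact: powR_ge0.
move: (Delta al u r) (Delta al w r) => a b.
have := sqr_ge0 (a - b); have := sqr_ge0 (a + b) => h1 h2.
by rewrite ler_norml; apply/andP; split; nra.
Qed.

Lemma energy_self u : energy u u = \int[mu]_(r in pos) (Delta al u r ^+ 2 * r `^ al).
Proof. by apply: eq_Rintegral => r _; rewrite expr2. Qed.

Lemma energy_ge0 u : 0 <= energy u u.
Proof.
rewrite energy_self; apply: Rintegral_ge0 => r _.
by rewrite mulr_ge0 ?sqr_ge0 ?powR_ge0.
Qed.

Lemma Rint_linear f g (a b : R) :
  mu.-integrable pos (EFin \o f) -> mu.-integrable pos (EFin \o g) ->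
  \int[mu]_(r in pos) (a * f r + b * g r) =
  a * \int[mu]_(r in pos) f r + b * \int[mu]_(r in pos) g r.
Proof.
move=> fi gi.
have Z k h : mu.-integrable pos (EFin \o h) ->
    mu.-integrable pos (EFin \o (fun r => k * h r)).
  move=> hi; have := integrable_linear k 0 hi hi.
  by under [X in EFin \o X]eq_fun do rewrite mul0r addr0.
rewrite RintegralD; [|exact: measurable_pos|exact: Z|exact: Z].
by rewrite !RintegralZl//; exact: measurable_pos.
Qed.

Lemma energy_addZ u phi e : X22 al u -> X22 al phi ->
  energy (fun r => u r + e * phi r) (fun r => u r + e * phi r) =
  energy u u + 2 * e * energy u phi + e ^+ 2 * energy phi phi.
Proof.
move=> Xu Xp; have [uac _] := Xu; have [pac _] := Xp.
have upac := AC1loc_addZ e uac pac.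
have iuu := Delta_mul_integrable Xu Xu; have iup := Delta_mul_integrable Xu Xp.
have ipp := Delta_mul_integrable Xp Xp.
have i1 := integrable_linear 1 (2 * e) iuu iup.
have i2 := integrable_linear 1 (e ^+ 2) i1 ipp.
transitivity (\int[mu]_(r in pos) (1 * (1 * (Delta al u r * Delta al u r * r `^ al)
   + 2 * e * (Delta al u r * Delta al phi r * r `^ al))
   + e ^+ 2 * (Delta al phi r * Delta al phi r * r `^ al))).
  apply: Rint_ae.
  - apply: measurable_funM; last exact: powR_measurable.
    by apply: measurable_funM; exact: measurable_Delta.
  - by apply/measurable_EFinP; case/integrableP : i2.
  have h2 := derive1n2_addZ_ae e uac pac.
  apply: (ae_imp _ h2) => r E r0; have {}E := E r0.
  have [du _] := uac; have [dp _] := pac.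
  have E1 := derive1_addZ e (du r r0) (dp r r0).
  rewrite /Delta E E1.
  move: (derive1n 2 u r) (derive1n 2 phi r) (derive1 u r) (derive1 phi r) (r `^ al).
  by move=> a b c d W; ring.
by rewrite !Rint_linear// !mul1r.
Qed.

Lemma mass_integrable u : X22 al u ->
  mu.-integrable pos (EFin \o (fun r => `|u r| `^ p * r `^ al)).
Proof. exact: X22_crit_integrable. Qed.

Lemma mass_ge0 u : 0 <= mass u.
Proof. by apply: Rintegral_ge0 => r _; rewrite mulr_ge0 ?powR_ge0. Qed.

Lemma mass_gt0 u : X22 al u -> (exists2 r, 0 < r & u r != 0) -> 0 < mass u.
Proof.
move=> Xu [r0 r00 ur0]; have [uac _] := Xu.
apply: (Rint_pos_gt0 (mass_integrable Xu) r00).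
- by move=> r _; rewrite mulr_ge0 ?powR_ge0.
- by rewrite mulr_gt0 ?powR_gt0 ?normr_gt0.
- apply: cvgM; last exact: powR_continuous.
  have nu : 0 < `|u r0| by rewrite normr_gt0.
  have cn : {for r0, continuous (fun r => `|u r|)}.
    by apply: cvg_norm; exact: AC1loc_continuous.
  exact: (continuous_comp cn (powR_continuous nu)).
Qed.

Lemma quotientE u : admissible al u ->
  quotient al u = (energy u u / mass u `^ (2 / p))%:E.
Proof.
move=> [[Xu _] une0]; have m0 := mass_gt0 Xu une0.
have p2 := crit_exp_gt2.
rewrite /quotient !wLnorm_fin; last 2 first.
- exact: mass_integrable.
- under [X in EFin \o X]eq_fun do rewrite sqr_powR_norm.
  exact: Delta_sqr_integrable.
have -> : \int[mu]_(r in pos) (`|Delta al u r| `^ 2 * r `^ al) = energy u u.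
  by rewrite energy_self; apply: eq_Rintegral => r _; rewrite sqr_powR_norm.
rewrite -/(mass u); move: (energy u u) (energy_ge0 u) (mass u) m0 => E E0 T T0.
rewrite -!EFin_expe -!powR_mulrn ?powR_ge0// -!powRrM.
rewrite mulVf// powRr1// mulrC.
by rewrite inver gt_eqF ?powR_gt0// -EFinM [_^-1 * _]mulrC.
Qed.

Section Minimizer.
Variables (u : R -> R) (umin : minimizer al u).

Let S := energy u u / mass u `^ (2 / p).

Lemma minimizer_X22 : X22 al u. Proof. by case: umin => [[[]]]. Qed.

Lemma minimizer_mass_gt0 : 0 < mass u.
Proof. by case: umin => [[[Xu _] h] _]; exact: mass_gt0. Qed.

Lemma S2E : S2 al = S%:E.
Proof. by case: umin => au <-; exact: quotientE. Qed.

Lemma S_ge0 : 0 <= S.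
Proof. by rewrite /S divr_ge0 ?energy_ge0 ?powR_ge0. Qed.

Lemma sobolev_ineq w : D22 al w -> S * mass w `^ (2 / p) <= energy w w.
Proof.
move=> Dw; have p2 := crit_exp_gt2; have [Xw _] := Dw.
have [wne|w0] := pselect (exists2 r : R, 0 < r & w r != 0).
  have m0 := mass_gt0 Xw wne.
  have aw : admissible al w by split.
  have : (S2 al <= quotient al w)%E by apply: ereal_inf_lbound; exists w.
  rewrite S2E (quotientE aw) lee_fin.
  by rewrite ler_pdivlMr// powR_gt0.
have -> : mass w = 0.
  rewrite /mass (_ : \int[mu]_(r in pos) _ = \int[mu]_(r in pos) 0).
    by rewrite Rintegral_cst ?mul0r//; exact: measurable_pos.
  apply: eq_Rintegral => r; rewrite inE => /[!in_posE] r0.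
  have -> : w r = 0 by apply: contra_notP w0 => /eqP wr; exists r.
  by rewrite normr0 powR0 ?mul0r// gt_eqF//; lra.
rewrite powR0 ?mulr0 ?energy_ge0//.
by rewrite gt_eqF// divr_gt0//; lra.
Qed.

(** The derivative of [S * T `^ (2 / p)] in the direction [phi] is [2 * multiplier]
    times the integral of [|u|^(p - 2) u phi], where [T] is the mass of [u]. *)
Definition multiplier : R := S * mass u `^ (2 / p - 1).

Lemma multiplier_ge0 : 0 <= multiplier.
Proof. by rewrite mulr_ge0 ?S_ge0 ?powR_ge0. Qed.

Lemma young_integrable phi : X22 al phi ->
  mu.-integrable pos (EFin \o (fun r => signed_power p (u r) * phi r * r `^ al)).
Proof.
move=> Xp; have Xu := minimizer_X22; have [uac _] := Xu; have [pac _] := Xp.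
have := integrable_linear 1 1 (mass_integrable Xu) (mass_integrable Xp).
apply: integrable_dominated.
  apply: measurable_funM; last exact: powR_measurable.
  apply: measurable_funM; last exact: (AC1loc_measurable pac (leq0n 2)).
  apply: pos_continuous_measurable => r r0.
  apply: continuous_comp; first exact: AC1loc_continuous.
  exact: (signed_power_continuous crit_exp_gt2).
move=> r r0; rewrite normrM (ger0_norm (powR_ge0 _ _)) !mul1r -mulrDl.
apply: ler_wpM2r; first exact: powR_ge0.
by apply: signed_power_young; exact: crit_exp_gt2.
Qed.

(** By convexity the mass of [u + e phi] is at least [T + p e J], so that
    [energy (u + e phi) - S * (T + p e J) `^ (2 / p)] is nonnegative for small [e] and
    vanishes at [e = 0]; its derivative there is zero. *)
Theorem euler_lagrange phi : D22_pre al phi -> X22 al phi ->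
  energy u phi =
  multiplier * \int[mu]_(r in pos) (signed_power p (u r) * phi r * r `^ al).
Proof.
move=> Dp Xp; have Xu := minimizer_X22; have T0 := minimizer_mass_gt0.
have Du : D22 al u by case: umin => [[]].
have p2 := crit_exp_gt2.
have p0 : 0 < p by lra.
set T := mass u in T0; set B := energy u phi; set C := energy phi phi.
set J := \int[mu]_(r in pos) _.
have massJ e : T + p * e * J <= mass (fun r => u r + e * phi r).
  have iJ := young_integrable Xp; have iT := mass_integrable Xu.
  have iU := mass_integrable (X22_addZ e Xu Xp).
  have iL := integrable_linear 1 (p * e) iT iJ.
  have E := Rint_linear 1 (p * e) iT iJ.
  rewrite mul1r -/J -/(mass u) -/T in E; rewrite -E /mass.
  apply: (le_Rint_set (@measurable_pos R) iL iU) => r _.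
  rewrite mul1r mulrA -mulrDl; apply: ler_wpM2r; first exact: powR_ge0.
  have := convex_power (u r) (e * phi r) (ltac:(lra) : 1 <= p).
  by rewrite (_ : p * e * _ = p * (signed_power p (u r) * (e * phi r))) //; ring.
have key e : 0 <= T + p * e * J ->
    S * (T + p * e * J) `^ (2 / p) <= energy u u + 2 * e * B + e ^+ 2 * C.
  move=> h0; rewrite -energy_addZ//.
  apply: (le_trans _ (sobolev_ineq (D22_addZ e Du Dp Xp))).
  apply: ler_wpM2l; first exact: S_ge0.
  apply: ge0_ler_powR; last exact: massJ.
  - by apply: divr_ge0; lra.
  - by rewrite nnegrE.
  - by rewrite nnegrE mass_ge0.
(* For [|e| < d] the affine bound stays positive, and its power differentiable. *)
pose d := T / (p * (`|J| + 1)).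
have J1 : 0 < `|J| + 1 by have := normr_ge0 J; lra.
have d0 : 0 < d by rewrite divr_gt0// mulr_gt0//; lra.
have near0 e : - d < e < d -> 0 < T + p * e * J.
  move=> /andP[h1 h2]; have : `|e| < d by rewrite ltr_norml h1.
  rewrite /d ltr_pdivlMr; last by rewrite mulr_gt0//; lra.
  move=> h; have : `|p * e * J| <= `|e| * (p * (`|J| + 1)).
    rewrite (normrM (p * e)) (normrM p) (gtr0_norm p0).
    rewrite [leRHS](_ : _ = p * `|e| * (`|J| + 1)); last by ring.
    by apply: ler_wpM2l; [rewrite mulr_ge0//; lra|lra].
  by rewrite ler_norml => /andP[h3 _]; lra.
pose G e := (energy u u + 2 * B * e + C * e ^+ 2) - S * (T + p * J * e) `^ (2 / p).
have dG e : - d < e < d -> is_derive e 1 G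
    (2 * B + C * (2 * e) - S * (2 / p * (T + p * e * J) `^ (2 / p - 1) * (p * J))).
  move=> ed; have pos0 := near0 e ed.
  have dlin (a b : R) : is_derive e 1 (fun z => a + b * z) b.
    apply: (is_deriveD_eq (is_derive_cst a e 1) (is_deriveZ_eq (is_derive_id e 1) erefl)).
    by rewrite add0r mulr1.
  apply: is_deriveB_eq erefl.
    apply: (is_deriveD_eq (dlin _ _) (is_deriveZ_eq (is_derive_sqr e) erefl)).
    by [].
  apply: is_deriveZ_eq erefl.
  have eqe : T + p * e * J = T + p * J * e by ring.
  rewrite eqe in pos0 *.
  exact: (@is_derive_comp_eq _ (@powR R ^~ (2 / p)) (fun z => T + p * J * z) _ _ _ _
    (is_derive_powR (2 / p) pos0) (dlin T (p * J)) erefl).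
have dG0 : is_derive (0 : R) 1 G 0.
  apply: (@derive1_at_min _ G (- d) d).
  - lra.
  - by move=> t; rewrite in_itv/= => /dG[].
  - by rewrite in_itv/=; lra.
  - move=> t; rewrite in_itv/= => td; rewrite /G !mulr0 expr0n /= mulr0 !addr0.
    have -> : S * T `^ (2 / p) = energy u u.
      by rewrite /S divfK// gt_eqF// powR_gt0.
    rewrite subrr subr_ge0 (_ : T + p * J * t = T + p * t * J); last by ring.
    apply: le_trans (key _ (ltW (near0 t td))) _.
    by rewrite le_eqVlt; apply/orP; left; apply/eqP; ring.
have E1 : 2 * B + C * (2 * 0) -
    S * (2 / p * (T + p * 0 * J) `^ (2 / p - 1) * (p * J)) = 0.
  have d00 : - d < 0 < d by lra.
  have [_ <-] := dG 0 d00; by case: dG0.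
rewrite !mulr0 mul0r !addr0 in E1.
rewrite /multiplier -/T.
have : S * (2 / p * T `^ (2 / p - 1) * (p * J)) = 2 * (S * T `^ (2 / p - 1) * J).
  by field; lra.
by move=> E2; lra.
Qed.

End Minimizer.
End EulerLagrange.

(** * From the weak equation to the radial system *)

Section Primitive.
Context (R : realType).
Implicit Types (f g k F u : R -> R) (r x y c : R).

Local Notation mu := (@lebesgue_measure R).
Local Notation pos := (`]0, +oo[ : set R).

Lemma oc0_pos y : (`]0, y] : set R) `<=` pos.
Proof. by move=> z /=; rewrite !in_itv/= andbT => /andP[]. Qed.

Lemma pos_integrable_oc k y : mu.-integrable pos (EFin \o k) ->
  mu.-integrable `]0, y] (EFin \o k).
Proof.
move=> ik; apply: (integrable_sub _ (@measurable_pos R) (@oc0_pos y) ik).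
exact: measurable_itv.
Qed.

Lemma bounded_integrable_oc k c y : 0 < y -> measurable_fun pos k ->
  (forall r, 0 < r -> r <= y -> `|k r| <= c) ->
  mu.-integrable `]0, y] (EFin \o k).
Proof.
move=> y0 mk kc.
have ic : mu.-integrable `]0, y] (EFin \o (fun r => c * r `^ 0)).
  have -> : EFin \o (fun r => c * r `^ 0) = (fun r => c%:E * (EFin \o (@powR R ^~ 0%R)) r)%E.
    by apply/funext => r /=; rewrite EFinM.
  apply: integrableZl; first exact: measurable_itv.
  by apply: integrable_powR0 => //; lra.
have mo : measurable (`]0, y] : set R) by exact: measurable_itv.
apply: (le_integrable _ _ _ ic); first exact: mo.
  by apply/measurable_EFinP; exact: (measurable_funS (@measurable_pos R) (@oc0_pos y) mk).
move=> r /=; rewrite in_itv/= => /andP[r0 ry]; rewrite lee_fin powRr0 mulr1.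
exact: le_trans (kc r r0 ry) (ler_norm _).
Qed.

Definition primitive0 k y : R := \int[mu]_(r in `]0, y]) k r.

Lemma primitive0_bound k c y : 0 < y -> mu.-integrable `]0, y] (EFin \o k) ->
  (forall r, 0 < r -> r <= y -> `|k r| <= c) -> `|primitive0 k y| <= c * y.
Proof.
move=> y0 ik kc.
have ic : mu.-integrable `]0, y] (EFin \o (fun=> c)).
  by apply: (@bounded_integrable_oc _ `|c|) => // r _ _.
have mo : measurable (`]0, y] : set R) by exact: measurable_itv.
have := @norm_Rint_le R `]0, y] k (fun=> c) mo ik ic _; rewrite /primitive0.
rewrite Rintegral_cst// [X in fine X]lebesgue_measure_itv /= lte_fin y0 /= subr0.
by apply => r /=; rewrite in_itv/= => /andP[]; exact: kc.
Qed.

Lemma primitive0_derive k y : 0 < y ->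
  (forall z, 0 < z -> mu.-integrable `]0, z] (EFin \o k)) ->
  {for y, continuous k} -> is_derive y 1 (primitive0 k) (k y).
Proof.
move=> y0 ik ck.
have y1 : y < y + 1 by rewrite ltrDl.
have b0 : (BRight 0 < BRight y)%O by rewrite bnd_simp.
have [d e] := continuous_FTC1 y1 (ik (y + 1) ltac:(lra)) b0 ck.
by apply: DeriveDef; [exact: d|rewrite -derive1E; exact: e].
Qed.

Lemma segment_bounded f a b : 0 < a -> a <= b ->
  (forall r, 0 < r -> {for r, continuous f}) ->
  exists2 K, 0 < K & forall r, a <= r <= b -> `|f r| <= K.
Proof.
move=> a0 ab cf; have cn r : 0 < r -> {for r, continuous (fun z => `|f z|)}.
  by move=> r0; apply: cvg_norm; exact: cf.
have [c _ Hc] := EVT_max ab (pos_within_continuous a0 cn).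
exists (`|f c| + 1); first by have := normr_ge0 (f c); lra.
by move=> r rab; have := Hc r; rewrite in_itv/= => /(_ rab); lra.
Qed.

Lemma C1_abs_continuous F f a b : 0 < a -> a <= b ->
  (forall r, 0 < r -> is_derive r 1 F (f r)) ->
  (forall r, 0 < r -> {for r, continuous f}) -> abs_continuous a b F.
Proof.
move=> a0 ab dF cf; have [K K0 fK] := segment_bounded a0 ab cf.
apply: (@lipschitz_abs_continuous _ _ _ _ K) => x y ax xy yb.
have x0 : 0 < x by exact: lt_le_trans ax.
rewrite (pos_FTC2 x0 xy dF cf).
have mxy : measurable (`[x, y] : set R) by exact: measurable_itv.
have icst : mu.-integrable `[x, y] (EFin \o (fun=> K)).
  by apply: pos_continuous_integrable => // r _; exact: cvg_cst.
have iF : mu.-integrable `[x, y] (EFin \o f) by exact: pos_continuous_integrable.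
have H := norm_Rint_le mxy iF icst.
apply: (le_trans (H _)).
  by move=> r /=; rewrite in_itv/= => /andP[xr ry]; apply: fK; apply/andP; split; lra.
rewrite Rintegral_cst// [X in fine X]lebesgue_measure_itv /= lte_fin.
by move: xy; rewrite le_eqVlt => /orP[/eqP ->|xy]; rewrite ?ltxx ?xy /= ?subrr ?mulr0.
Qed.

(** If the flux tended to [c > 0], then [v'] would exceed [c / 2 * r^-2] near the
    origin, as [al > 2], and [v] would be unbounded. *)
Lemma flux_le0 (al K c : R) (v m : R -> R) : 2 < al ->
  (forall r, 0 < r -> is_derive r 1 v (r `^ (- al) * m r)) ->
  (forall r, 0 < r -> `|v r| <= K) -> m r @[r --> 0^'+] --> c -> c <= 0.
Proof.
move=> al2 dv vK mc; rewrite leNgt; apply/negP => c0.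
have c20 : 0 < c / 2 by lra.
move/cvgrPdist_lt : mc => /(_ _ c20) [d /= d0 Hd].
pose e := Num.min (d / 2) 1.
have e0 : 0 < e by rewrite lt_min; apply/andP; split; lra.
have ed : e < d by rewrite /e gt_min; apply/orP; left; lra.
have e1 : e <= 1 by rewrite /e ge_min lexx orbT.
have mE r : 0 < r -> r <= e -> c / 2 <= m r.
  move=> r0 re; have : `|c - m r| < c / 2.
    by apply: Hd => //=; rewrite sub0r normrN gtr0_norm//; exact: le_lt_trans ed.
  by rewrite ltr_norml => /andP[_]; lra.
pose F r := v r + c / 2 * r `^ (-1).
have dF r : 0 < r -> is_derive r 1 F (r `^ (- al) * m r + c / 2 * (- 1 * r `^ (- 1 - 1))).
  move=> r0; apply: (is_deriveD_eq (dv r r0) _ erefl).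
  exact: (is_deriveZ_eq (is_derive_powR (-1) r0) erefl).
have mono x : 0 < x -> x <= e -> F x <= F e.
  move=> x0 xe; apply: (pos_monotone x0 xe dF) => r /andP[xr re].
  have r0 : 0 < r by exact: lt_trans xr.
  have h1 : r `^ (-1 - 1) <= r `^ (- al).
    by apply: ger_powR; [rewrite r0 /=; lra|lra].
  have h2 := mE r r0 (ltW re).
  have h3 := powR_ge0 r (-1 - 1); have h4 := powR_ge0 r (- al).
  have h5 : c / 2 * r `^ (- 1 - 1) <= m r * r `^ (- al).
    by apply: ler_pM => //; lra.
  by lra.
pose x := Num.min e (c / 2 / (2 * K + c / 2 * e `^ (-1) + 1)).
have K0 : 0 <= K by apply: le_trans (vK e e0).
have B0 : 0 < 2 * K + c / 2 * e `^ (-1) + 1.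
  by have := mulr_ge0 (ltW c20) (powR_ge0 e (-1)); lra.
have x0 : 0 < x by rewrite lt_min e0 divr_gt0.
have xe : x <= e by rewrite /x ge_min lexx.
have := mono x x0 xe; rewrite /F.
have xB : x <= c / 2 / (2 * K + c / 2 * e `^ (-1) + 1) by rewrite /x ge_min lexx orbT.
have : 2 * K + c / 2 * e `^ (-1) + 1 <= c / 2 * x `^ (-1).
  by rewrite [x `^ (-1)]powR_inv1 ?(ltW x0)// ler_pdivlMr// mulrC -ler_pdivlMr.
have := vK x x0; have := vK e e0; rewrite !ler_norml => /andP[? ?] /andP[? ?].
lra.
Qed.

Lemma flux_eq0 (al K c : R) (v m : R -> R) : 2 < al ->
  (forall r, 0 < r -> is_derive r 1 v (r `^ (- al) * m r)) ->
  (forall r, 0 < r -> `|v r| <= K) -> m r @[r --> 0^'+] --> c -> c = 0.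
Proof.
move=> al2 dv vK mc; apply/eqP; rewrite eq_le (flux_le0 al2 dv vK mc) /=.
rewrite -oppr_le0; apply: (@flux_le0 al K _ (fun r => - 1 * v r) (fun r => - m r)) => //.
- move=> r r0; apply: (is_deriveZ_eq (dv r r0)); by rewrite mulN1r mulrN.
- by move=> r r0; rewrite mulN1r normrN; exact: vK.
- exact: cvgN.
Qed.

End Primitive.

(** The radial equation [Delta_al (Delta_al u) = f u] as a first-order system:
    [M] is the flux of [u], [D] is [Delta_al u] and [N] is the flux of [D].  The
    limits at [0] are those of a solution that is regular at the origin. *)
Definition radial_solution (R : realType) (al : R) (f u M D N : R -> R)
    (l d : R) : Prop :=
  [/\ forall r : R, 0 < r -> is_derive r 1 u (r `^ (- al) * M r),
      forall r : R, 0 < r -> is_derive r 1 M (r `^ al * D r),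
      forall r : R, 0 < r -> is_derive r 1 D (r `^ (- al) * N r) &
      forall r : R, 0 < r -> is_derive r 1 N (r `^ al * f (u r))] /\
  [/\ u r @[r --> 0^'+] --> l, M r @[r --> 0^'+] --> (0 : R),
      D r @[r --> 0^'+] --> d & N r @[r --> 0^'+] --> (0 : R)].

(** * The radial system of a minimizer *)

Section MinimizerSystem.
Context (R : realType) (al : R) (al3 : 3 < al) (u : R -> R).
Context (umin : minimizer al u) (l : R) (ul : u r @[r --> 0^'+] --> l).
Implicit Types (f g k : R -> R) (r x y c : R).

Local Notation mu := (@lebesgue_measure R).
Local Notation pos := (`]0, +oo[ : set R).
Local Notation p := (crit_exp al).
Let alp1 : al + 1 != 0. Proof. by rewrite gt_eqF//; move: al3; lra. Qed.
Let alm1 : al - 1 != 0. Proof. by rewrite gt_eqF//; move: al3; lra. Qed.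
Let alm3 : al - 3 != 0. Proof. by rewrite gt_eqF//; move: al3; lra. Qed.
Local Ltac side_lra := repeat (apply/andP; split); rewrite ?alp1 ?alm1 ?alm3 ?gt_eqF //.

Let Xu : X22 al u := minimizer_X22 umin.
Let uac : AC1loc u := proj1 Xu.
Let lam := multiplier al u.

Lemma minimizer_decay : exists2 C, 0 <= C &
  forall r, 0 < r -> `|u r| <= C * r `^ ((3 - al) / 2).
Proof.
have [C HC] := radial_bound al3 Xu.
have C0 : 0 <= C.
  by have := HC 1 ltr01; rewrite powR1 mulr1; apply: le_trans; exact: sqr_ge0.
exists (C `^ 2^-1); first exact: powR_ge0.
move=> r r0; have -> : `|u r| = (u r ^+ 2) `^ 2^-1.
  rewrite -sqr_powR_norm -powRrM mulfV// powRr1//.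
rewrite (powRrM r) -powRM ?powR_ge0//.
apply: ge0_ler_powR; rewrite ?nnegrE ?sqr_ge0 ?invr_ge0//.
  by rewrite mulr_ge0 ?powR_ge0.
exact: HC.
Qed.

Lemma minimizer_bounded : exists2 K, 0 <= K & forall r, 0 < r -> `|u r| <= K.
Proof.
have [C C0 HC] := minimizer_decay.
have /cvgrPdist_lt /(_ _ ltr01)[d /= d0 Hd] := ul.
exists (`|l| + 1 + C * d `^ ((3 - al) / 2)).
  by rewrite !addr_ge0 ?mulr_ge0 ?powR_ge0.
move=> r r0; have [rd|dr] := ltP r d.
  have h : `|l - u r| < 1 by apply: Hd => //=; rewrite sub0r normrN gtr0_norm.
  have -> : u r = l - (l - u r) by ring.
  apply: le_trans (ler_normB _ _) _; have := powR_ge0 d ((3 - al) / 2).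
  by move=> /(mulr_ge0 C0); lra.
apply: le_trans (HC r r0) _.
suff : C * r `^ ((3 - al) / 2) <= C * d `^ ((3 - al) / 2).
  by have := normr_ge0 l; lra.
apply: ler_wpM2l => //.
have -> : (3 - al) / 2 = - ((al - 3) / 2) by field.
rewrite !powRN lef_pV2 ?posrE ?powR_gt0//.
by apply: ge0_ler_powR; rewrite ?nnegrE ?(ltW r0) ?(ltW d0)//; move: al3; lra.
Qed.

Let h r := signed_power p (u r).

Lemma source_continuous r : 0 < r -> {for r, continuous h}.
Proof.
move=> r0; apply: continuous_comp; first exact: AC1loc_continuous.
exact: (signed_power_continuous (crit_exp_gt2 al3)).
Qed.

Lemma signed_power_norm x : `|signed_power p x| = `|x| `^ (p - 1).
Proof.
have p2 := crit_exp_gt2 al3.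
rewrite /signed_power normrM (ger0_norm (powR_ge0 _ _)).
have [->|x0] := eqVneq x 0; first by rewrite normr0 mul0r powR0// gt_eqF//; lra.
by rewrite -{1}[`|x|]powRr1// -powRDp ?normr_gt0//; congr (_ `^ _); ring.
Qed.

Lemma source_bounded : exists2 K, 0 <= K & forall r, 0 < r -> `|h r| <= K.
Proof.
have [K K0 HK] := minimizer_bounded; have p2 := crit_exp_gt2 al3.
exists (K `^ (p - 1)) => [|r r0]; first exact: powR_ge0.
rewrite signed_power_norm; apply: ge0_ler_powR; rewrite ?nnegrE ?HK//; lra.
Qed.

Lemma source_decay : exists2 C, 0 <= C &
  forall r, 0 < r -> `|h r| <= C * r `^ (- ((al + 5) / 2)).
Proof.
have [C C0 HC] := minimizer_decay; have p2 := crit_exp_gt2 al3.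
exists (C `^ (p - 1)) => [|r r0]; first exact: powR_ge0.
rewrite signed_power_norm.
have -> : - ((al + 5) / 2) = (3 - al) / 2 * (p - 1).
  by rewrite crit_expE//; field; side_lra.
rewrite powRrM -powRM ?powR_ge0//.
apply: ge0_ler_powR; rewrite ?nnegrE ?mulr_ge0 ?powR_ge0 ?HC//; lra.
Qed.

Let k1 r := h r * r `^ al.
Let k2 r := h r * r `^ 1.
Let k3 r := h r * r `^ (al + 2).

Lemma weighted_source_continuous (s r : R) : 0 < r ->
  {for r, continuous (fun z => h z * z `^ s)}.
Proof.
by move=> r0; apply: cvgM; [exact: source_continuous|exact: powR_continuous].
Qed.

Lemma weighted_source_bound : exists2 K, 0 <= K & forall (s : R) y r, 0 <= s ->
  0 < r -> r <= y -> `|h r * r `^ s| <= K * y `^ s.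
Proof.
have [K K0 HK] := source_bounded; exists K => // s y r s0 r0 ry.
rewrite normrM (ger0_norm (powR_ge0 _ _)); apply: ler_pM => //; rewrite ?powR_ge0//.
  exact: HK.
by apply: ge0_ler_powR; rewrite ?nnegrE ?(ltW r0)// ltW// (lt_le_trans r0).
Qed.

Lemma weighted_source_integrable (s y : R) : 0 <= s -> 0 < y ->
  mu.-integrable `]0, y] (EFin \o (fun z => h z * z `^ s)).
Proof.
move=> s0 y0; have [K K0 HK] := weighted_source_bound.
apply: (@bounded_integrable_oc _ _ (K * y `^ s)) => //.
  by apply: pos_continuous_measurable => r; exact: weighted_source_continuous.
by move=> r r0 ry; exact: HK.
Qed.

Lemma primitive0_source_derive (s y : R) : 0 <= s -> 0 < y ->
  is_derive y 1 (primitive0 (fun z => h z * z `^ s)) (h y * y `^ s).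
Proof.
move=> s0 y0; apply: primitive0_derive => //; last exact: weighted_source_continuous.
by move=> z; exact: weighted_source_integrable.
Qed.

Lemma primitive0_source_bound : exists2 K, 0 <= K & forall (s y : R), 0 <= s ->
  0 < y -> `|primitive0 (fun z => h z * z `^ s) y| <= K * y `^ (s + 1).
Proof.
have [K K0 HK] := weighted_source_bound; exists K => // s y s0 y0.
rewrite powRDp// powRr1 ?(ltW y0)// mulrA; apply: primitive0_bound => //.
  exact: weighted_source_integrable.
by move=> r r0 ry; exact: HK.
Qed.

Lemma dominated_at0 g (K s : R) : 0 < s ->
  (forall y, 0 < y -> `|g y| <= K * y `^ s) -> g y @[y --> 0^'+] --> (0 : R).
Proof.
move=> s0 gK; apply/cvgrPdist_lt => e e0.
have : K * y `^ s @[y --> 0^'+] --> K * 0 by apply: cvgMr; exact: powR_cvg0.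
rewrite mulr0 => /cvgrPdist_lt /(_ _ e0) H; near=> y.
have y0 : 0 < y by near: y; exact: nbhs_right_gt.
have : `|0 - K * y `^ s| < e by near: y.
rewrite !sub0r !normrN; apply: le_lt_trans; apply: le_trans (gK y y0) (ler_norm _).
Unshelve. all: by end_near. Qed.

Lemma primitive0_source_at0 (s : R) : 0 <= s ->
  primitive0 (fun z => h z * z `^ s) y @[y --> 0^'+] --> (0 : R).
Proof.
move=> s0; have [K K0 HK] := primitive0_source_bound.
have s1 : 0 < s + 1 by lra.
by apply: (dominated_at0 s1) => y y0; exact: HK.
Qed.

Lemma source_integrable : mu.-integrable pos (EFin \o k2).
Proof.
have [K K0 HK] := source_bounded; have [C C0 HC] := source_decay.
have t1 : 1 - (al + 5) / 2 < -1 by move: al3; lra.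
have s1 : -1 < 1 :> R by lra.
apply: (@integrable_two_powers _ k2 1 _ 1 (K + C) s1 t1) => //.
- by apply: pos_continuous_measurable => r; exact: weighted_source_continuous.
- move=> r r0 _; rewrite normrM (ger0_norm (powR_ge0 _ _)).
  by apply: ler_wpM2r; [exact: powR_ge0|have := HK r r0; lra].
- move=> r r1; have r0 : 0 < r by lra.
  rewrite normrM (ger0_norm (powR_ge0 _ _)) [X in _ * r `^ X]addrC powRDp// mulrA.
  apply: ler_wpM2r; first exact: powR_ge0.
  apply: le_trans (HC r r0) _; apply: ler_wpM2r; [exact: powR_ge0|lra].
Qed.

Let H0 : R := \int[mu]_(r in pos) k2 r.

Lemma Rint_truncated g k y : 0 < y -> mu.-integrable pos (EFin \o g) ->
  mu.-integrable `]0, y] (EFin \o k) ->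
  (forall r, 0 < r -> r < y -> g r = k r) -> (forall r, y < r -> g r = 0) ->
  \int[mu]_(r in pos) g r = primitive0 k y.
Proof.
move=> y0 ig ik gk g0.
have E : pos = `]0, y[ `|` `[y, +oo[.
  apply/seteqP; split => [z /=|z [] /=]; rewrite !in_itv/= ?andbT.
  - by move=> z0; rewrite z0 /=; case: (ltP z y); [left|right].
  - by move=> /andP[].
  - exact: lt_le_trans.
have m1 : measurable (`]0, y[ : set R) by exact: measurable_itv.
have m2 : measurable (`[y, +oo[ : set R) by exact: measurable_itv.
have m3 : measurable (`]y, +oo[ : set R) by exact: measurable_itv.
have disj : [disjoint `]0, y[%classic & `[y, +oo[%classic]%classic.
  apply/disj_setPS => z [] /=; rewrite !in_itv/= andbT => /andP[_ h1'] h2'.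
  by have := lt_le_trans h1' h2'; rewrite ltxx.
have ig' := ig; rewrite E in ig' *.
rewrite Rintegral_setU// -Rintegral_itv_obnd_cbnd; last first.
  apply: (integrable_sub m3 (@measurable_pos R) _ ig).
  by move=> z /=; rewrite !in_itv/= !andbT; exact: lt_trans.
rewrite [X in _ + X](_ : _ = 0) ?addr0; last first.
  rewrite (_ : \int[mu]_(r in _) g r = \int[mu]_(r in `]y, +oo[) 0).
    by rewrite Rintegral_cst ?mul0r.
  by apply: eq_Rintegral => r; rewrite inE /= in_itv/= andbT; exact: g0.
rewrite /primitive0 -Rintegral_itv_bndo_bndc.
  by apply: eq_Rintegral => r; rewrite inE /= in_itv/= => /andP[]; exact: gk.
apply: (integrable_sub m1 _ _ ik); first exact: measurable_itv.
by move=> z /=; rewrite !in_itv/= => /andP[-> /ltW].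
Qed.

Let A1 := primitive0 k1.
Let A2 := primitive0 k2.
Let A3 := primitive0 k3.

Let al0 : 0 <= al. Proof. by move: al3; lra. Qed.
Let al2 : 0 <= al + 2. Proof. by move: al3; lra. Qed.

(** The integral of [h * ball_potential al y * r^al], expressed by primitives of [h].
    The global quantity [H0] is a constant and disappears by differentiation. *)
Let J y : R := (2 * (al + 1))^-1 * A3 y - (2 * (al - 1))^-1 * (y ^+ 2 * A1 y) +
  ((al + 1) * (al - 1))^-1 * (y `^ (al + 1) * (A2 y - H0)).

(** On [`]y, +oo[] the potential times [r^al] is a multiple of [r]: adding the same
    multiple of [h r] makes the integrand vanish there. *)
Lemma potential_pairing y : 0 < y ->
  \int[mu]_(r in pos) (h r * ball_potential al y r * r `^ al) = J y.
Proof.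
move=> y0; pose c := ((al + 1) * (al - 1))^-1 * y `^ (al + 1).
have iy := young_integrable al3 umin (ball_potential_X22 al3 y0).
have ig := integrable_linear 1 c iy source_integrable.
pose k r := 1 * ((2 * (al + 1))^-1 * k3 r + - ((2 * (al - 1))^-1 * y ^+ 2) * k1 r) + c * k2 r.
have i1 : mu.-integrable `]0, y] (EFin \o k1) by exact: weighted_source_integrable.
have i2 : mu.-integrable `]0, y] (EFin \o k2) by apply: weighted_source_integrable => //; lra.
have i3 : mu.-integrable `]0, y] (EFin \o k3) by exact: weighted_source_integrable.
have moc : measurable (`]0, y] : set R) by exact: measurable_itv.
have lin a b f g : mu.-integrable `]0, y] (EFin \o f) -> mu.-integrable `]0, y] (EFin \o g) ->
    mu.-integrable `]0, y] (EFin \o (fun r => a * f r + b * g r)) /\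
    primitive0 (fun r => a * f r + b * g r) y = a * primitive0 f y + b * primitive0 g y.
  move=> fi gi.
  have Z c' f' : mu.-integrable `]0, y] (EFin \o f') ->
      mu.-integrable `]0, y] (EFin \o (fun r => c' * f' r)).
    move=> f'i; have -> : EFin \o (fun r => c' * f' r) = (fun r => c'%:E * (EFin \o f') r)%E.
      by apply/funext => r /=; rewrite EFinM.
    by apply: integrableZl.
  split.
    have -> : EFin \o (fun r => a * f r + b * g r) =
        (fun r => (EFin \o (fun r => a * f r)%R) r + (EFin \o (fun r => b * g r)%R) r)%E.
      by apply/funext => r /=; rewrite EFinD.
    by apply: integrableD => //; exact: Z.
  rewrite /primitive0 RintegralD//; [|exact: Z|exact: Z].
  by rewrite !RintegralZl.
have [i31 E31] := lin (2 * (al + 1))^-1 (- ((2 * (al - 1))^-1 * y ^+ 2)) _ _ i3 i1.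
have [ik Ek] := lin 1 c _ _ i31 i2.
have T : \int[mu]_(r in pos) (1 * (h r * ball_potential al y r * r `^ al) + c * k2 r) =
    primitive0 k y.
  apply: Rint_truncated => //.
  - move=> r r0 ry; rewrite /ball_potential (ltW ry) /inner_potential /k /k1 /k2 /k3.
    rewrite powRDp// [r `^ 2]powR_mulrn ?(ltW r0)//.
    by move: (r `^ al) (h r) (_^-1) (_^-1) => W a b d; ring.
  - move=> r yr; have r0 : 0 < r by exact: lt_trans yr.
    rewrite /ball_potential [r <= y]leNgt yr /= /outer_potential /c /k2.
    have -> : r `^ (1 - al) = r `^ 1 / r `^ al by rewrite powRBp.
    have := powR_gt0 al r0; move: (r `^ al) (r `^ 1) (h r) (y `^ _) => W r1 a b W0.
    by rewrite /cst; field; side_lra.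
move: T; rewrite Rint_linear//; last exact: source_integrable.
rewrite [primitive0 k y]Ek E31 !mul1r -/H0 -/(A1 y) -/(A2 y) -/(A3 y) => T.
rewrite /J; move: T; rewrite /c => /(canRL (addrK _)) ->.
by ring.
Qed.

Let flux r : R := r `^ al * derive1 u r.
Let G y : R := (al - 1)^-1 * (A2 y - H0 - y `^ (1 - al) * A1 y).

Lemma J_derive y : 0 < y -> is_derive y 1 J (y `^ al * G y).
Proof.
move=> y0.
have d1 := primitive0_source_derive al0 y0; rewrite -/(k1 y) in d1.
have d2 := primitive0_source_derive ler01 y0; rewrite -/(k2 y) in d2.
have d3 := primitive0_source_derive al2 y0; rewrite -/(k3 y) in d3.
have d2' := is_deriveB_eq d2 (is_derive_cst H0 y 1) erefl.
have e1 := is_deriveM_eq (is_derive_sqr y) d1 erefl.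
have e2 := is_deriveM_eq (is_derive_powR (al + 1) y0) d2' erefl.
have e3 := is_deriveB_eq (is_deriveZ_eq (k := (2 * (al + 1))^-1) d3 erefl)
  (is_deriveZ_eq (k := (2 * (al - 1))^-1) e1 erefl) erefl.
apply: (is_deriveD_eq e3 (is_deriveZ_eq (k := ((al + 1) * (al - 1))^-1) e2 erefl)).
rewrite /G -/A1 -/A2 /k1 /k2 /k3.
have -> : al + 1 - 1 = al by ring.
have -> : y `^ (al + 1) = y `^ al * y by rewrite powRDp// powRr1// ltW.
have -> : y `^ (al + 2) = y `^ al * y ^+ 2.
  by rewrite powRDp// [y `^ 2]powR_mulrn// ltW.
have -> : y `^ (1 - al) = y / y `^ al by rewrite powRBp// powRr1// ltW.
rewrite powRr1 ?(ltW y0)//.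
have := powR_gt0 al y0; move: (y `^ al) (h y) (A1 y) (A2 y) => W a b c W0.
by rewrite /cst; field; side_lra.
Qed.

Lemma G_derive y : 0 < y -> is_derive y 1 G (y `^ (- al) * A1 y).
Proof.
move=> y0.
have d1 := primitive0_source_derive al0 y0; rewrite -/(k1 y) in d1.
have d2 := primitive0_source_derive ler01 y0; rewrite -/(k2 y) in d2.
have d2' := is_deriveB_eq d2 (is_derive_cst H0 y 1) erefl.
have e1 := is_deriveM_eq (is_derive_powR (1 - al) y0) d1 erefl.
apply: (is_deriveZ_eq (is_deriveB_eq d2' e1 erefl)).
rewrite -/A1 /k1 /k2.
have -> : 1 - al - 1 = - al by ring.
have -> : y `^ (1 - al) = y / y `^ al by rewrite powRBp// powRr1// ltW.
rewrite powRr1 ?(ltW y0)// powRN.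
have := powR_gt0 al y0; move: (y `^ al) (h y) (A1 y) => W a b W0.
by rewrite /cst; field; side_lra.
Qed.

(** The Laplacian of the potential is the indicator of [(0, y)], so the weak equation
    computes the integral of [Delta al u * r^al] over [(0, y)]; and this integrand is
    the derivative of [flux] wherever [u'] is differentiable. *)
Lemma flux_increment x y : 0 < x -> x <= y ->
  flux y - flux x = lam * J y - lam * J x.
Proof.
move=> x0 xy; have y0 : 0 < y by exact: lt_le_trans xy.
pose k r := Delta al u r * r `^ al.
have mk : measurable_fun pos k.
  by apply: measurable_funM; [exact: measurable_Delta|exact: powR_measurable].
have ik z : 0 < z -> mu.-integrable `]0, z] (EFin \o k).
  move=> z0.
  have moc : measurable (`]0, z] : set R) by exact: measurable_itv.
  have j1 := pos_integrable_oc z (Delta_sqr_integrable Xu).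
  have j2 := integrable_powR0 (ltac:(move: al3; lra) : -1 < al) z0.
  have j3 : mu.-integrable `]0, z] (EFin \o (fun r => Delta al u r ^+ 2 * r `^ al + r `^ al)).
    have -> : EFin \o (fun r => Delta al u r ^+ 2 * r `^ al + r `^ al) =
        (fun r => (EFin \o (fun r => Delta al u r ^+ 2 * r `^ al)%R) r + (EFin \o (@powR R ^~ al)) r)%E.
      by apply/funext => r /=; rewrite EFinD.
    by apply: integrableD.
  apply: (le_integrable _ _ _ j3); first exact: moc.
    by apply/measurable_EFinP; exact: (measurable_funS (@measurable_pos R) (@oc0_pos R z) mk).
  move=> r _ /=; rewrite lee_fin; apply: le_trans (ler_norm _).
  rewrite /k normrM (ger0_norm (powR_ge0 _ _)) -[X in _ + X]mul1r -mulrDl.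
  apply: ler_wpM2r; first exact: powR_ge0.
  move: (Delta al u r) => a; have := sqr_ge0 (a - 1); have := sqr_ge0 (a + 1) => h1 h2.
  by rewrite ler_norml; apply/andP; split; nra.
have EL z : 0 < z -> primitive0 k z = lam * J z.
  move=> z0; rewrite -potential_pairing//.
  rewrite -(euler_lagrange al3 umin (ball_potential_D22_pre al3 z0) (ball_potential_X22 al3 z0)).
  rewrite /energy; symmetry; apply: Rint_truncated => //.
  - exact: (Delta_mul_integrable Xu (ball_potential_X22 al3 z0)).
  - exact: ik.
  - by move=> r r0 rz; rewrite Delta_ball_potential_in// mulr1.
  - by move=> r zr; rewrite Delta_ball_potential_out// mulr0 mul0r.
rewrite -!EL//.
have -> : primitive0 k y - primitive0 k x = \int[mu]_(r in `]x, y]) k r.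
  by apply: Rintegral_itvB; [exact: ik|rewrite bnd_simp ltW|rewrite bnd_simp].
have cu' r : 0 < r -> {for r, continuous (derive1 u)} by exact: AC1loc_derive1_continuous.
have cp r : 0 < r -> {for r, continuous (@powR R ^~ al)} by exact: powR_continuous.
have [K1 K10 HK1] := segment_bounded x0 xy cu'.
have [K2 K20 HK2] := segment_bounded x0 xy cp.
have acp : abs_continuous x y (@powR R ^~ al).
  apply: (@C1_abs_continuous _ _ (fun r => al * r `^ (al - 1))) => //.
  by move=> r r0; apply: cvgM; [exact: cvg_cst|exact: powR_continuous].
have acu' : abs_continuous x y (derive1 u).
  move: xy; rewrite le_eqVlt => /orP[/eqP <-|xy]; last by case: uac => _; exact.
  have := proj2 uac x (x + 1) x0 ltac:(lra) => H e e0.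
  have [d d0 Hd] := H e e0; exists d => // n a b h1 h2 h3; apply: Hd => // i iN.
  by have [? ? ?] := h1 i iN; split => //; lra.
have acM : abs_continuous x y flux.
  apply: (@abs_continuousM_bounded _ _ _ _ _ (K1 + K2)) => //; first lra.
    by move=> r /HK2; lra.
  by move=> r /HK1; lra.
have msub : measurable_fun `]x, y] k.
  apply: measurable_funS mk; first exact: measurable_pos.
  by move=> z /=; rewrite !in_itv/= andbT => /andP[h1 _]; exact: lt_trans h1.
have [] := abs_continuous_FTC xy acM msub => //.
move=> r /andP[xr _] dflux; have r0 : 0 < r by exact: lt_trans xr.
have du' : derivable (derive1 u) r 1.
  apply: (derivable_near (f := fun z => z `^ (- al) * flux z) r0).
    by move=> z z0; rewrite /flux powRN mulKf// gt_eqF// powR_gt0.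
  by have [] := is_deriveM_eq (is_derive_powR (- al) r0) (derivable_is_derive dflux) erefl.
have dM := is_deriveM_eq (is_derive_powR al r0) (derivable_is_derive du') erefl.
rewrite derive1E; have [_ ->] := dM.
rewrite /k /Delta -[derive1n 2 u r]/(derive1 (derive1 u) r).
have -> : r `^ (al - 1) = r `^ al / r by rewrite powRBp// powRr1// ltW.
move: (r `^ al) (derive1 (derive1 u) r) (derive1 u r) => W a b.
by field; rewrite gt_eqF.
Qed.

Lemma J_at0 : J y @[y --> 0^'+] --> (0 : R).
Proof.
have c1 := primitive0_source_at0 al0; have c2 := primitive0_source_at0 ler01.
have c3 := primitive0_source_at0 al2.
have p1 : y `^ (al + 1) @[y --> 0^'+] --> (0 : R) by apply: powR_cvg0; move: al3; lra.
have p2 : y ^+ 2 @[y --> 0^'+] --> (0 : R).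
  apply: (@dominated_at0 _ 1 2) => // y y0.
  by rewrite mul1r powR_mulrn ?(ltW y0)// ger0_norm// sqr_ge0.
rewrite -[X in _ --> X](_ : (2 * (al + 1))^-1 * 0 - (2 * (al - 1))^-1 * (0 * 0) +
    ((al + 1) * (al - 1))^-1 * (0 * (0 - H0)) = 0); last first.
  by rewrite !mul0r !mulr0 subrr addr0.
apply: cvgD; first apply: cvgB.
- by apply: cvgMr; exact: c3.
- by apply: cvgMr; apply: cvgM; [exact: p2|exact: c1].
- by apply: cvgMr; apply: cvgM; [exact: p1|apply: cvgB; [exact: c2|exact: cvg_cst]].
Qed.

(** The flux and [lam * J] differ by a constant, which is the limit of the flux at
    [0] and vanishes because [u] is bounded. *)
Lemma fluxE y : 0 < y -> flux y = lam * J y.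
Proof.
move=> y0; pose c := flux 1 - lam * J 1.
have E r : 0 < r -> flux r = lam * J r + c.
  move=> r0; rewrite /c; have [r1|r1] := leP 1 r.
    by have := flux_increment ltr01 r1; lra.
  by have := flux_increment r0 (ltW r1); lra.
suff c0 : c = 0 by rewrite E// c0 addr0.
have [K K0 HK] := minimizer_bounded.
apply: (@flux_eq0 _ al K c u (fun r => lam * J r + c)) => //.
- by move: al3; lra.
- move=> r r0; have := AC1loc_is_derive uac r0.
  by rewrite -E// /flux powRN mulKf// gt_eqF// powR_gt0.
- rewrite -[X in _ --> X](_ : lam * 0 + c = c); last by rewrite mulr0 add0r.
  by apply: cvgD; [apply: cvgMr; exact: J_at0|exact: cvg_cst].
Qed.

Lemma G_at0 : G y @[y --> 0^'+] --> (al - 1)^-1 * (0 - H0 - 0).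
Proof.
apply: cvgMr; apply: cvgB.
  by apply: cvgB; [exact: (primitive0_source_at0 ler01)|exact: cvg_cst].
have [K K0 HK] := primitive0_source_bound.
apply: (@dominated_at0 _ K 2) => // y y0.
rewrite normrM (ger0_norm (powR_ge0 _ _)).
have -> : K * y `^ 2 = y `^ (1 - al) * (K * y `^ (al + 1)).
  rewrite mulrCA -powRDp//; congr (_ * _ `^ _); ring.
by apply: ler_wpM2l; [exact: powR_ge0|exact: HK].
Qed.

(** The formula for the flux expresses [u'] by primitives of the continuous function
    [h], and can be differentiated three more times. *)
Theorem minimizer_radial_solution : exists M D N d,
  radial_solution al (fun x => lam * signed_power p x) u M D N l d.
Proof.
exists (fun r => lam * J r), (fun r => lam * G r), (fun r => lam * A1 r),
  (lam * ((al - 1)^-1 * (0 - H0 - 0))).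
split; split.
- move=> r r0; have := AC1loc_is_derive uac r0.
  by rewrite -fluxE// /flux powRN mulKf// gt_eqF// powR_gt0.
- by move=> r r0; apply: (is_deriveZ_eq (J_derive r0)); rewrite mulrCA.
- by move=> r r0; apply: (is_deriveZ_eq (G_derive r0)); rewrite mulrCA.
- move=> r r0; apply: (is_deriveZ_eq (primitive0_source_derive al0 r0)).
  by rewrite -/(h r); ring.
- exact: ul.
- by rewrite -[X in _ --> X](mulr0 lam); apply: cvgMr; exact: J_at0.
- by apply: cvgMr; exact: G_at0.
- by rewrite -[X in _ --> X](mulr0 lam); apply: cvgMr; exact: (primitive0_source_at0 al0).
Qed.

End MinimizerSystem.

(** * Comparison and uniqueness for the radial equation *)

Section Shooting.
Context (R : realType).
Implicit Types (f g F G u M D N : R -> R) (r x y l d L K : R).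

(** [F] is nondecreasing on [(0, y)]; only a lower bound [G] of [F] is required to
    have a limit at [0]. *)
Lemma ge_limit_at0 F g G y l : 0 < y ->
  (forall r, 0 < r -> is_derive r 1 F (g r)) ->
  (forall r, 0 < r -> r < y -> 0 <= g r) ->
  (forall r, 0 < r -> r < y -> G r <= F r) ->
  G r @[r --> 0^'+] --> l -> l <= F y.
Proof.
move=> y0 dF g0 GF Gl; rewrite leNgt; apply/negP => h.
have e0 : 0 < l - F y by rewrite subr_gt0.
move/cvgrPdist_lt : Gl => /(_ _ e0)[d /= d0 Hd].
pose x := Num.min (d / 2) (y / 2).
have x0 : 0 < x by rewrite lt_min; apply/andP; split; lra.
have xd : x < d by rewrite /x gt_min; apply/orP; left; lra.
have xy : x < y by rewrite /x gt_min; apply/orP; right; lra.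
have : `|l - G x| < l - F y.
  by apply: Hd => //=; rewrite sub0r normrN gtr0_norm.
rewrite ltr_norml => /andP[_]; have := GF x x0 xy.
have : F x <= F y.
  apply: (pos_monotone x0 (ltW xy) dF) => r /andP[xr ry].
  by apply: g0 => //; exact: lt_trans xr.
lra.
Qed.

Lemma le_primitive_at0 F g G g' y : 0 < y ->
  (forall r, 0 < r -> is_derive r 1 F (g r)) ->
  (forall r, 0 < r -> is_derive r 1 G (g' r)) ->
  (forall r, 0 < r -> r < y -> `|g r| <= g' r) ->
  (forall r, 0 < r -> 0 <= G r) ->
  F r @[r --> 0^'+] --> (0 : R) -> `|F y| <= G y.
Proof.
move=> y0 dF dG gg' G0 F0.
have h1 : 0 <= G y - F y.
  apply: (@ge_limit_at0 (fun r => G r - F r) (fun r => g' r - g r) (fun r => - F r)) => //.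
  - by move=> r r0; apply: (is_deriveB_eq (dG r r0) (dF r r0)).
  - by move=> r r0 ry; have := gg' r r0 ry; have := ler_norm (g r); lra.
  - by move=> r r0 _; have := G0 r r0; lra.
  - by rewrite -[X in _ --> X]oppr0; exact: cvgN.
have h2 : 0 <= G y + F y.
  apply: (@ge_limit_at0 (fun r => G r + F r) (fun r => g' r + g r) F) => //.
  - by move=> r r0; apply: (is_deriveD_eq (dG r r0) (dF r r0)).
  - by move=> r r0 ry; have := gg' r r0 ry; have := ler_norm (- g r); rewrite normrN; lra.
  - by move=> r r0 _; have := G0 r r0; lra.
by rewrite ler_norml; apply/andP; split; lra.
Qed.

Lemma cvg_at0_gt F l c : F r @[r --> 0^'+] --> l -> c < l ->
  exists2 e, 0 < e & forall r, 0 < r -> r < e -> c < F r.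
Proof.
move=> /cvgrPdist_lt H cl; have e0 : 0 < l - c by rewrite subr_gt0.
have [d /= d0 Hd] := H _ e0; exists d => // r r0 rd.
have : `|l - F r| < l - c.
  by apply: Hd => //=; rewrite sub0r normrN gtr0_norm.
by rewrite ltr_norml => /andP[_]; lra.
Qed.

Section TwoSolutions.
Context (al : R) (al0 : 0 <= al) (f : R -> R).
Context (u1 M1 D1 N1 u2 M2 D2 N2 : R -> R) (l d1 d2 : R).
Context (sol1 : radial_solution al f u1 M1 D1 N1 l d1).
Context (sol2 : radial_solution al f u2 M2 D2 N2 l d2).

Let u r := u1 r - u2 r.
Let M r := M1 r - M2 r.
Let D r := D1 r - D2 r.
Let N r := N1 r - N2 r.
Let e r := f (u1 r) - f (u2 r).

Lemma difference_system :
  [/\ forall r, 0 < r -> is_derive r 1 u (r `^ (- al) * M r),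
      forall r, 0 < r -> is_derive r 1 M (r `^ al * D r),
      forall r, 0 < r -> is_derive r 1 D (r `^ (- al) * N r) &
      forall r, 0 < r -> is_derive r 1 N (r `^ al * e r)] /\
  [/\ u r @[r --> 0^'+] --> (0 : R), M r @[r --> 0^'+] --> (0 : R),
      D r @[r --> 0^'+] --> d1 - d2 & N r @[r --> 0^'+] --> (0 : R)].
Proof.
have [[a1 a2 a3 a4] [b1 b2 b3 b4]] := sol1.
have [[a1' a2' a3' a4'] [b1' b2' b3' b4']] := sol2.
split; split.
- by move=> r r0; apply: (is_deriveB_eq (a1 r r0) (a1' r r0)); rewrite mulrBr.
- by move=> r r0; apply: (is_deriveB_eq (a2 r r0) (a2' r r0)); rewrite mulrBr.
- by move=> r r0; apply: (is_deriveB_eq (a3 r r0) (a3' r r0)); rewrite mulrBr.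
- by move=> r r0; apply: (is_deriveB_eq (a4 r r0) (a4' r r0)); rewrite mulrBr.
- by rewrite -[X in _ --> X](subrr l); exact: cvgB.
- by rewrite -[X in _ --> X](subrr 0); exact: cvgB.
- exact: cvgB.
- by rewrite -[X in _ --> X](subrr 0); exact: cvgB.
Qed.

(** Nonnegativity passes from [D] to [M], to [u], to [e] by monotonicity of [f], and
    to [N]; so [D] increases. *)
Lemma shooting_propagates y : {homo f : x z / x <= z} -> 0 < y ->
  (forall r, 0 < r -> r < y -> 0 <= D r) ->
  [/\ 0 <= M y, 0 <= u y & d1 - d2 <= D y].
Proof.
move=> f_nd y0 D0; have [[a1 a2 a3 a4] [b1 b2 b3 b4]] := difference_system.
have M0 z : 0 < z -> z <= y -> 0 <= M z.
  move=> z0 zy; apply: (ge_limit_at0 z0 a2 _ _ b2) => // r r0 rz.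
  by rewrite mulr_ge0 ?powR_ge0// D0//; exact: lt_le_trans zy.
have u0 z : 0 < z -> z <= y -> 0 <= u z.
  move=> z0 zy; apply: (ge_limit_at0 z0 a1 _ _ b1) => // r r0 rz.
  by rewrite mulr_ge0 ?powR_ge0// M0// ltW//; exact: lt_le_trans zy.
have N0 z : 0 < z -> z <= y -> 0 <= N z.
  move=> z0 zy; apply: (ge_limit_at0 z0 a4 _ _ b4) => // r r0 rz.
  rewrite mulr_ge0 ?powR_ge0// subr_ge0 f_nd// -subr_ge0.
  by apply: u0 => //; rewrite ltW//; exact: lt_le_trans zy.
split; [exact: M0|exact: u0|].
apply: (ge_limit_at0 y0 a3 _ _ b3) => // r r0 rz.
by rewrite mulr_ge0 ?powR_ge0// N0// ltW.
Qed.

(** At the first point where [D] drops to half of its initial value,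
    [shooting_propagates] says that [D] has not dropped at all.  Integrating
    [D >= (d1 - d2) / 2] twice gives the bound. *)
Lemma shooting_growth : {homo f : x z / x <= z} -> d2 < d1 ->
  forall r, 0 < r -> (d1 - d2) / (4 * (al + 1)) * r ^+ 2 <= u r.
Proof.
move=> f_nd d12; have [[a1 a2 a3 a4] [b1 b2 b3 b4]] := difference_system.
pose delta := d1 - d2; have delta0 : 0 < delta by rewrite subr_gt0.
have [r0 r00 Hr0] := cvg_at0_gt b3 (ltac:(rewrite -/delta; lra) : delta / 2 < d1 - d2).
have Dpos s : 0 < s -> delta / 2 < D s.
  move=> s0; rewrite ltNge; apply/negP => Ds.
  (* The infimum of [E] is the first point where [D] is at most [delta / 2]. *)
  pose E := [set t | r0 <= t /\ D t <= delta / 2].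
  have Es : E s.
    split => //; rewrite leNgt; apply/negP => sr0.
    by have := Hr0 s s0 sr0; rewrite -/delta; lra.
  have E0 : E !=set0 by exists s.
  have hiE : has_inf E by split => //; exists r0 => t [].
  pose m := inf E.
  have m0 : r0 <= m by apply: lb_le_inf => // t [].
  have mp : 0 < m by lra.
  have below r : 0 < r -> r < m -> 0 <= D r.
    move=> rp rm; rewrite leNgt; apply/negP => Dr.
    have Er : E r.
      split; last by lra.
      rewrite leNgt; apply/negP => rr0.
      by have := Hr0 r rp rr0; lra.
    have : m <= r by apply: ge_inf => //; exists r0 => t [].
    by lra.
  have [_ _ Dm] := shooting_propagates f_nd mp below.
  have cD : {for m, continuous D} by exact: (is_derive_continuous_at (a3 m mp)).
  have e0 : 0 < delta / 2 by lra.
  move/cvgrPdist_lt : cD => /(_ _ e0)[d /= d0 Hd].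
  have [t Et tm] := inf_lt E0 (ltac:(rewrite -/m; lra) : inf E < m + d).
  have mt : m <= t by apply: ge_inf => //; exists r0 => z [].
  have : `|D m - D t| < delta / 2.
    by apply: Hd => /=; rewrite distrC ger0_norm; rewrite -/m in tm; lra.
  have [_ Dt] := Et.
  rewrite ltr_norml => /andP[h1 h2].
  by have := Dm; rewrite -/delta; lra.
have al1 : 0 < al + 1 by move: al0; lra.
have Mlow r : 0 < r -> (delta / 2 / (al + 1)) * r `^ (al + 1) <= M r.
  move=> rp; rewrite -subr_ge0.
  pose g := fun z => z `^ al * D z - delta / 2 / (al + 1) * ((al + 1) * z `^ (al + 1 - 1)).
  apply: (@ge_limit_at0 (fun z => M z - delta / 2 / (al + 1) * z `^ (al + 1)) g
     (fun z => M z - delta / 2 / (al + 1) * z `^ (al + 1))) => //.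
  - move=> z z0; apply: (is_deriveB_eq (a2 z z0) _ erefl).
    exact: (is_deriveZ_eq (is_derive_powR (al + 1) z0) erefl).
  - move=> z z0 _; rewrite /g addrK.
    rewrite (_ : _ - _ = z `^ al * (D z - delta / 2)); last first.
      by move: (z `^ al) (D z) => W b; field; rewrite gt_eqF.
    by rewrite mulr_ge0 ?powR_ge0// subr_ge0 ltW// Dpos.
  - rewrite -[X in _ --> X](_ : 0 - delta / 2 / (al + 1) * 0 = 0); last by rewrite mulr0 subrr.
    by apply: cvgB => //; apply: cvgMr; exact: powR_cvg0.
move=> r rp; rewrite -subr_ge0 -/delta.
pose g := fun z => z `^ (- al) * M z - delta / (4 * (al + 1)) * (2 * z).
apply: (@ge_limit_at0 (fun z => u z - delta / (4 * (al + 1)) * z ^+ 2) g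
  (fun z => u z - delta / (4 * (al + 1)) * z ^+ 2)) => //.
- move=> z z0; apply: (is_deriveB_eq (a1 z z0) _ erefl).
  exact: (is_deriveZ_eq (is_derive_sqr z) erefl).
- move=> z z0 _; rewrite /g.
  have -> : delta / (4 * (al + 1)) * (2 * z) =
      z `^ (- al) * (delta / 2 / (al + 1) * z `^ (al + 1)).
    rewrite [RHS]mulrCA -powRDp// addrA addNr add0r powRr1 ?(ltW z0)//.
    by field; rewrite gt_eqF.
  by rewrite -mulrBr mulr_ge0 ?powR_ge0// subr_ge0 Mlow.
- rewrite -[X in _ --> X](_ : 0 - delta / (4 * (al + 1)) * (0 * 0) = 0); last first.
    by rewrite !mulr0 subrr.
  apply: cvgB => //; apply: cvgMr.
  under [X in X @ _]eq_fun do rewrite expr2.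
  by apply: cvgM; apply: cvg_at_right_filter; exact: cvg_id.
Qed.

Lemma exp_weight_derive (c k r : R) : k != 0 ->
  is_derive r 1 (fun z => c / k * expR (k * z)) (c * expR (k * r)).
Proof.
move=> k0.
have dk : is_derive r 1 (fun z => expR (k * z)) (expR (k * r) * k).
  apply: (@is_derive_comp_eq _ (@expR R) (fun z => k * z) r _ (k * 1) _
    (is_derive_expR (k * r)) (is_deriveZ_eq (is_derive_id r 1) erefl)).
  by rewrite mulr1.
by apply: (is_deriveZ_eq dk); field.
Qed.

Lemma powR_exp_weight_derive (c k r : R) : k != 0 -> 0 < r ->
  is_derive r 1 (fun z => z `^ al * (c / k * expR (k * z)))
    (r `^ al * (c * expR (k * r)) + c / k * expR (k * r) * (al * r `^ (al - 1))).
Proof.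
by move=> k0 r0; apply: (is_deriveM_eq (is_derive_powR al r0) (exp_weight_derive c r k0)).
Qed.

(** Each of the four integrations of the system gains a factor [1 / k] on bounds of
    the form [c * expR (k * r)], and the Lipschitz constant costs a factor [L]. *)
Lemma shooting_contracts K L k a : 0 < k -> 0 <= a -> 0 <= L -> 2 * L <= k ^+ 4 ->
  (forall x y, `|x| <= K -> `|y| <= K -> `|f x - f y| <= L * `|x - y|) ->
  (forall r, 0 < r -> `|u1 r| <= K) -> (forall r, 0 < r -> `|u2 r| <= K) ->
  d1 = d2 ->
  (forall r, 0 < r -> `|u r| <= a * expR (k * r)) ->
  forall r, 0 < r -> `|u r| <= a / 2 * expR (k * r).
Proof.
move=> k0 a0 L0 kL lip b1 b2 d12 ua.
have [[a1 a2 a3 a4] [c1 c2 c3 c4]] := difference_system.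
rewrite d12 subrr in c3.
have kn : k != 0 by rewrite gt_eqF.
have ex r : 0 < expR (k * r) by exact: expR_gt0.
have step F g c : (forall r, 0 < r -> is_derive r 1 F (r `^ al * g r)) -> 0 <= c ->
    F r @[r --> 0^'+] --> (0 : R) -> (forall r, 0 < r -> `|g r| <= c * expR (k * r)) ->
    forall r, 0 < r -> `|F r| <= r `^ al * (c / k * expR (k * r)).
  move=> dF cge F0 gc r r0.
  apply: (le_primitive_at0 r0 dF (fun z z0 => powR_exp_weight_derive c kn z0)) => //.
    move=> z z0 _; rewrite normrM (ger0_norm (powR_ge0 _ _)).
    have h1 : z `^ al * `|g z| <= z `^ al * (c * expR (k * z)).
      by apply: ler_wpM2l; [exact: powR_ge0|exact: gc].
    have h2 : 0 <= c / k * expR (k * z) * (al * z `^ (al - 1)).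
      by rewrite !mulr_ge0 ?powR_ge0 ?(ltW (ex z))// invr_ge0 ltW.
    by lra.
  by move=> z z0; rewrite !mulr_ge0 ?powR_ge0 ?(ltW (ex z))// invr_ge0 ltW.
have step' F g c : (forall r, 0 < r -> is_derive r 1 F (r `^ (- al) * g r)) -> 0 <= c ->
    F r @[r --> 0^'+] --> (0 : R) ->
    (forall r, 0 < r -> `|g r| <= r `^ al * (c * expR (k * r))) ->
    forall r, 0 < r -> `|F r| <= c / k * expR (k * r).
  move=> dF cge F0 gc r r0.
  apply: (le_primitive_at0 r0 dF (fun z _ => exp_weight_derive c z kn)) => //.
    move=> z z0 _; rewrite normrM (ger0_norm (powR_ge0 _ _)) powRN mulrC.
    by rewrite ler_pdivrMr ?powR_gt0// mulrC gc.
  by move=> z z0; rewrite !mulr_ge0 ?(ltW (ex z))// invr_ge0 ltW.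
have k1 c : 0 <= c -> 0 <= c / k by move=> c0; rewrite divr_ge0// ltW.
have La0 : 0 <= L * a by rewrite mulr_ge0.
have eL r : 0 < r -> `|e r| <= L * a * expR (k * r).
  move=> r0; apply: le_trans (lip _ _ (b1 r r0) (b2 r r0)) _.
  by rewrite -mulrA; apply: ler_wpM2l => //; exact: ua.
have hN := step N e (L * a) a4 La0 c4 eL.
have hD := step' D N (L * a / k) a3 (k1 _ La0) c3 hN.
have hM := step M D _ a2 (k1 _ (k1 _ La0)) c2 hD.
have hu := step' u M _ a1 (k1 _ (k1 _ (k1 _ La0))) c1 hM.
move=> r r0; apply: le_trans (hu r r0) _.
apply: ler_wpM2r; first exact: ltW.
rewrite (_ : _ / k = L * a / k ^+ 4); last by field.
rewrite ler_pdivrMr ?exprn_gt0//.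
by have := ler_wpM2l a0 kL; lra.
Qed.

Lemma shooting_unique_data K L : 0 <= L ->
  (forall x y, `|x| <= K -> `|y| <= K -> `|f x - f y| <= L * `|x - y|) ->
  (forall r, 0 < r -> `|u1 r| <= K) -> (forall r, 0 < r -> `|u2 r| <= K) ->
  d1 = d2 -> forall r, 0 < r -> u1 r = u2 r.
Proof.
move=> L0 lip b1 b2 d12 r r0.
have K0 : 0 <= K by apply: le_trans (b1 1 ltr01).
(* Any rate with [2 * L <= k ^+ 4] makes the system contract by [1 / 2]. *)
pose k := 1 + 2 * L.
have k1 : 1 <= k by rewrite /k; lra.
have k0 : 0 < k by lra.
have k4 : 2 * L <= k ^+ 4.
  apply: (@le_trans _ _ k); first by rewrite /k; lra.
  by rewrite -{1}[k]expr1; apply: ler_weXn2l.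
have key n : forall z, 0 < z -> `|u z| <= 2 * K / 2 ^+ n * expR (k * z).
  elim: n => [|n IH].
    move=> z z0; rewrite expr0 divr1.
    apply: (@le_trans _ _ (2 * K * 1)).
      by rewrite mulr1; apply: le_trans (ler_normB _ _) _; have := b1 z z0; have := b2 z z0; lra.
    by apply: ler_wpM2l; rewrite ?mulr_ge0// -[1]expR0 ler_expR mulr_ge0// ltW.
  move=> z z0.
  have a0 : 0 <= 2 * K / 2 ^+ n by rewrite divr_ge0 ?mulr_ge0 ?exprn_ge0.
  have := shooting_contracts k0 a0 L0 k4 lip b1 b2 d12 IH z0.
  by rewrite (_ : 2 * K / 2 ^+ n / 2 = 2 * K / 2 ^+ n.+1) // exprSr invfM !mulrA.
apply/eqP; rewrite -subr_eq0 -normr_eq0 eq_le normr_ge0 andbT -/(u r).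
apply/ler_addgt0Pr => eps eps0; rewrite add0r.
pose B := 2 * K * expR (k * r).
have B0 : 0 <= B by rewrite !mulr_ge0// ltW// expR_gt0.
pose n := Num.Def.archi_bound (B / eps).
have nB : B / eps < n%:R by apply: archi_boundP; rewrite divr_ge0// ltW.
apply: le_trans (key n r r0) _.
rewrite (mulrAC (2 * K)) -/B ler_pdivrMr ?exprn_gt0// mulrC -ler_pdivrMr//.
apply: le_trans (ltW nB) _.
by rewrite -natrX ler_nat ltnW// ltn_expl.
Qed.

End TwoSolutions.

(** If [d1] and [d2] differ, the solutions drift apart quadratically and cannot both
    be bounded; if they agree, the contraction applies. *)
Theorem radial_solution_unique al f u1 M1 D1 N1 u2 M2 D2 N2 l d1 d2 K L :
  0 <= al -> {homo f : x z / x <= z} -> 0 <= L ->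
  (forall x y, `|x| <= K -> `|y| <= K -> `|f x - f y| <= L * `|x - y|) ->
  radial_solution al f u1 M1 D1 N1 l d1 ->
  radial_solution al f u2 M2 D2 N2 l d2 ->
  (forall r, 0 < r -> `|u1 r| <= K) -> (forall r, 0 < r -> `|u2 r| <= K) ->
  forall r, 0 < r -> u1 r = u2 r.
Proof.
move=> al0 f_nd L0 lip s1 s2 b1 b2.
have K0 : 0 <= K by apply: le_trans (b1 1 ltr01).
have no v1 m1 e1 n1 v2 m2 e2 n2 c1 c2 :
    radial_solution al f v1 m1 e1 n1 l c1 -> radial_solution al f v2 m2 e2 n2 l c2 ->
    (forall r, 0 < r -> `|v1 r| <= K) -> (forall r, 0 < r -> `|v2 r| <= K) ->
    ~ c2 < c1.
  move=> t1 t2 w1 w2 c21.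
  have G := shooting_growth al0 t1 t2 f_nd c21.
  pose c := (c1 - c2) / (4 * (al + 1)).
  have c0 : 0 < c by rewrite divr_gt0 ?subr_gt0//; lra.
  pose r := 1 + 2 * K / c.
  have r1 : 1 <= r by rewrite /r lerDl; apply: divr_ge0; [lra|exact: ltW].
  have r0 : 0 < r by lra.
  have := G r r0; rewrite -/c => Gr.
  have h1 : c * r <= c * r ^+ 2 by rewrite ler_pM2l// expr2 ler_peMl// ltW.
  have h2 : c * r = c + 2 * K by rewrite /r mulrDr mulr1 mulrC divfK// gt_eqF.
  have := w1 r r0; have := w2 r r0; rewrite !ler_norml => /andP[? ?] /andP[? ?].
  lra.
have d12 : d1 = d2.
  apply/eqP; rewrite eq_le !leNgt; apply/andP; split; apply/negP.
    exact: (no _ _ _ _ _ _ _ _ _ _ s1 s2 b1 b2).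
  exact: (no _ _ _ _ _ _ _ _ _ _ s2 s1 b2 b1).
exact: (shooting_unique_data al0 s1 s2 L0 lip b1 b2 d12).
Qed.

End Shooting.

(** * The explicit bubble *)

Section Bubble.
Context (R : realType) (al k l : R) (al3 : 3 < al) (k0 : 0 <= k).
Implicit Types (r c x : R).

Local Notation gam := ((al - 3) / 2).

Let B r : R := 1 + k * r ^+ 2.

Lemma bubble_base_gt0 r : 0 < B r.
Proof. by rewrite /B ltr_wpDr// mulr_ge0 ?sqr_ge0. Qed.

Definition bubble r : R := l * (1 + k * r ^+ 2) `^ (- gam).

Lemma bubble_base_derive c r :
  is_derive r 1 (fun z => B z `^ c) (c * B r `^ (c - 1) * (2 * k * r)).
Proof.
have dB : is_derive r 1 B (2 * k * r).
  apply: (is_deriveD_eq (is_derive_cst (1 : R) r 1)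
    (is_deriveZ_eq (is_derive_sqr r) erefl)).
  by rewrite add0r; ring.
exact: (@is_derive_comp_eq _ (@powR R ^~ c) B r _ _ _
  (is_derive_powR c (bubble_base_gt0 r)) dB erefl).
Qed.

(** [M], [D] and [N] are the flux of [bubble], its Laplacian, and the flux of the
    Laplacian. *)
Let M r := - (2 * gam * k * l) * (r `^ (al + 1) * B r `^ (- gam - 1)).
Let D r := - (2 * gam * k * l) *
  ((al - 1) * B r `^ (- gam - 2) + 2 * B r `^ (- gam - 1)).
Let N r := 4 * gam * k ^+ 2 * l * (al - 1) *
  (r `^ (al + 1) * ((gam + 2) * B r `^ (- gam - 3) + B r `^ (- gam - 2))).

Lemma powRS_al r : 0 < r -> r `^ (al + 1) = r `^ al * r.
Proof. by move=> r0; rewrite powRDp// powRr1 ?(ltW r0). Qed.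

Lemma bubble_powS c r : B r `^ c = B r `^ (c - 1) * B r.
Proof.
have B0 := bubble_base_gt0 r.
by rewrite -{3}(powRr1 (ltW B0)) -powRDp//; congr (_ `^ _); ring.
Qed.

Lemma bubble_derive r : 0 < r -> is_derive r 1 bubble (r `^ (- al) * M r).
Proof.
move=> r0; apply: (is_deriveZ_eq (bubble_base_derive (- gam) r)).
rewrite /M powRS_al// powRN; move: (B r `^ _) => b.
have := powR_gt0 al r0; move: (r `^ al) => w w0.
by field; rewrite gt_eqF.
Qed.

Lemma bubble_M_derive r : 0 < r -> is_derive r 1 M (r `^ al * D r).
Proof.
move=> r0; apply: (is_deriveZ_eq (is_deriveM_eq (is_derive_powR (al + 1) r0)
  (bubble_base_derive (- gam - 1) r) erefl)).
rewrite addrK powRS_al// /D (bubble_powS (- gam - 1)).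
rewrite (_ : - gam - 1 - 1 = - gam - 2); last by ring.
move: (B r `^ _) (r `^ al) => b w; rewrite /B.
by field.
Qed.

Lemma bubble_D_derive r : 0 < r -> is_derive r 1 D (r `^ (- al) * N r).
Proof.
move=> r0; apply: (is_deriveZ_eq (is_deriveD_eq
  (is_deriveZ_eq (bubble_base_derive (- gam - 2) r) erefl)
  (is_deriveZ_eq (bubble_base_derive (- gam - 1) r) erefl) erefl)).
rewrite /N powRS_al// powRN.
rewrite (_ : - gam - 1 - 1 = - gam - 2); last by ring.
rewrite (_ : - gam - 2 - 1 = - gam - 3); last by ring.
have := powR_gt0 al r0; move: (r `^ al) => w w0.
move: (B r `^ _) (B r `^ _) => b c.
by field; rewrite gt_eqF.
Qed.

(** With [b = 1 + k r^2] and [al + 1 = 2 (gam + 2)], the bracket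
    [(al + 1) ((gam + 2) b + b^2) - 2 (gam + 2) (b - 1) (gam + 3 + b)] reduces to the
    constant [(al + 1) (gam + 3)], which completes [P2 al]. *)
Lemma bubble_N_derive r : 0 < r ->
  is_derive r 1 N (r `^ al * (l * (k ^+ 2 * P2 al) * B r `^ (- gam - 4))).
Proof.
move=> r0; apply: (is_deriveZ_eq (is_deriveM_eq (is_derive_powR (al + 1) r0)
  (is_deriveD_eq (is_deriveZ_eq (bubble_base_derive (- gam - 3) r) erefl)
    (bubble_base_derive (- gam - 2) r) erefl) erefl)).
rewrite addrK powRS_al// (bubble_powS (- gam - 2)).
rewrite (_ : - gam - 2 - 1 = - gam - 3); last by ring.
rewrite (bubble_powS (- gam - 3)).
rewrite (_ : - gam - 3 - 1 = - gam - 4); last by ring.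
move: (B r `^ _) (r `^ al) => b w; rewrite /B /P2.
by rewrite 4?big_nat_recr//= big_geq// => *; field.
Qed.

Lemma bubble_base_at0 c : B r `^ c @[r --> 0^'+] --> (1 : R).
Proof.
have h : B r `^ c @[r --> (0 : R)] --> B 0 `^ c.
  exact: (is_derive_continuous_at (bubble_base_derive c 0)).
rewrite -[X in _ --> X](_ : B 0 `^ c = 1); first exact: cvg_at_right_filter.
by rewrite /B expr0n mulr0 addr0 powR1.
Qed.

Lemma powRS_at0 : r `^ (al + 1) @[r --> 0^'+] --> (0 : R).
Proof. by apply: powR_cvg0; move: al3; lra. Qed.

Lemma bubble_at0 : bubble r @[r --> 0^'+] --> l.
Proof.
by rewrite -[X in _ --> X]mulr1; apply: cvgMr; exact: bubble_base_at0.
Qed.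

Lemma bubble_bounded r : `|bubble r| <= `|l|.
Proof.
rewrite /bubble normrM (ger0_norm (powR_ge0 _ _)) -[leRHS]mulr1.
apply: ler_wpM2l => //; rewrite powRN invf_le1 ?powR_gt0 ?bubble_base_gt0//.
apply: (@le_trans _ _ (B r `^ 0)); first by rewrite powRr0.
apply: ler_powR; last by move: al3; lra.
by rewrite /B lerDl mulr_ge0 ?sqr_ge0.
Qed.

Lemma bubble_radial_solution (f : R -> R) :
  (forall r, 0 < r -> f (bubble r) = l * (k ^+ 2 * P2 al) * B r `^ (- gam - 4)) ->
  radial_solution al f bubble M D N l (- (2 * gam * k * l) * ((al - 1) * 1 + 2 * 1)).
Proof.
move=> fE; split; split.
- exact: bubble_derive.
- exact: bubble_M_derive.
- exact: bubble_D_derive.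
- move=> r r0; rewrite (fE r r0); exact: bubble_N_derive.
- exact: bubble_at0.
- rewrite -[X in _ --> X](_ : - (2 * gam * k * l) * (0 * 1) = 0); last by ring.
  by apply: cvgMr; apply: cvgM; [exact: powRS_at0|exact: bubble_base_at0].
- apply: cvgMr; apply: cvgD; apply: cvgMr; exact: bubble_base_at0.
- rewrite -[X in _ --> X](_ : 4 * gam * k ^+ 2 * l * (al - 1) *
    (0 * ((gam + 2) * 1 + 1)) = 0); last by ring.
  apply: cvgMr; apply: cvgM; first exact: powRS_at0.
  by apply: cvgD; [apply: cvgMr|]; exact: bubble_base_at0.
Qed.

End Bubble.

Lemma P2E (R : realType) (al : R) :
  P2 al = (al - 3) * (al - 1) * (al + 1) * (al + 3).
Proof. by rewrite /P2 4?big_nat_recr//= big_geq//; ring. Qed.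

Lemma P2_gt0 (R : realType) (al : R) : 3 < al -> 0 < P2 al.
Proof. by move=> al3; rewrite P2E !mulr_gt0//; lra. Qed.

(** As [gam * (crit_exp al - 2) = 4], the nonlinearity turns [b^(- gam)] into
    [b^(- gam - 4)]. *)
Lemma bubble_critical (R : realType) (al k l lam r : R) : 3 < al -> 0 <= k ->
  k ^+ 2 * P2 al = lam * `|l| `^ (crit_exp al - 2) ->
  lam * signed_power (crit_exp al) (bubble al k l r) =
  l * (k ^+ 2 * P2 al) * (1 + k * r ^+ 2) `^ (- ((al - 3) / 2) - 4).
Proof.
move=> al3 k0 kE; have B0 := bubble_base_gt0 k0 r.
rewrite kE /signed_power /bubble normrM (ger0_norm (powR_ge0 _ _)).
rewrite powRM ?powR_ge0// -powRrM.
move: (`|l| `^ _) => w.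
rewrite (_ : - ((al - 3) / 2) * (crit_exp al - 2) = - 4).
  by rewrite (addrC _ (- 4)) powRDp//; ring.
rewrite crit_expE//; field; lra.
Qed.

(** * The Gamma function and the mass of a bubble *)

Section GammaIntegrals.
Context (R : realType).
Implicit Types (f g F G : R -> R) (r t z s a b c k A C : R).

Local Notation mu := (@lebesgue_measure R).
Local Notation pos := (`]0, +oo[ : set R).

Lemma pos_exhaustion : pos = \bigcup_n `[n.+1%:R^-1, n.+1%:R : R].
Proof.
apply/seteqP; split => [z|z [n _]] /=; rewrite !in_itv/= andbT; last first.
  by move=> /andP[h _]; apply: lt_le_trans h; rewrite invr_gt0.
move=> z0; pose n := Num.Def.archi_bound (z + z^-1).
have zi : 0 < z^-1 by rewrite invr_gt0.
have hn : z + z^-1 < n%:R by apply: archi_boundP; lra.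
exists n => //=; rewrite in_itv/=.
have hS : (n%:R : R) <= n.+1%:R by rewrite ler_nat.
apply/andP; split; last by lra.
by rewrite -[leRHS]invrK lef_pV2 ?posrE ?invr_gt0//; lra.
Qed.

Lemma power_substitution_continuous G c b r : 0 < c -> 0 < r ->
  (forall z, 0 < z -> {for z, continuous G}) ->
  {for r, continuous (fun z => G (c * z `^ b) * (c * (b * z `^ (b - 1))))}.
Proof.
move=> c0 r0 cG; apply: cvgM; last by do 2 apply: cvgMr; exact: powR_continuous.
apply: (@continuous_comp _ _ _ (fun z => c * z `^ b) G).
  by apply: cvgMr; exact: powR_continuous.
by apply: cG; rewrite mulr_gt0 ?powR_gt0.
Qed.

(** The segments [[1 / n, n]] and their images both exhaust the half-line, and on
    corresponding segments the two integrals are the same increment of a primitive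
    of [G]. *)
Lemma pos_power_substitution G c b : 0 < c -> 0 < b ->
  (forall r, 0 < r -> 0 <= G r) -> (forall r, 0 < r -> {for r, continuous G}) ->
  mu.-integrable pos (EFin \o G) ->
  (\int[mu]_(r in pos) (G (c * r `^ b) * (c * (b * r `^ (b - 1))))%:E =
   \int[mu]_(r in pos) (G r)%:E)%E.
Proof.
move=> c0 b0 G0 cG iG.
pose phi r := c * r `^ b.
have phi0 r : 0 < r -> 0 < phi r by move=> r0; rewrite mulr_gt0 ?powR_gt0.
have phi_le r z : 0 <= r -> r <= z -> phi r <= phi z.
  move=> r0 rz; apply: ler_wpM2l; first exact: ltW.
  by apply: ge0_ler_powR; rewrite ?nnegrE ?(ltW b0)// (le_trans r0).
have dphi r : 0 < r -> is_derive r 1 phi (c * (b * r `^ (b - 1))).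
  by move=> r0; apply: (is_deriveZ_eq (is_derive_powR b r0)).
have dH r : 0 < r -> is_derive r 1 (primitive0 G) (G r).
  move=> r0; apply: (primitive0_derive r0 _ (cG r r0)) => z z0.
  exact: pos_integrable_oc.
pose g r := G (phi r) * (c * (b * r `^ (b - 1))).
have dHphi r : 0 < r -> is_derive r 1 (fun z => primitive0 G (phi z)) (g r).
  by move=> r0; apply: (is_derive_comp_eq (dH _ (phi0 r r0)) (dphi r r0)).
have g0 r : 0 < r -> 0 <= g r.
  by move=> r0; rewrite mulr_ge0 ?G0 ?phi0// !mulr_ge0 ?powR_ge0 ?ltW.
have cg r : 0 < r -> {for r, continuous g}.
  by move=> r0; exact: power_substitution_continuous.
have nS n : 0 < n.+1%:R^-1 :> R by rewrite invr_gt0.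
have nS1 n : n.+1%:R^-1 <= n.+1%:R :> R.
  by apply: (@le_trans _ _ 1); rewrite ?invf_le1// ler1n.
have mono n m : (n <= m)%N -> m.+1%:R^-1 <= n.+1%:R^-1 :> R /\ n.+1%:R <= m.+1%:R :> R.
  by move=> nm; rewrite lef_pV2 ?posrE// !ler_nat ltnS.
have lim1 := exhaustion_cvg g0 cg dHphi (fun n => conj (nS n) (nS1 n)) mono.
have ab n : 0 < phi n.+1%:R^-1 /\ phi n.+1%:R^-1 <= phi n.+1%:R.
  by split; [exact: phi0|apply: phi_le; [exact: ltW|exact: nS1]].
have mono2 n m : (n <= m)%N ->
    phi m.+1%:R^-1 <= phi n.+1%:R^-1 /\ phi n.+1%:R <= phi m.+1%:R.
  by move=> /mono[h1 h2]; split; apply: phi_le => //; exact: ltW.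
have lim2 := exhaustion_cvg G0 cG dH ab mono2.
have E : \bigcup_n `[phi n.+1%:R^-1, phi n.+1%:R] = pos.
  apply/seteqP; split => [z [n _]|z] /=; rewrite !in_itv/= andbT.
    by move=> /andP[h _]; apply: lt_le_trans h; exact: phi0.
  move=> z0; pose w := (z / c) `^ b^-1.
  have zc : 0 < z / c by rewrite divr_gt0.
  have w0 : pos w by rewrite in_posE powR_gt0.
  have wz : phi w = z.
    rewrite /phi /w -powRrM mulVf ?gt_eqF// powRr1 ?(ltW zc)//.
    by rewrite mulrC divfK// gt_eqF.
  move: (w0); rewrite {1}pos_exhaustion => -[n _ /=]; rewrite in_itv/= => /andP[h1 h2].
  exists n => //=; rewrite in_itv/= -wz.
  rewrite in_posE in w0.
  by apply/andP; split; apply: phi_le => //; exact: ltW.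
rewrite -pos_exhaustion in lim1; rewrite E in lim2.
exact: (cvg_unique _ lim1 lim2).
Qed.

Lemma integral_posZl C f : 0 <= C -> measurable_fun pos f ->
  (forall r, 0 < r -> 0 <= f r) ->
  (\int[mu]_(r in pos) (C * f r)%:E = C%:E * \int[mu]_(r in pos) (f r)%:E)%E.
Proof.
move=> C0 mf f0; have h := @ge0_integralZl _ _ R mu pos (@measurable_pos R) (EFin \o f).
rewrite -h.
- by apply: eq_integral => r _; rewrite EFinM.
- exact/measurable_EFinP.
- by move=> r; rewrite in_posE => r0; rewrite lee_fin f0.
- by [].
Qed.

(** If the integral of [f] is infinite, both sides are zero. *)
Lemma Rintegral_posZl C f : 0 < C -> measurable_fun pos f ->
  (forall r, 0 < r -> 0 <= f r) ->
  \int[mu]_(r in pos) (C * f r) = C * \int[mu]_(r in pos) f r.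
Proof.
move=> C0 mf f0; rewrite /Rintegral integral_posZl// ?ltW//.
case: (integral _ _ _) => [x| |] //=.
- by rewrite gt0_muley ?lte_fin//= mulr0.
- by rewrite gt0_muleNy ?lte_fin//= mulr0.
Qed.

Definition gamma_kernel s t : R := t `^ (s - 1) * expR (- t).

Lemma gamma_kernel_gt0 s t : 0 < t -> 0 < gamma_kernel s t.
Proof. by move=> t0; rewrite mulr_gt0 ?powR_gt0 ?expR_gt0. Qed.

Lemma gamma_kernel_continuous s t : 0 < t -> {for t, continuous (gamma_kernel s)}.
Proof.
move=> t0; apply: cvgM; first exact: powR_continuous.
apply: (@continuous_comp _ _ _ (fun z : R => - z) expR); last exact: continuous_expR.
by apply: cvgN; exact: cvg_id.
Qed.

(** The exponential beats every power: [expR t = expR (t / m) `^ m >= (t / m) `^ m]. *)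
Lemma powR_expRN_bounded m t : 0 < m -> 0 < t -> t `^ m * expR (- t) <= m `^ m.
Proof.
move=> m0 t0; rewrite expRN ler_pdivrMr ?expR_gt0//.
have E : expR t = expR (t / m) `^ m by rewrite -expRM divfK// gt_eqF.
have tm : 0 < t / m by rewrite divr_gt0.
rewrite E -powRM ?expR_ge0 ?(ltW m0)//.
apply: ge0_ler_powR; rewrite ?nnegrE ?mulr_ge0 ?expR_ge0 ?(ltW m0) ?(ltW t0)//.
by rewrite -ler_pdivrMl// mulrC; have := expR_ge1Dx (t / m); lra.
Qed.

Lemma gamma_kernel_integrable s : 0 < s -> mu.-integrable pos (EFin \o gamma_kernel s).
Proof.
move=> s0; pose C := (s + 1) `^ (s + 1); pose c := Num.max 1 C.
apply: (@integrable_two_powers R _ (s - 1) (- 2) 1 c) => //; [lra|lra|..].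
- by apply: pos_continuous_measurable => t; exact: gamma_kernel_continuous.
- move=> t t0 _; rewrite ger0_norm ?(ltW (gamma_kernel_gt0 s t0))// mulrC.
  apply: ler_pM; rewrite ?powR_ge0 ?expR_ge0// le_max; apply/orP; left.
  by rewrite -[leRHS]expR0 ler_expR; lra.
- move=> t t1; have t0 : 0 < t by lra.
  rewrite ger0_norm ?(ltW (gamma_kernel_gt0 s t0))//.
  rewrite /gamma_kernel (_ : s - 1 = (s + 1) + - 2); last by ring.
  rewrite powRDp// mulrAC; apply: ler_wpM2r; first exact: powR_ge0.
  have s1 : 0 < s + 1 by lra.
  by rewrite le_max; apply/orP; right; exact: powR_expRN_bounded.
Qed.

Lemma GammaE s : 0 < s -> (\int[mu]_(t in pos) (gamma_kernel s t)%:E = (Gamma s)%:E)%E.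
Proof.
move=> s0; rewrite /Gamma /Rintegral fineK//.
by apply: integrable_fin_num; [exact: measurable_pos|exact: gamma_kernel_integrable].
Qed.

Lemma Gamma_gt0 s : 0 < s -> 0 < Gamma s.
Proof.
move=> s0; apply: (Rint_pos_gt0 (gamma_kernel_integrable s0) ltr01).
- by move=> t t0; rewrite ltW// gamma_kernel_gt0.
- exact: gamma_kernel_gt0.
- exact: gamma_kernel_continuous.
Qed.

(** Substitute [t = A * r `^ b] in [Gamma s]. *)
Lemma gamma_scaling A b s : 0 < A -> 0 < b -> 0 < s ->
  (\int[mu]_(r in pos) (r `^ (b * s - 1) * expR (- (A * r `^ b)))%:E =
   (Gamma s / (b * A `^ s))%:E)%E.
Proof.
move=> A0 b0 s0.
have := @pos_power_substitution (gamma_kernel s) A b A0 b0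
  (fun _ h => ltW (gamma_kernel_gt0 s h)) (@gamma_kernel_continuous s)
  (gamma_kernel_integrable s0).
rewrite GammaE// => E.
have bA : 0 < b * A `^ s by rewrite mulr_gt0 ?powR_gt0.
rewrite [Gamma s / _]mulrC EFinM -E -integral_posZl.
- apply: eq_integral => r; rewrite inE in_posE => r0; congr EFin.
  rewrite /gamma_kernel powRM ?powR_ge0 ?(ltW A0)// -powRrM.
  rewrite [A `^ (s - 1)]powRBp// powRr1 ?(ltW A0)//.
  have -> : b * s - 1 = b * (s - 1) + (b - 1) by ring.
  rewrite [r `^ (b * (s - 1) + _)]powRDp//; move: (expR _) => x.
  move: (r `^ _) => y; move: (r `^ _) => z.
  have : A `^ s != 0 by rewrite gt_eqF// powR_gt0.
  move: (A `^ s) => w w0; have A1 : A != 0 by rewrite gt_eqF.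
  have b1 : b != 0 by rewrite gt_eqF.
  by field; rewrite ?w0 ?A1 ?b1.
- by rewrite invr_ge0 ltW.
- apply: pos_continuous_measurable => r r0.
  exact: (@power_substitution_continuous (gamma_kernel s) A b r A0 r0
    (@gamma_kernel_continuous s)).
- move=> r r0; have h : 0 < A * r `^ b by rewrite mulr_gt0 ?powR_gt0.
  by rewrite mulr_ge0 ?(ltW (gamma_kernel_gt0 s h))// !mulr_ge0 ?powR_ge0 ?(ltW A0) ?(ltW b0).
Qed.

Lemma gamma_scalingZ C A b s : 0 <= C -> 0 < A -> 0 < b -> 0 < s ->
  (\int[mu]_(r in pos) (C * (r `^ (b * s - 1) * expR (- (A * r `^ b))))%:E =
   (C * (Gamma s / (b * A `^ s)))%:E)%E.
Proof.
move=> C0 A0 b0 s0; rewrite EFinM -gamma_scaling//; apply: integral_posZl => //.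
  apply: pos_continuous_measurable => r r0; apply: cvgM; first exact: powR_continuous.
  apply: (@continuous_comp _ _ _ (fun z => - (A * z `^ b)) (@expR R)); last exact: continuous_expR.
  by apply: cvgN; apply: cvgMr; exact: powR_continuous.
by move=> r _; rewrite mulr_ge0 ?powR_ge0 ?expR_ge0.
Qed.

Lemma integral_indic_pos g :
  (\int[mu]_t (\1_pos t * g t)%:E = \int[mu]_(t in pos) (g t)%:E)%E.
Proof.
rewrite [RHS]integral_mkcond; apply: eq_integral => t _.
by rewrite patchE indicE; case: ifP; rewrite ?mul1r ?mul0r.
Qed.

Section Beta.
Context (a k : R) (a0 : 0 < a) (k0 : 0 < k).

(** The indicators make [f] a function on the whole plane, as the Tonelli theorem
    for [setT] requires. *)
Let h (z : R * R) : R :=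
  z.1 `^ (2 * a - 1) * z.2 `^ (2 * a - 1) * expR (- ((1 + k * z.1 ^+ 2) * z.2)).

Let f (z : R * R) : \bar R := (\1_pos z.2 * (\1_pos z.1 * h z))%:E.

Let f_ge0 (z : R * R) : (0 <= f z)%E.
Proof. by rewrite lee_fin !mulr_ge0 ?indicE ?powR_ge0 ?expR_ge0. Qed.

Let f_measurable : measurable_fun [set: R * R] f.
Proof.
have m1 : measurable_fun [set: R] (\1_pos : R -> R).
  by apply: measurable_indic; exact: measurable_pos.
have mfst : measurable_fun [set: R * R] (@fst R R) by exact: measurable_fst.
have msnd : measurable_fun [set: R * R] (@snd R R) by exact: measurable_snd.
have mp : measurable_fun [set: R] (@powR R ^~ (2 * a - 1)) by exact: measurable_powR.
apply/measurable_EFinP; apply: measurable_funM; first exact: (measurableT_comp m1 msnd).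
apply: measurable_funM; first exact: (measurableT_comp m1 mfst).
apply: measurable_funM.
  by apply: measurable_funM; [exact: (measurableT_comp mp mfst)|exact: (measurableT_comp mp msnd)].
apply: (measurableT_comp (@measurable_expR R)); apply: measurableT_comp => //.
apply: measurable_funM => //; apply: measurable_funD => //.
by apply: measurable_funM => //; apply: measurable_funX.
Qed.

Lemma bubble_weight_measurable (c : R) :
  measurable_fun pos (fun r => (1 + k * r ^+ 2) `^ c * r `^ (2 * a - 1)).
Proof.
apply: pos_continuous_measurable => r r0; apply: cvgM; last exact: powR_continuous.
exact: (is_derive_continuous_at (bubble_base_derive (ltW k0) c r)).
Qed.

(** Integrate [(r t)^(2 a - 1) exp (- (1 + k r^2) t)] over the quadrant.  Integrating
    first in [t] gives [Gamma (2 a)] times the left-hand side; integrating first in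
    [r] gives [Gamma a / (2 k^a)] times the integrand of [Gamma a]. *)
Lemma beta_rational_integral :
  \int[mu]_(r in pos) ((1 + k * r ^+ 2) `^ (- (2 * a)) * r `^ (2 * a - 1)) =
  k `^ (- a) * (Gamma a ^+ 2 / (2 * Gamma (2 * a))).
Proof.
have A0 r : 0 < 1 + k * r ^+ 2 by rewrite ltr_wpDr// mulr_ge0 ?sqr_ge0// ltW.
have a20 : 0 < 2 * a by rewrite mulr_gt0.
have G0 := Gamma_gt0 a20.
have L : (\int[mu]_r \int[mu]_t f (r, t) = \int[mu]_(r in pos)
   (Gamma (2 * a) * ((1 + k * r ^+ 2) `^ (- (2 * a)) * r `^ (2 * a - 1)))%:E)%E.
  rewrite -integral_indic_pos; apply: eq_integral => r _; rewrite integral_indic_pos /=.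
  rewrite indicE; have [r0|r0] := boolP (r \in pos); last first.
    by rewrite mul0r; apply: integral0_eq => t _; rewrite mul0r.
  have := gamma_scalingZ (powR_ge0 r (2 * a - 1)) (A0 r) ltr01 a20.
  rewrite !mul1r => E; transitivity ((r `^ (2 * a - 1) * (Gamma (2 * a) / (1 + k * r ^+ 2) `^ (2 * a)))%:E).
    rewrite -E; apply: eq_integral => t; rewrite inE in_posE => t0.
    by rewrite /h /= powRr1 ?(ltW t0)// mul1r mulrA.
  by rewrite powRN; congr EFin; ring.
have M : (\int[mu]_t \int[mu]_r f (r, t) = (Gamma a / (2 * k `^ a) * Gamma a)%:E)%E.
  transitivity (\int[mu]_(t in pos) (Gamma a / (2 * k `^ a) * gamma_kernel a t)%:E)%E; last first.
    rewrite EFinM -GammaE//; apply: integral_posZl.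
    - by apply: divr_ge0; [exact: ltW (Gamma_gt0 a0)|rewrite mulr_ge0// powR_ge0].
    - by apply: pos_continuous_measurable => t; exact: gamma_kernel_continuous.
    - by move=> t t0; rewrite ltW// gamma_kernel_gt0.
  rewrite -integral_indic_pos; apply: eq_integral => t _ /=.
  transitivity (\int[mu]_r (\1_pos r * (\1_pos t * h (r, t)))%:E)%E.
    by apply: eq_integral => r _; rewrite /f /= mulrCA.
  rewrite integral_indic_pos /=.
  rewrite indicE; have [t0|t0] := boolP (t \in pos); last first.
    by rewrite mul0r; apply: integral0_eq => r _; rewrite mul0r.
  move: t0; rewrite inE in_posE => t0.
  have kt : 0 < k * t by rewrite mulr_gt0.
  have C0 : 0 <= t `^ (2 * a - 1) * expR (- t) by rewrite mulr_ge0 ?powR_ge0 ?expR_ge0.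
  have := gamma_scalingZ C0 kt (ltr0n _ 2 : 0 < 2) a0.
  rewrite !mul1r => E; transitivity ((t `^ (2 * a - 1) * expR (- t) * (Gamma a / (2 * (k * t) `^ a)))%:E).
    rewrite -E; apply: eq_integral => r; rewrite inE in_posE => r0.
    rewrite /h /= mul1r powR_mulrn ?(ltW r0)//.
    have -> : - ((1 + k * r ^+ 2) * t) = - t + - (k * t * r ^+ 2) by ring.
    by rewrite expRD; congr EFin; rewrite (mulrC (r `^ _) (t `^ _)) mulrACA.
  congr EFin; rewrite powRM ?(ltW k0) ?(ltW t0)// /gamma_kernel.
  rewrite (_ : 2 * a - 1 = a + (a - 1)); last by ring.
  rewrite powRDp//; have ta : t `^ a != 0 by rewrite gt_eqF// powR_gt0.
  have ka : k `^ a != 0 by rewrite gt_eqF// powR_gt0.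
  move: (t `^ a) (t `^ (a - 1)) (expR _) (k `^ a) ta ka => x y z w ta ka.
  by field; rewrite ta ka.
pose w r := (1 + k * r ^+ 2) `^ (- (2 * a)) * r `^ (2 * a - 1).
have w0 r : 0 < r -> 0 <= Gamma (2 * a) * w r.
  by move=> r0; rewrite /w !mulr_ge0 ?powR_ge0// ltW.
have mw : measurable_fun pos (fun r => Gamma (2 * a) * w r).
  by apply: measurable_funM => //; exact: bubble_weight_measurable.
have LM : (\int[mu]_(r in pos) (Gamma (2 * a) * w r)%:E =
    (Gamma a / (2 * k `^ a) * Gamma a)%:E)%E.
  by rewrite -M -L; exact: (@fubini_tonelli _ _ _ _ R mu mu f f_measurable f_ge0).
transitivity (\int[mu]_(r in pos) ((Gamma (2 * a))^-1 * (Gamma (2 * a) * w r))).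
  by apply: eq_Rintegral => r _; rewrite mulKf// gt_eqF.
rewrite /Rintegral integral_posZl//; last by rewrite invr_ge0 ltW.
rewrite LM /= powRN.
have ka : k `^ a != 0 by rewrite gt_eqF// powR_gt0.
have Ga : Gamma (2 * a) != 0 by rewrite gt_eqF.
move: (Gamma a) (Gamma (2 * a)) (k `^ a) ka Ga => x y z z0 y0.
by field; rewrite z0 y0.
Qed.

End Beta.
End GammaIntegrals.

(** * The best constant *)

Section BestConstant.
Context (R : realType) (al : R) (al3 : 3 < al) (u : R -> R).
Context (umin : minimizer al u) (l : R) (ul : u r @[r --> 0^'+] --> l).

Local Notation mu := (@lebesgue_measure R).
Local Notation pos := (`]0, +oo[ : set R).
Local Notation p := (crit_exp al).
Local Notation lam := (multiplier al u).

Let k := Num.sqrt (lam * `|l| `^ (p - 2) / P2 al).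

Let k0 : 0 <= k. Proof. exact: sqrtr_ge0. Qed.

Let kE : k ^+ 2 * P2 al = lam * `|l| `^ (p - 2).
Proof.
rewrite sqr_sqrtr; first by rewrite divfK// gt_eqF// P2_gt0.
apply: divr_ge0; last exact: ltW (P2_gt0 al3).
by apply: mulr_ge0; [exact: multiplier_ge0|exact: powR_ge0].
Qed.

(** Both functions are bounded solutions of the same radial system with the same value
    at the origin. *)
Theorem minimizer_is_bubble r : 0 < r -> u r = bubble al k l r.
Proof.
move=> r0; have p2 := crit_exp_gt2 al3; have lam0 := multiplier_ge0 al u.
have [M [D [N [d sol]]]] := minimizer_radial_solution al3 umin ul.
have [K K0 uK] := minimizer_bounded al3 umin ul.
have sol' := bubble_radial_solution al3 k0 (f := fun x => lam * signed_power p x)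
  (fun z _ => bubble_critical z al3 k0 kE).
have lK : `|l| <= Num.max K `|l| by rewrite le_max lexx orbT.
have KK : K <= Num.max K `|l| by rewrite le_max lexx.
apply: (radial_solution_unique _ _ _ _ sol sol' (K := Num.max K `|l|)
  (L := lam * ((p - 1) * Num.max K `|l| `^ (p - 2)))) => //.
- by move: al3; lra.
- by move=> x z xz; apply: ler_wpM2l => //; exact: signed_power_le.
- by apply: mulr_ge0 => //; apply: mulr_ge0; [lra|exact: powR_ge0].
- move=> x y xK yK; rewrite -mulrBr normrM (ger0_norm lam0) -mulrA.
  by apply: ler_wpM2l => //; exact: signed_power_lipschitz.
- by move=> z z0; apply: le_trans KK; exact: uK.
- by move=> z z0; apply: le_trans lK; exact: bubble_bounded.
Qed.

(** Otherwise [u] is the constant [l], which decays at infinity only if it is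
    zero. *)
Let k_gt0 : 0 < k.
Proof.
rewrite lt_neqAle k0 andbT eq_sym; apply/negP => /eqP kz.
have [[[Xu _] [r r0 ur]] _] := umin.
have uE z : 0 < z -> u z = l.
  move=> z0; rewrite minimizer_is_bubble// /bubble kz mul0r addr0 powR1 mulr1//.
have [C C0 HC] := minimizer_decay al3 umin.
have g0 : (3 - al) / 2 < 0 by move: al3; lra.
have lim : C * z `^ ((3 - al) / 2) @[z --> +oo] --> C * 0.
  by apply: cvgMr; exact: powR_cvg_pinfty0.
have : `|l| <= C * 0.
  apply: (cvgr_to_ge lim); near=> z.
  have z0 : 0 < z by near: z; exact: nbhs_pinfty_gt.
  by rewrite -(uE z z0) HC.
rewrite mulr0 normr_le0 => /eqP lz.
by move: ur; rewrite uE// lz eqxx.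
Unshelve. all: by end_near. Qed.

Let l_neq0 : 0 < `|l|.
Proof.
rewrite normr_gt0; apply/eqP => lz; have p2 := crit_exp_gt2 al3.
have := kE; rewrite lz normr0 powR0; last by rewrite gt_eqF; lra.
by move/eqP; rewrite mulr0 gt_eqF// mulr_gt0 ?exprn_gt0// P2_gt0.
Qed.

Local Notation a := ((al + 1) / 2).
Let I0 := Gamma a ^+ 2 / (2 * Gamma (al + 1)).

Let a_gt0 : 0 < a. Proof. by move: al3; lra. Qed.

Let I0_gt0 : 0 < I0.
Proof.
by rewrite divr_gt0 ?mulr_gt0 ?exprn_gt0 ?Gamma_gt0//; move: al3; lra.
Qed.

Lemma minimizer_mass : mass al u = `|l| `^ p * (k `^ (- a) * I0).
Proof.
have a2 : 2 * a = al + 1 by field.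
have Ga : Gamma (al + 1) = Gamma (2 * a) by rewrite a2.
rewrite /I0 Ga -(beta_rational_integral a_gt0 k_gt0).
transitivity (\int[mu]_(r in pos) (`|l| `^ p *
    ((1 + k * r ^+ 2) `^ (- (2 * a)) * r `^ (2 * a - 1)))).
  apply: eq_Rintegral => r; rewrite inE in_posE => r0.
  rewrite minimizer_is_bubble// /bubble normrM (ger0_norm (powR_ge0 _ _)).
  rewrite powRM ?powR_ge0// -powRrM -mulrA a2 addrK.
  congr (_ * (_ `^ _ * _)); rewrite crit_expE//.
  by field; move: al3; lra.
apply: Rintegral_posZl; first by rewrite powR_gt0.
  exact: bubble_weight_measurable.
by move=> r _; rewrite mulr_ge0 ?powR_ge0.
Qed.

(** The mass enters [multiplier] with the exponent [2 / p - 1 = - 4 / (al + 1)], for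
    which the powers of [|l|] and [k] cancel against those in
    [k^2 P2 = lam |l|^(p - 2)]. *)
Theorem best_constantE : energy al u u / mass al u `^ (2 / p) =
  P2 al * I0 `^ (4 / (al + 1)).
Proof.
set S := LHS; have p2 := crit_exp_gt2 al3.
have al1 : al + 1 != 0 by rewrite gt_eqF//; move: al3; lra.
have al31 : al - 3 != 0 by rewrite gt_eqF//; move: al3; lra.
have := kE; rewrite /multiplier -/S minimizer_mass.
have powE q : (`|l| `^ p * (k `^ (- a) * I0)) `^ q =
    `|l| `^ (p * q) * (k `^ (- a * q) * I0 `^ q).
  move: I0 I0_gt0 => I /ltW I_ge0.
  by rewrite powRM ?mulr_ge0 ?powR_ge0// [(_ * I) `^ q]powRM ?powR_ge0// -!powRrM.
rewrite powE.
rewrite (_ : p * (2 / p - 1) = - (p - 2)); last by field; rewrite gt_eqF//; lra.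
rewrite (_ : - a * (2 / p - 1) = 2%:R); last first.
  by rewrite /crit_exp; field; rewrite ?al1 ?al31.
rewrite (_ : 2 / p - 1 = - (4 / (al + 1))); last first.
  by rewrite /crit_exp; field; rewrite ?al1 ?al31.
rewrite !powRN powR_mulrn//.
have : `|l| `^ (p - 2) != 0 by rewrite gt_eqF// powR_gt0.
have : I0 `^ (4 / (al + 1)) != 0 by rewrite gt_eqF// powR_gt0.
have : k ^+ 2 != 0 by rewrite gt_eqF// exprn_gt0.
move: (`|l| `^ _) (I0 `^ _) (k ^+ 2) (P2 al) S => x y z w S z0 y0 x0 H.
apply: (mulfI z0); rewrite mulrA H.
by field; rewrite x0 y0.
Qed.

End BestConstant.

Theorem corollary1p5 (R : realType) (alpha : R) (halpha : 3 < alpha)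
  (hmin : exists u : R -> R, minimizer alpha u /\ nonsingular0 u) :
  (S2 alpha `^ (- 2^-1))%E =
  (P2 alpha `^ (- 2^-1) *
   (2 * Gamma (alpha + 1) /
      (Gamma ((alpha + 1) / 2) * Gamma ((alpha + 1) / 2)))
     `^ (2 / (alpha + 1)))%:E.
Proof.
have [u [umin [l ul]]] := hmin.
rewrite (S2E halpha umin) (best_constantE halpha umin ul) poweR_EFin; congr EFin.
have G1 : 0 < Gamma (alpha + 1) by apply: Gamma_gt0; lra.
have G2 : 0 < Gamma ((alpha + 1) / 2) by apply: Gamma_gt0; lra.
rewrite powRM ?powR_ge0 ?(ltW (P2_gt0 halpha))//; congr (_ * _).
have al1 : alpha + 1 != 0 by rewrite lt0r_neq0//; lra.
rewrite -powRrM (_ : 4 / (alpha + 1) * - 2^-1 = - 1 * (2 / (alpha + 1))); last by field.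
move: (Gamma (alpha + 1)) (Gamma ((alpha + 1) / 2)) G1 G2 => x y x0 y0.
have I0 : 0 <= y ^+ 2 / (2 * x) by rewrite divr_ge0 ?exprn_ge0 ?mulr_ge0 ?(ltW x0) ?(ltW y0).
by rewrite powRrM powR_inv1// invf_div expr2.
Qed.
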